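(* Let $0<a\leq 1$ and let $N$ be an odd positive integer. Put $A_{N,j}(y):=\pi(2\pi y)^{\frac{1}{N}}e^{\frac{i\pi j}{N}}$. Then for $x>0$, \begin{align*} &\sum_{n=1}^{\infty}\frac{\exp(-an^{N}x)}{n(1-\exp(-n^{N}x))}\\ &=\frac{\zeta(N+1)}{x}+\frac{1}{N}\left(\left(\tfrac{1}{2}-a\right)\left((N-1)\gamma-\log x\right)+\log\Gamma(a)-\tfrac{1}{2}\log 2\pi\right)\\ &\quad+(-1)^{\frac{N+3}{2}}2^{N}\pi^{N+1}\sum_{j=1}^{\left\lfloor\frac{N+1}{2N}\right\rfloor}\left(\frac{-1}{4\pi^2}\right)^{jN}\frac{B_{2j}(a)B_{N+1-2jN}}{(2j)!(N+1-2jN)!}x^{2j-1}\\ &\quad+\frac{(-1)^{\frac{N+3}{2}}}{N}\sum_{j=-\frac{N-1}{2}}^{\frac{N-1}{2}}(-1)^j\bigg\{\sum_{n=1}^{\infty}\frac{\cos(2\pi na)}{n\left(\exp\left(2A_{N,j}\left(\frac{n}{x}\right)\right)-1\right)}\\ &\quad+\frac{(-1)^{j+\frac{N+1}{2}}}{\pi}\sum_{n=1}^{\infty}\frac{\sin(2\pi na)}{n}\left\{\log\left(\tfrac{1}{\pi}A_{N,j}\left(\tfrac{n}{x}\right)\right)-\tfrac{1}{2}\left(\psi\left(\tfrac{i}{\pi}A_{N,j}\left(\tfrac{n}{x}\right)\right)+\psi\left(-\tfrac{i}{\pi}A_{N,j}\left(\tfrac{n}{x}\right)\right)\right)\right\}\bigg\}.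 \end{align*} Equivalently, if $\alpha,\beta>0$ with $\alpha\beta^{N}=\pi^{N+1}$, then \begin{align*} &\sum_{n=1}^{\infty}\frac{\exp(-a(2n)^{N}\alpha)}{n(1-\exp(-(2n)^{N}\alpha))}-\frac{(-1)^{\frac{N+3}{2}}}{N}\sum_{j=-\frac{N-1}{2}}^{\frac{N-1}{2}}(-1)^{j}\bigg(\sum_{n=1}^{\infty}\frac{\cos(2\pi na)}{n\left(\exp\left((2n)^{\frac{1}{N}}\beta e^{\frac{i\pi j}{N}}\right)-1\right)}\\ &\quad+\frac{(-1)^{j+\frac{N+1}{2}}}{\pi}\sum_{n=1}^{\infty}\frac{\sin(2\pi na)}{n}\left\{\log\left(\tfrac{\beta}{2\pi}(2n)^{\frac{1}{N}}e^{\frac{i\pi j}{N}}\right)-\frac{1}{2}\left(\psi\left(\tfrac{i\beta}{2\pi}(2n)^{\frac{1}{N}}e^{\frac{i\pi j}{N}}\right)+\psi\left(\tfrac{-i\beta}{2\pi}(2n)^{\frac{1}{N}}e^{\frac{i\pi j}{N}}\right)\right)\right\}\bigg)\\ &=\frac{1}{N}\left((a-1)\log(2\pi)+\log\Gamma(a)\right)+\left(a-\frac{1}{2}\right)\left\{\frac{(N-1)(\log 2-\gamma)}{N}+\frac{\log(\alpha/\beta)}{N+1}\right\}\\ &\quad+(-1)^{\frac{N+3}{2}}\sum_{j=0}^{\left\lfloor\frac{N+1}{2N}\right\rfloor}\frac{(-1)^jB_{2j}(a)B_{N+1-2Nj}}{(2j)!(N+1-2Nj)!}\alpha^{\frac{2j}{N+1}}\beta^{N-\frac{2N^2j}{N+1}}.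 \end{align*}
   Context: $\gamma$ is Euler's constant, $\zeta$ the Riemann zeta function, $B_j(a)$ Bernoulli polynomials ($\sum_{j\ge0}B_j(a)z^j/j!=ze^{az}/(e^z-1)$), $B_j=B_j(1)$, $\psi=\Gamma'/\Gamma$ the digamma function, and $\log$ the principal branch. Sums over $j$ run through integers; empty sums are $0$. *)

(* Defs.v *)
From Stdlib Require Import Reals ZArith Arith List ClassicalEpsilon.
From Coquelicot Require Import Coquelicot.
Open Scope R_scope.

Definition Cexp (z : C) : C :=
  (exp (Re z) * cos (Im z), exp (Re z) * sin (Im z)).

(* principal argument, in (-PI, PI] (and 0 at 0) *)
Definition Carg (z : C) : R :=
  let x := Re z in let y := Im z in
  if Rlt_dec 0 x then atan (y / x)
  else if Rlt_dec x 0 then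
         (if Rle_dec 0 y then atan (y / x) + PI else atan (y / x) - PI)
  else if Rlt_dec 0 y then PI / 2
  else if Rlt_dec y 0 then - (PI / 2) else 0.

Definition Clog (z : C) : C := (ln (Cmod z), Carg z).

Definition CLim (u : nat -> C) : C :=
  (real (Lim_seq (fun n => Re (u n))), real (Lim_seq (fun n => Im (u n)))).

Definition CSeries (u : nat -> C) : C :=
  (Series (fun n => Re (u n)), Series (fun n => Im (u n))).

Definition Csum_Z (lo hi : Z) (f : Z -> C) : C :=
  if Z.ltb hi lo then RtoC 0
  else sum_n (fun k => f (lo + Z.of_nat k)%Z) (Z.to_nat (hi - lo)).

Fixpoint Cpochhammer_prod (z : C) (n : nat) : C :=
  match n with
  | O => z
  | S m => Cmult (Cpochhammer_prod z m) (Cplus z (RtoC (INR (S m))))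
  end.

(* Euler--Gauss definition of the Gamma function on C:
   Gamma(z) = lim_{n -> oo} n! n^z / (z (z+1) ... (z+n)) *)
Definition CGamma (z : C) : C :=
  CLim (fun n => Cdiv (Cmult (RtoC (INR (fact n))) (Cexp (Cmult z (RtoC (ln (INR n))))))
                      (Cpochhammer_prod z n)).

Definition CDeriv (f : C -> C) (z : C) : C :=
  epsilon (inhabits (RtoC 0)) (fun l => is_derive f z l).

Definition digamma (z : C) : C := Cdiv (CDeriv CGamma z) (CGamma z).

Definition euler_gamma : R :=
  real (Lim_seq (fun n => sum_n_m (fun k => / INR k) 1 n - ln (INR n))).

(* Riemann zeta at a real s (used for s = N+1 > 1) : sum_{n>=1} n^{-s} *)
Definition zeta (s : R) : R := Series (fun n => / Rpower (INR (S n)) s).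

Definition binomR (n k : nat) : R := INR (fact n) / (INR (fact k) * INR (fact (n - k))).

(* bern_list a m = [B_0(a); ...; B_m(a)], from the coefficient identities of
   (e^z - 1) * (sum_j B_j(a) z^j / j!) = z e^{a z}, namely
   sum_{k=0}^{m-1} binom(m,k) B_k(a) = m a^(m-1)  for m >= 1. *)
Fixpoint bern_list (a : R) (m : nat) : list R :=
  match m with
  | O => 1 :: nil
  | S m' =>
      let l := bern_list a m' in
      l ++ (a ^ (S m') -
            / INR (S (S m')) *
            sum_n (fun k => binomR (S (S m')) k * nth k l 0) m') :: nil
  end.

Definition bernoulli_poly (j : nat) (a : R) : R := nth j (bern_list a j) 0.

Definition bernoulli (j : nat) : R := bernoulli_poly j 1.

Definition A_Nj (N : nat) (j : Z) (y : R) : C :=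
  Cmult (RtoC (PI * Rpower (2 * PI * y) (/ INR N))) (Cexp (0, PI * IZR j / INR N)).

(* Main.v *)
Require Import Defs.
From Stdlib Require Import Reals ZArith Arith List Lra Lia ClassicalEpsilon.
From Coquelicot Require Import Coquelicot.
Open Scope R_scope.

(** Idea of the proof, for N = 2h + 1, t_n = n^N x and 0 < a < 1. The partial fraction expansion
    exp(-at)/(1 - exp(-t)) = 1/t + sum_m (2t cos(2 pi m a) + 4 pi m sin(2 pi m a))/(t^2 + 4 pi^2 m^2)
    holds because e^(ta) times the right-hand side has derivative e^(ta) D_M(a) in a, D_M the Dirichlet
    kernel; the constant is read off the jump at the integers.  Summing over t = t_n with weights 1/n, the
    order of summation may be exchanged: after Abel summation in m the double series is dominated.  The
    inner sums over n split by partial fractions over the N-th roots of unity into sums of w/(n^2 + w^2),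
    which are hyperbolic cotangents, and of n/(n^2 + w^2), which are digamma pairs; here w = A_{N,j}/pi.

    What remains is Kummer's Fourier series of log Gamma.  It comes out of the case N = 1 as x -> 0: the
    left-hand side L(a) is convex in a and L(a+1) - L(a) = log(1 - exp(-ax)), so a Bohr-Mollerup sandwich
    identifies the limit up to an additive constant.  Both sides extend continuously to a = 1, and the
    self-dual point a = N = 1, x = 2 pi yields the constant.  The Bernoulli terms come from the power series
    of the same partial fraction expansion, and the second form is the substitution x = 2^N alpha. *)

(** * Dominated convergence and Abel summation *)

(** The definitions shape the argument. [CGamma] is an Euler-Gauss limit and [digamma] rests on a
    derivative chosen by [epsilon], so Gamma has to be shown differentiable: the finite Gauss
    quotient at z + h factors exactly into the one at z, an exponential exp(h psi_n(z)) and a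
    Weierstrass product equal to 1 + O(h^2). Integrals never occur; an explicit corrector absorbs
    the Dirichlet kernel and the mean value inequality does the rest. The bounds from Abel summation
    are of order 1/sin(pi a), so a = 1 is reached only as a limit, and only after Kummer's formula
    has exchanged a cosine series that diverges at a = 1 for log Gamma. For odd N the arguments pi
    j/N with |j| <= (N-1)/2 lie strictly between -pi/2 and pi/2. Hence w stays in the open right
    half-plane, off the poles of both kernels, and log w is principal. The digamma pair differs from
    log w by O(1/|w|) with |w| of order m^(1/N), which makes the transformed series absolutely
    convergent. The constant in Kummer's formula stays an unknown until the transformation, with
    that unknown in it, holds at a = 1. *)

Lemma sum_n_S (u : nat -> R) (n : nat) : sum_n u (S n) = sum_n u n + u (S n).
Proof. apply (sum_Sn (G := R_AbelianGroup)). Qed.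

Lemma sum_n_Rmult_l (c : R) (u : nat -> R) (n : nat) : sum_n (fun k => c * u k) n = c * sum_n u n.
Proof. apply (sum_n_mult_l (K := R_Ring)). Qed.

Lemma sum_n_Rplus (u v : nat -> R) (n : nat) : sum_n (fun k => u k + v k) n = sum_n u n + sum_n v n.
Proof. apply (sum_n_plus (G := R_AbelianGroup)). Qed.

Lemma ex_series_Rabs_le (f V : nat -> R) :
  (forall n, Rabs (f n) <= V n) -> ex_series V -> ex_series f.
Proof. intros H HV. apply (ex_series_le f V); auto. Qed.

Lemma Series_Rabs_le (f V : nat -> R) :
  (forall n, Rabs (f n) <= V n) -> ex_series V -> Rabs (Series f) <= Series V.
Proof.
  intros H HV.
  apply Rle_trans with (Series (fun n => Rabs (f n))).
  - apply Series_Rabs. apply ex_series_Rabs_le with V; auto.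
    intros n; rewrite Rabs_Rabsolu; auto.
  - apply Series_le; auto. intros n; split; auto. apply Rabs_pos.
Qed.

Lemma is_lim_seq_Rabs_sub_0 (u : nat -> R) (l : R) :
  is_lim_seq (fun n => Rabs (u n - l)) 0 -> is_lim_seq u l.
Proof.
  intros H.
  apply is_lim_seq_abs_0 in H.
  apply is_lim_seq_ext with (fun n => (u n - l) + l); [intros; ring|].
  replace (Finite l) with (Rbar_plus 0 l) by (simpl; f_equal; ring).
  apply is_lim_seq_plus' with (l1 := 0) (l2 := l); auto. apply is_lim_seq_const.
Qed.

Lemma is_lim_seq_sub_Rabs_0 (u : nat -> R) (l : R) :
  is_lim_seq u l -> is_lim_seq (fun n => Rabs (u n - l)) 0.
Proof.
  intros H. apply -> is_lim_seq_abs_0.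
  replace (Finite 0) with (Finite (l - l)) by (f_equal; ring).
  apply is_lim_seq_minus'; auto. apply is_lim_seq_const.
Qed.

Lemma is_lim_seq_squeeze_0 (u v : nat -> R) (l : R) :
  (forall n, Rabs (u n - l) <= v n) -> is_lim_seq v 0 -> is_lim_seq u l.
Proof.
  intros H Hv. apply is_lim_seq_Rabs_sub_0.
  apply is_lim_seq_le_le with (fun _ => 0) v; auto.
  - intros n; split; auto. apply Rabs_pos.
  - apply is_lim_seq_const.
Qed.

Lemma is_series_is_lim_seq (f : nat -> R) (l : R) : is_series f l <-> is_lim_seq (sum_n f) l.
Proof. reflexivity. Qed.

Lemma is_series_cons (a : nat -> R) (l : R) : is_series (fun k => a (S k)) l -> is_series a (a 0%nat + l).
Proof.
  intros H. apply is_series_decr_1.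
  match goal with |- is_series _ ?x => replace x with l; auto end.
  unfold plus, opp; simpl. ring.
Qed.

Lemma Series_tail_lim (V : nat -> R) :
  ex_series V -> is_lim_seq (fun M => Series (fun k => V (S M + k)%nat)) 0.
Proof.
  intros HV.
  apply is_lim_seq_ext with (fun M => Series V - sum_n V M).
  - intros M. rewrite (Series_incr_n V (S M)); auto; [|lia]. simpl pred. rewrite sum_n_Reals. ring.
  - replace (Finite 0) with (Finite (Series V - Series V)) by (f_equal; ring).
    apply is_lim_seq_minus'; [apply is_lim_seq_const|].
    apply Series_correct in HV. exact HV.
Qed.

Lemma is_lim_seq_sum_f_R0 (f : nat -> nat -> R) (g : nat -> R) (M : nat) :
  (forall n, is_lim_seq (fun p => f p n) (g n)) ->
  is_lim_seq (fun p => sum_f_R0 (f p) M) (sum_f_R0 g M).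
Proof.
  intros H. induction M; simpl; auto. apply is_lim_seq_plus'; auto.
Qed.

(** Cut where the tail of [V] is below eps/4: each of the two tails is then below eps/4, and the
    finite heads converge termwise. The bound by [V] passes to the limit, which makes [g]
    summable. *)
Lemma tannery (f : nat -> nat -> R) (g V : nat -> R) :
  (forall p n, Rabs (f p n) <= V n) -> ex_series V ->
  (forall n, is_lim_seq (fun p => f p n) (g n)) ->
  ex_series g /\ is_lim_seq (fun p => Series (f p)) (Series g).
Proof.
  intros Hf HV Hl.
  assert (Hg : forall n, Rabs (g n) <= V n).
  { intros n. apply (is_lim_seq_le (fun p => Rabs (f p n)) (fun _ => V n) (Rabs (g n)) (V n)); auto.
    - apply (is_lim_seq_abs _ (g n)); auto.
    - apply is_lim_seq_const. }
  assert (Eg : ex_series g) by (apply ex_series_Rabs_le with V; auto).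
  split; auto.
  apply is_lim_seq_spec. intros eps.
  pose proof (Series_tail_lim V HV) as HT. apply is_lim_seq_spec in HT.
  assert (He : 0 < eps / 4) by (destruct eps; simpl; lra).
  destruct (HT (mkposreal _ He)) as [M HM]. specialize (HM M (le_n M)). simpl in HM.
  assert (HF := is_lim_seq_sum_f_R0 f g M Hl). apply is_lim_seq_spec in HF.
  destruct (HF (mkposreal _ He)) as [P HP]. exists P. intros p Hp. specialize (HP p Hp). simpl in HP.
  assert (Ef : ex_series (f p)) by (apply ex_series_Rabs_le with V; auto).
  assert (ET : ex_series (fun k => V (S M + k)%nat)) by (apply (ex_series_incr_n V (S M)); auto).
  rewrite (Series_incr_n (f p) (S M)), (Series_incr_n g (S M)); auto; try lia.
  simpl pred.
  assert (H1 := Series_Rabs_le (fun k => f p (S M + k)%nat) _ (fun k => Hf p (S M + k)%nat) ET).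
  assert (H2 := Series_Rabs_le (fun k => g (S M + k)%nat) _ (fun k => Hg (S M + k)%nat) ET).
  rewrite Rminus_0_r in HM.
  apply Rabs_def2 in HM. apply Rabs_def2 in HP. apply Rabs_le_between in H1. apply Rabs_le_between in H2.
  simpl in *. apply Rabs_def1; lra.
Qed.

Lemma Series_sum_n (f : nat -> nat -> R) (p : nat) :
  (forall m, ex_series (fun n => f n m)) ->
  is_series (fun n => sum_n (f n) p) (sum_n (fun m => Series (fun n => f n m)) p).
Proof.
  intros H. induction p.
  - rewrite sum_O. apply is_series_ext with (fun n => f n 0%nat).
    + intros; now rewrite sum_O.
    + now apply Series_correct.
  - rewrite sum_Sn. apply is_series_ext with (fun n => plus (sum_n (f n) p) (f n (S p))).
    + intros; now rewrite sum_Sn.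
    + apply (is_series_plus (V := R_NormedModule)); auto. now apply Series_correct.
Qed.

(* Only the partial sums in [m] need to be dominated, so conditionally convergent inner series are allowed. *)
Lemma series_swap_dominated (f : nat -> nat -> R) (g V : nat -> R) :
  (forall m, ex_series (fun n => f n m)) ->
  (forall n p, Rabs (sum_n (f n) p) <= V n) -> ex_series V ->
  (forall n, is_series (f n) (g n)) ->
  ex_series g /\ is_series (fun m => Series (fun n => f n m)) (Series g).
Proof.
  intros Hc Hb HV Hg.
  destruct (tannery (fun p n => sum_n (f n) p) g V) as [E L]; auto.
  split; auto. apply is_series_is_lim_seq.
  apply (is_lim_seq_ext (fun p => Series (fun n => sum_n (f n) p))); auto.
  intros p. apply is_series_unique. now apply Series_sum_n.
Qed.

Lemma sum_n_Rabs_le (f V : nat -> R) (p : nat) :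
  (forall n, Rabs (f n) <= V n) -> Rabs (sum_n f p) <= sum_n V p.
Proof.
  intros H. induction p.
  - rewrite !sum_O; auto.
  - rewrite !sum_Sn. apply Rle_trans with (Rabs (sum_n f p) + Rabs (f (S p))).
    apply Rabs_triang. apply Rplus_le_compat; auto.
Qed.

Lemma sum_n_le_is_series (V : nat -> R) (l : R) (p : nat) :
  (forall n, 0 <= V n) -> is_series V l -> sum_n V p <= l.
Proof.
  intros H HV. apply (is_lim_seq_incr_compare (sum_n V) l HV).
  intros n. rewrite sum_Sn. specialize (H (S n)). unfold plus; simpl; lra.
Qed.

Lemma abel_identity (d k : nat -> R) (p : nat) :
  sum_n (fun m => d m * k m) (S p) =
  sum_n d (S p) * k (S p) + sum_n (fun m => sum_n d m * (k m - k (S m))) p.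
Proof.
  induction p.
  - rewrite !sum_Sn, !sum_O. unfold plus; simpl. ring.
  - rewrite sum_Sn, IHp. rewrite (sum_Sn d (S p)), (sum_Sn (fun m => sum_n d m * (k m - k (S m))) p).
    unfold plus; simpl. ring.
Qed.

(** The steps of [k] are bounded one by one through [B], which covers kernels that first rise and
    then fall; [b] bounds both the size and the total variation. *)
Lemma abel_bound (d k B : nat -> R) (D b : R) (p : nat) :
  (forall m, Rabs (sum_n d m) <= D) ->
  (forall m, Rabs (k m) <= b) ->
  (forall m, Rabs (k m - k (S m)) <= B m) ->
  (forall m, sum_n B m <= b) ->
  Rabs (sum_n (fun m => d m * k m) p) <= 2 * D * b.
Proof.
  intros HD Hk HB Hs.
  assert (D0 : 0 <= D) by (apply Rle_trans with (2 := HD 0%nat); apply Rabs_pos).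
  assert (b0 : 0 <= b) by (apply Rle_trans with (2 := Hk 0%nat); apply Rabs_pos).
  assert (Db : 0 <= D * b) by now apply Rmult_le_pos.
  destruct p.
  - rewrite sum_O, Rabs_mult. specialize (HD 0%nat). rewrite sum_O in HD.
    apply Rle_trans with (D * b); [|lra].
    apply Rmult_le_compat; auto using Rabs_pos.
  - rewrite abel_identity. eapply Rle_trans; [apply Rabs_triang|].
    rewrite Rabs_mult.
    assert (H1 : Rabs (sum_n d (S p)) * Rabs (k (S p)) <= D * b) by (apply Rmult_le_compat; auto using Rabs_pos).
    assert (H2 : Rabs (sum_n (fun m => sum_n d m * (k m - k (S m))) p) <= D * b).
    { apply Rle_trans with (sum_n (fun m => D * B m) p).
      - apply sum_n_Rabs_le. intros m. rewrite Rabs_mult. apply Rmult_le_compat; auto using Rabs_pos.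
      - rewrite sum_n_Rmult_l. apply Rmult_le_compat_l; auto. }
    lra.
Qed.

(** * Trigonometric sums *)

Lemma INR_S_pos (n : nat) : 0 < INR (S n).
Proof. apply lt_0_INR; lia. Qed.

Lemma INR_S_ge_1 (n : nat) : 1 <= INR (S n).
Proof. change 1 with (INR 1). apply le_INR; lia. Qed.

Lemma inv_S_pow_pos (n k : nat) : 0 < / INR (S n) ^ k.
Proof. apply Rinv_0_lt_compat, pow_lt, INR_S_pos. Qed.

Lemma MVT_bound (f f' : R -> R) (b c K : R) :
  (forall u, Rmin b c <= u <= Rmax b c -> is_derive f u (f' u)) ->
  (forall u, Rmin b c <= u <= Rmax b c -> Rabs (f' u) <= K) ->
  Rabs (f c - f b) <= K * Rabs (c - b).
Proof.
  intros Hd HK.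
  destruct (MVT_gen f b c f') as [u [Hu E]].
  - intros; apply Hd; lra.
  - intros u Hu. apply continuity_pt_filterlim. apply (ex_derive_continuous f u).
    eexists; eauto.
  - rewrite E, Rabs_mult. apply Rmult_le_compat_r; auto using Rabs_pos.
Qed.

Lemma INR_2n3 (M : nat) : INR (2 * M + 3) = 2 * INR (S M) + 1.
Proof. replace (2 * M + 3)%nat with (S (S (S (M + M)))) by lia. rewrite !S_INR, plus_INR. ring. Qed.

(** The factor 2 sin(pi a) makes the sum telescope. The frequencies are 1, ..., M + 1, so the last
    half-integer frequency is (2M + 3)/2. *)
Lemma sum_cos_2 (a : R) (M : nat) :
  2 * sin (PI * a) * sum_n (fun k => cos (2 * PI * INR (S k) * a)) M =
  sin (INR (2 * M + 3) * PI * a) - sin (PI * a).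
Proof.
  induction M.
  - rewrite sum_O. simpl INR.
    replace ((1 + 1 + 1) * PI * a) with (2 * PI * 1 * a + PI * a) by ring.
    pose proof (sin_minus (2 * PI * 1 * a) (PI * a)) as E.
    replace (2 * PI * 1 * a - PI * a) with (PI * a) in E by ring.
    rewrite sin_plus. lra.
  - rewrite sum_n_S, Rmult_plus_distr_l, IHM.
    replace (INR (2 * M + 3) * PI * a) with (2 * PI * INR (S (S M)) * a - PI * a) by (rewrite INR_2n3, !S_INR; ring).
    replace (INR (2 * S M + 3) * PI * a) with (2 * PI * INR (S (S M)) * a + PI * a) by (rewrite INR_2n3, !S_INR; ring).
    rewrite sin_plus, sin_minus. ring.
Qed.

Lemma sum_sin_2 (a : R) (M : nat) :
  2 * sin (PI * a) * sum_n (fun k => sin (2 * PI * INR (S k) * a)) M =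
  cos (PI * a) - cos (INR (2 * M + 3) * PI * a).
Proof.
  induction M.
  - rewrite sum_O. simpl INR.
    replace ((1 + 1 + 1) * PI * a) with (2 * PI * 1 * a + PI * a) by ring.
    pose proof (cos_minus (2 * PI * 1 * a) (PI * a)) as E.
    replace (2 * PI * 1 * a - PI * a) with (PI * a) in E by ring.
    rewrite cos_plus. lra.
  - rewrite sum_n_S, Rmult_plus_distr_l, IHM.
    replace (INR (2 * M + 3) * PI * a) with (2 * PI * INR (S (S M)) * a - PI * a) by (rewrite INR_2n3, !S_INR; ring).
    replace (INR (2 * S M + 3) * PI * a) with (2 * PI * INR (S (S M)) * a + PI * a) by (rewrite INR_2n3, !S_INR; ring).
    rewrite cos_plus, cos_minus. ring.
Qed.

Lemma sin_PI_pos (a : R) : 0 < a < 1 -> 0 < sin (PI * a).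
Proof.
  intros H. pose proof PI_RGT_0. apply sin_gt_0.
  - apply Rmult_lt_0_compat; lra.
  - rewrite <- (Rmult_1_r PI) at 2. apply Rmult_lt_compat_l; lra.
Qed.

Lemma Rabs_sum_cos_le (a : R) (M : nat) : 0 < a < 1 ->
  Rabs (sum_n (fun k => cos (2 * PI * INR (S k) * a)) M) <= / sin (PI * a).
Proof.
  intros H. pose proof (sin_PI_pos a H) as Hs. pose proof (sum_cos_2 a M) as E.
  pose proof (SIN_bound (PI * a)) as B1. pose proof (SIN_bound (INR (2 * M + 3) * PI * a)) as B2.
  apply Rmult_le_reg_l with (sin (PI * a)); auto. rewrite Rinv_r; [|lra].
  rewrite <- (Rabs_pos_eq (sin (PI * a))) at 1; [|lra].
  rewrite <- Rabs_mult. apply Rabs_le. lra.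
Qed.

Lemma Rabs_sum_sin_le (a : R) (M : nat) : 0 < a < 1 ->
  Rabs (sum_n (fun k => sin (2 * PI * INR (S k) * a)) M) <= / sin (PI * a).
Proof.
  intros H. pose proof (sin_PI_pos a H) as Hs. pose proof (sum_sin_2 a M) as E.
  pose proof (COS_bound (PI * a)) as B1. pose proof (COS_bound (INR (2 * M + 3) * PI * a)) as B2.
  apply Rmult_le_reg_l with (sin (PI * a)); auto. rewrite Rinv_r; [|lra].
  rewrite <- (Rabs_pos_eq (sin (PI * a))) at 1; [|lra].
  rewrite <- Rabs_mult. apply Rabs_le. lra.
Qed.

Lemma is_lim_seq_inv_S : is_lim_seq (fun n => / INR (S n)) 0.
Proof.
  apply (is_lim_seq_incr_1 (fun n => / INR n)).
  replace (Finite 0) with (Rbar_inv p_infty) by reflexivity.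
  apply is_lim_seq_inv; [apply is_lim_seq_INR|discriminate].
Qed.

Lemma is_lim_seq_scal_0 (u : nat -> R) (K : R) : is_lim_seq u 0 -> is_lim_seq (fun n => K * u n) 0.
Proof.
  intros H. replace (Finite 0) with (Finite (K * 0)) by (f_equal; ring).
  apply is_lim_seq_mult'; auto. apply is_lim_seq_const.
Qed.

Lemma is_series_inv_S_telescope : is_series (fun m => / INR (S m) - / INR (S (S m))) 1.
Proof.
  apply is_series_is_lim_seq.
  apply is_lim_seq_ext with (fun n => 1 - / INR (S (S n))).
  - intros n. induction n.
    + rewrite sum_O. simpl. lra.
    + rewrite sum_n_S, <- IHn. ring.
  - replace (Finite 1) with (Finite (1 - 0)) by (f_equal; ring).
    apply is_lim_seq_minus'; [apply is_lim_seq_const|].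
    apply (is_lim_seq_incr_1 (fun n => / INR (S n))). apply is_lim_seq_inv_S.
Qed.

(** Dirichlet's test: after summation by parts the terms are dominated by D times the telescoping
    differences of 1/(m+1), and the boundary term is at most D/(p+2). *)
Lemma ex_series_dirichlet (d : nat -> R) (D : R) :
  (forall m, Rabs (sum_n d m) <= D) -> ex_series (fun m => d m / INR (S m)).
Proof.
  intros HD.
  assert (D0 : 0 <= D) by (apply Rle_trans with (2 := HD 0%nat); apply Rabs_pos).
  assert (E : ex_series (fun m => sum_n d m * (/ INR (S m) - / INR (S (S m))))).
  { apply ex_series_Rabs_le with (fun m => D * (/ INR (S m) - / INR (S (S m)))).
    - intros m. rewrite Rabs_mult.
      assert (0 <= / INR (S m) - / INR (S (S m))).
      { apply Rle_minus_r. ring_simplify. apply Rinv_le_contravar; [apply INR_S_pos|]. apply le_INR; lia. }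
      rewrite (Rabs_pos_eq (_ - _)); auto. apply Rmult_le_compat_r; auto.
    - apply (ex_series_scal D (fun m => / INR (S m) - / INR (S (S m)))). exists 1. apply is_series_inv_S_telescope. }
  destruct E as [l Hl]. exists l. apply is_series_is_lim_seq. apply is_lim_seq_incr_1.
  apply is_series_is_lim_seq in Hl.
  apply is_lim_seq_ext with (fun p => sum_n d (S p) * / INR (S (S p)) + sum_n (fun m => sum_n d m * (/ INR (S m) - / INR (S (S m)))) p).
  - intros p. symmetry. apply (abel_identity d (fun m => / INR (S m)) p).
  - replace (Finite l) with (Finite (0 + l)) by (f_equal; ring).
    apply is_lim_seq_plus'; auto.
    apply is_lim_seq_squeeze_0 with (fun p => D * / INR (S (S p))).
    + intros p. rewrite Rminus_0_r, Rabs_mult. pose proof (INR_S_pos (S p)).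
      rewrite (Rabs_pos_eq (/ _)); [|left; now apply Rinv_0_lt_compat].
      apply Rmult_le_compat_r; auto. left; now apply Rinv_0_lt_compat.
    + apply is_lim_seq_scal_0. apply (is_lim_seq_incr_1 (fun n => / INR (S n))). apply is_lim_seq_inv_S.
Qed.

(** The sine rises and then falls on (0, pi), so over a subinterval it is smallest at an endpoint.
    This keeps the Dirichlet kernel uniformly away from its singularities between [b] and [c]. *)
Lemma sin_PI_lower (b c u : R) : 0 < b < 1 -> 0 < c < 1 -> Rmin b c <= u <= Rmax b c ->
  Rmin (sin (PI * b)) (sin (PI * c)) <= sin (PI * u).
Proof.
  intros Hb Hc Hu. pose proof PI_RGT_0.
  assert (G : forall b c, 0 < b < 1 -> 0 < c < 1 -> b <= u <= c ->
            Rmin (sin (PI * b)) (sin (PI * c)) <= sin (PI * u)).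
  { clear b c Hb Hc Hu. intros b c Hb Hc Hu. destruct (Rle_dec u (1/2)).
    - apply Rle_trans with (sin (PI * b)); [apply Rmin_l|].
      apply sin_incr_1; try nra.
    - apply Rle_trans with (sin (PI * c)); [apply Rmin_r|].
      apply sin_decr_1; try nra. }
  destruct (Rle_dec b c).
  - rewrite Rmin_left, Rmax_right in Hu by lra. auto.
  - rewrite Rmin_right, Rmax_left in Hu by lra. rewrite Rmin_comm. auto.
Qed.

(* The oscillating primitive of the Dirichlet kernel [sin (L pi u) / sin (pi u)], up to a term of order [1/L]. *)
Definition dirichlet_corr (L u : R) : R := cos (L * PI * u) / (L * PI * sin (PI * u)).
Definition dirichlet_rem (L u : R) : R := - cos (L * PI * u) * cos (PI * u) / (L * sin (PI * u) ^ 2).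

(** Integration by parts in differential form: a function whose derivative is the Dirichlet kernel
    is left, after [dirichlet_corr] is added, with a derivative of size O(1/L). *)
Lemma is_derive_dirichlet_corr (L u : R) : 0 < L -> sin (PI * u) <> 0 ->
  is_derive (dirichlet_corr L) u (- (sin (L * PI * u) / sin (PI * u)) + dirichlet_rem L u).
Proof.
  intros HL Hs. pose proof PI_RGT_0. unfold dirichlet_corr, dirichlet_rem. auto_derive.
  - assert (0 < L * PI) by nra. intros E. apply Rmult_integral in E. tauto || (destruct E as [E|E]; [nra|tauto]).
  - field. repeat split; auto; lra.
Qed.

Lemma dirichlet_corr_bound (L u s : R) : 0 < L -> 0 < s <= sin (PI * u) ->
  Rabs (dirichlet_corr L u) <= / s * / L.
Proof.
  intros HL Hs. pose proof PI2_1. unfold dirichlet_corr.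
  unfold Rdiv. rewrite Rabs_mult.
  assert (0 < L * PI * sin (PI * u)) by (apply Rmult_lt_0_compat; [apply Rmult_lt_0_compat|]; lra).
  rewrite (Rabs_pos_eq (/ _)); [|left; now apply Rinv_0_lt_compat].
  assert (Rabs (cos (L * PI * u)) <= 1) by (apply Rabs_le, COS_bound).
  rewrite <- Rinv_mult.
  apply Rle_trans with (1 * / (L * PI * sin (PI * u))).
  - apply Rmult_le_compat_r; auto. left; now apply Rinv_0_lt_compat.
  - rewrite Rmult_1_l. apply Rinv_le_contravar. nra. 
    rewrite (Rmult_comm s). rewrite Rmult_assoc. apply Rmult_le_compat_l; [lra|]. nra.
Qed.

Lemma dirichlet_rem_bound (L u s : R) : 0 < L -> 0 < s <= sin (PI * u) ->
  Rabs (dirichlet_rem L u) <= / s ^ 2 * / L.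
Proof.
  intros HL Hs. unfold dirichlet_rem, Rdiv. rewrite !Rabs_mult, Rabs_Ropp.
  assert (0 < s ^ 2) by nra.
  assert (s ^ 2 <= sin (PI * u) ^ 2) by (apply pow_incr; lra).
  assert (0 < L * sin (PI * u) ^ 2) by (apply Rmult_lt_0_compat; lra).
  rewrite (Rabs_pos_eq (/ _)); [|left; now apply Rinv_0_lt_compat].
  assert (Rabs (cos (L * PI * u)) <= 1) by (apply Rabs_le, COS_bound).
  assert (Rabs (cos (PI * u)) <= 1) by (apply Rabs_le, COS_bound).
  rewrite <- Rinv_mult.
  apply Rle_trans with ((1 * 1) * / (L * sin (PI * u) ^ 2)).
  - apply Rmult_le_compat_r; [left; now apply Rinv_0_lt_compat|].
    apply Rmult_le_compat; auto using Rabs_pos.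
  - rewrite !Rmult_1_l. apply Rinv_le_contravar. nra. rewrite Rmult_comm.
    apply Rmult_le_compat_l; lra.
Qed.

Lemma is_lim_seq_inv_2n3 : is_lim_seq (fun M => / INR (2 * M + 3)) 0.
Proof.
  apply is_lim_seq_squeeze_0 with (2 := is_lim_seq_inv_S).
  intros n. rewrite Rminus_0_r. rewrite Rabs_pos_eq.
  - apply Rinv_le_contravar; [apply INR_S_pos|]. apply le_INR; lia.
  - left; apply Rinv_0_lt_compat. apply lt_0_INR; lia.
Qed.

(** The partial sum plus [u] has the Dirichlet kernel as its derivative. With the corrector added,
    the derivative is [dirichlet_rem], so the function [V] hardly changes between 1/2 and [a]. *)
Lemma is_series_sin_div (a : R) : 0 < a < 1 ->
  is_series (fun k => sin (2 * PI * INR (S k) * a) / (PI * INR (S k))) (1 / 2 - a).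
Proof.
  intros Ha. pose proof PI_RGT_0 as HPI. apply is_series_is_lim_seq.
  set (f := fun M u => sum_n (fun k => sin (2 * PI * INR (S k) * u) / (PI * INR (S k))) M).
  set (s := Rmin (sin (PI * (1/2))) (sin (PI * a))).
  assert (Hs : 0 < s) by (apply Rmin_glb_lt; apply sin_PI_pos; lra).
  set (V := fun M u => f M u + u + dirichlet_corr (INR (2 * M + 3)) u).
  assert (HV : forall M, Rabs (V M a - V M (1/2)) <= / s ^ 2 * / INR (2 * M + 3) * Rabs (a - 1/2)).
  { intros M. assert (HL : 0 < INR (2 * M + 3)) by (apply lt_0_INR; lia).
    apply MVT_bound with (f' := dirichlet_rem (INR (2 * M + 3))).
    - intros u Hu. pose proof (sin_PI_lower (1/2) a u ltac:(lra) Ha Hu) as Hl. fold s in Hl.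
      evar_last.
      + unfold V. apply (is_derive_plus (V := R_NormedModule)).
        * apply (is_derive_plus (V := R_NormedModule)).
          -- unfold f. apply (is_derive_sum_n (V := R_NormedModule)) with (d := fun k => 2 * cos (2 * PI * INR (S k) * u)).
             intros k _. pose proof (INR_S_pos k). revert H. generalize (INR (S k)). intros K HK. auto_derive; auto. field. split; lra.
          -- apply (is_derive_id (K := R_AbsRing)).
        * apply is_derive_dirichlet_corr; lra.
      + pose proof (sum_cos_2 u M) as E. rewrite sum_n_Rmult_l.
        change (@plus R_NormedModule) with Rplus. change (@one R_AbsRing) with 1.
        set (T := sum_n (fun k => cos (2 * PI * INR (S k) * u)) M) in *.
        assert (E' : sin (INR (2 * M + 3) * PI * u) / sin (PI * u) = 2 * T + 1).
        { replace (sin (INR (2 * M + 3) * PI * u)) with (2 * sin (PI * u) * T + sin (PI * u)) by lra. field. lra. }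
        rewrite E'. ring.
    - intros u Hu. pose proof (sin_PI_lower (1/2) a u ltac:(lra) Ha Hu) as Hl. fold s in Hl.
      apply dirichlet_rem_bound; auto. }
  (* At 1/2 every term contains the sine of a multiple of pi; this fixes the constant of
     integration. *)
  assert (H12 : forall M, f M (1/2) = 0).
  { intros M. unfold f. rewrite <- (Rmult_0_l (sum_n (fun _ => 0) M)), <- sum_n_Rmult_l. apply sum_n_ext.
    intros k. rewrite Rmult_0_l. replace (2 * PI * INR (S k) * (1/2)) with (0 + IZR (Z.of_nat (S k)) * PI).
    - rewrite (sin_eq_0_1 (0 + IZR (Z.of_nat (S k)) * PI)); [unfold Rdiv; apply Rmult_0_l|]. exists (Z.of_nat (S k)); ring.
    - rewrite <- INR_IZR_INZ. field. }
  apply is_lim_seq_ext with (fun M => (V M a - V M (1/2)) + (1/2 - a) +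
     (dirichlet_corr (INR (2 * M + 3)) (1/2) - dirichlet_corr (INR (2 * M + 3)) a)).
  - intros M. unfold V. rewrite H12. unfold f. ring.
  - replace (Finite (1/2 - a)) with (Finite (0 + (1/2 - a) + (0 - 0))) by (f_equal; ring).
    assert (Hc : forall u, 0 < u < 1 -> is_lim_seq (fun M => dirichlet_corr (INR (2 * M + 3)) u) 0).
    { intros u Hu. apply is_lim_seq_squeeze_0 with (fun M => / sin (PI * u) * / INR (2 * M + 3)).
      - intros M. rewrite Rminus_0_r. apply dirichlet_corr_bound. apply lt_0_INR; lia. pose proof (sin_PI_pos u Hu); lra.
      - apply is_lim_seq_scal_0, is_lim_seq_inv_2n3. }
    apply is_lim_seq_plus'; [apply is_lim_seq_plus'|apply is_lim_seq_minus'].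
    + apply is_lim_seq_squeeze_0 with (fun M => (/ s ^ 2 * Rabs (a - 1/2)) * / INR (2 * M + 3)).
      * intros M. rewrite Rminus_0_r. eapply Rle_trans; [apply HV|]. right; ring.
      * apply is_lim_seq_scal_0, is_lim_seq_inv_2n3.
    + apply is_lim_seq_const.
    + apply Hc; lra.
    + apply Hc; lra.
Qed.

(** * Limits and derivatives of complex-valued functions *)

(** Generic lemmas on [sum_n] leave equations in the carrier of an algebraic structure; restating
    them at type [C] or [R] lets [ring] and [field] recognise the operations. *)
Ltac as_C := match goal with |- @eq _ ?x ?y => change (@eq C x y) end.
Ltac cring := ((as_C; ring) || ring).
Ltac as_R := match goal with |- @eq _ ?x ?y => change (@eq R x y) end.

Lemma C_eq (z w : C) : Re z = Re w -> Im z = Im w -> z = w.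
Proof. destruct z, w. unfold Re, Im; simpl. now intros -> ->. Qed.

Ltac C_comp := apply C_eq; unfold Cmult, Cplus, Cminus, Copp, RtoC, Re, Im; simpl; try ring.

Lemma im_le_Cmod (z : C) : Rabs (Im z) <= Cmod z.
Proof. apply Rle_trans with (2 := Rmax_Cmod z). apply Rmax_r. Qed.

Lemma Cmod_le_Re_Im (z : C) : Cmod z <= Rabs (Re z) + Rabs (Im z).
Proof.
  replace z with (RtoC (Re z) + Ci * RtoC (Im z))%C by (destruct z; C_comp).
  eapply Rle_trans; [apply Cmod_triangle|].
  rewrite Cmod_mult, Cmod_Ci, !Cmod_R.
  replace (Re (Re z + Ci * Im z)%C) with (Re z) by (destruct z; simpl; ring).
  replace (Im (Re z + Ci * Im z)%C) with (Im z) by (destruct z; simpl; ring).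
  lra.
Qed.

Lemma Cexp_add (z w : C) : Cexp (z + w) = (Cexp z * Cexp w)%C.
Proof.
  destruct z as [x y], w as [x' y']. unfold Cexp. C_comp; rewrite exp_plus.
  - rewrite cos_plus. ring.
  - rewrite sin_plus. ring.
Qed.

Lemma Cexp_0 : Cexp 0 = 1.
Proof. unfold Cexp; simpl. rewrite exp_0, cos_0, sin_0. C_comp. Qed.

Lemma Cexp_RtoC (x : R) : Cexp x = exp x.
Proof. unfold Cexp; simpl. rewrite cos_0, sin_0. C_comp. Qed.

Lemma Cmod_Cexp (z : C) : Cmod (Cexp z) = exp (Re z).
Proof.
  unfold Cmod, Cexp. cbn [fst snd].
  replace ((exp (Re z) * cos (Im z)) ^ 2 + (exp (Re z) * sin (Im z)) ^ 2) with (exp (Re z) ^ 2).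
  - rewrite sqrt_pow2; auto. left; apply exp_pos.
  - pose proof (sin2_cos2 (Im z)) as E. unfold Rsqr in E.
    replace ((exp (Re z) * cos (Im z)) ^ 2 + (exp (Re z) * sin (Im z)) ^ 2)
      with (exp (Re z) ^ 2 * (sin (Im z) * sin (Im z) + cos (Im z) * cos (Im z))) by ring.
    rewrite E; ring.
Qed.

Lemma Cexp_neq_0 (z : C) : Cexp z <> 0.
Proof. apply Cmod_gt_0. rewrite Cmod_Cexp. apply exp_pos. Qed.

Lemma Cexp_opp (z : C) : Cexp (- z) = (/ Cexp z)%C.
Proof.
  assert (E : (Cexp (- z) * Cexp z)%C = 1).
  { rewrite <- Cexp_add. replace (- z + z)%C with (RtoC 0) by ring. apply Cexp_0. }
  pose proof (Cexp_neq_0 z). rewrite <- (Cmult_1_r (Cexp (- z))), <- (Cinv_r (Cexp z)); auto.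
  rewrite Cmult_assoc, E. ring.
Qed.

(** Componentwise convergence mirrors [CLim] and [CSeries], and real limit lemmas apply to each
    coordinate directly. *)
Definition Ccv (u : nat -> C) (l : C) : Prop :=
  is_lim_seq (fun n => Re (u n)) (Re l) /\ is_lim_seq (fun n => Im (u n)) (Im l).

Definition Cser (u : nat -> C) (l : C) : Prop :=
  is_series (fun n => Re (u n)) (Re l) /\ is_series (fun n => Im (u n)) (Im l).

Lemma Ccv_ext (u v : nat -> C) (l : C) : (forall n, u n = v n) -> Ccv u l -> Ccv v l.
Proof.
  intros H [H1 H2]; split.
  - apply is_lim_seq_ext with (2 := H1). intros; now rewrite H.
  - apply is_lim_seq_ext with (2 := H2). intros; now rewrite H.
Qed.

Lemma Ccv_eq (u : nat -> C) (l m : C) : l = m -> Ccv u l -> Ccv u m.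
Proof. now intros ->. Qed.

Lemma Cser_eq (u : nat -> C) (l m : C) : l = m -> Cser u l -> Cser u m.
Proof. now intros ->. Qed.

Lemma Ccv_const (c : C) : Ccv (fun _ => c) c.
Proof. split; apply is_lim_seq_const. Qed.

Lemma Ccv_RtoC (u : nat -> R) (l : R) : is_lim_seq u l -> Ccv (fun n => RtoC (u n)) l.
Proof. split; simpl; auto. apply is_lim_seq_const. Qed.

Lemma Ccv_plus (u v : nat -> C) (l m : C) : Ccv u l -> Ccv v m -> Ccv (fun n => (u n + v n)%C) (l + m)%C.
Proof. intros [H1 H2] [H3 H4]; split; simpl; apply is_lim_seq_plus'; auto. Qed.

Lemma Ccv_minus (u v : nat -> C) (l m : C) : Ccv u l -> Ccv v m -> Ccv (fun n => (u n - v n)%C) (l - m)%C.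
Proof. intros [H1 H2] [H3 H4]; split; simpl; apply is_lim_seq_minus'; auto. Qed.

Lemma Ccv_mult (u v : nat -> C) (l m : C) : Ccv u l -> Ccv v m -> Ccv (fun n => (u n * v n)%C) (l * m)%C.
Proof.
  intros [H1 H2] [H3 H4]; split; simpl.
  - apply is_lim_seq_minus'; apply is_lim_seq_mult'; auto.
  - apply is_lim_seq_plus'; apply is_lim_seq_mult'; auto.
Qed.

Lemma Ccv_unique (u : nat -> C) (l m : C) : Ccv u l -> Ccv u m -> l = m.
Proof.
  intros [H1 H2] [H3 H4]. apply C_eq.
  - apply is_lim_seq_unique in H1, H3. rewrite H1 in H3. now injection H3.
  - apply is_lim_seq_unique in H2, H4. rewrite H2 in H4. now injection H4.
Qed.

Lemma Ccv_CLim (u : nat -> C) (l : C) : Ccv u l -> CLim u = l.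
Proof.
  intros [H1 H2]. unfold CLim. apply is_lim_seq_unique in H1, H2. rewrite H1, H2. now destruct l.
Qed.

Lemma Ccv_Cmod_0 (u : nat -> C) (l : C) : is_lim_seq (fun n => Cmod (u n - l)) 0 -> Ccv u l.
Proof.
  intros H; split; apply is_lim_seq_squeeze_0 with (2 := H); intros n.
  - apply (re_le_Cmod (u n - l)).
  - apply (im_le_Cmod (u n - l)).
Qed.

Lemma Ccv_Cmod_sub (u : nat -> C) (l : C) : Ccv u l -> is_lim_seq (fun n => Cmod (u n - l)) 0.
Proof.
  intros [H1 H2]. apply is_lim_seq_sub_Rabs_0 in H1, H2.
  apply is_lim_seq_le_le with (fun _ => 0) (fun n => Rabs (Re (u n) - Re l) + Rabs (Im (u n) - Im l)).
  - intros n; split; [apply Cmod_ge_0|]. apply (Cmod_le_Re_Im (u n - l)).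
  - apply is_lim_seq_const.
  - replace (Finite 0) with (Finite (0 + 0)) by (f_equal; ring). now apply is_lim_seq_plus'.
Qed.

Lemma Ccv_Cmod (u : nat -> C) (l : C) : Ccv u l -> is_lim_seq (fun n => Cmod (u n)) (Cmod l).
Proof.
  intros H. apply is_lim_seq_squeeze_0 with (2 := Ccv_Cmod_sub u l H). intros n.
  apply Rabs_le. pose proof (Cmod_triangle (u n - l) l). pose proof (Cmod_triangle (l - u n) (u n)).
  replace (u n - l + l)%C with (u n) in H0 by ring. replace (l - u n + u n)%C with l in H1 by ring.
  replace (l - u n)%C with (- (u n - l))%C in H1 by ring. rewrite Cmod_opp in H1. lra.
Qed.

Lemma Ccv_Cmod_le (u : nat -> C) (l : C) (K : R) : Ccv u l -> (forall n, Cmod (u n) <= K) -> Cmod l <= K.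
Proof.
  intros H HK. apply Ccv_Cmod in H.
  apply (is_lim_seq_le (fun n => Cmod (u n)) (fun _ => K) (Cmod l) K); auto. apply is_lim_seq_const.
Qed.

Lemma Ccv_incr_1 (u : nat -> C) (l : C) : Ccv (fun n => u (S n)) l <-> Ccv u l.
Proof.
  unfold Ccv. rewrite <- (is_lim_seq_incr_1 (fun n => Re (u n))), <- (is_lim_seq_incr_1 (fun n => Im (u n))). tauto.
Qed.

Lemma Re_sum_n (u : nat -> C) (n : nat) : Re (sum_n u n) = sum_n (fun k => Re (u k)) n.
Proof. induction n; [now rewrite !sum_O|]. rewrite sum_Sn, sum_n_S, <- IHn. reflexivity. Qed.

Lemma Im_sum_n (u : nat -> C) (n : nat) : Im (sum_n u n) = sum_n (fun k => Im (u k)) n.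
Proof. induction n; [now rewrite !sum_O|]. rewrite sum_Sn, sum_n_S, <- IHn. reflexivity. Qed.

Lemma sum_n_0 (n : nat) : sum_n (fun _ => 0) n = 0.
Proof. induction n; [now rewrite sum_O|]. rewrite sum_n_S, IHn. apply Rplus_0_l. Qed.

Lemma is_series_0 (u : nat -> R) : (forall n, u n = 0) -> is_series u 0.
Proof.
  intros H. apply is_series_is_lim_seq. apply is_lim_seq_ext with (2 := is_lim_seq_const 0).
  intros n. rewrite <- (sum_n_0 n). apply sum_n_ext. intros k; now rewrite H.
Qed.

Lemma RtoC_sum_n (u : nat -> R) (n : nat) : RtoC (sum_n u n) = sum_n (fun k => RtoC (u k)) n.
Proof.
  apply C_eq.
  - now rewrite Re_sum_n.
  - rewrite Im_sum_n. symmetry. apply sum_n_0.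
Qed.

Lemma Cser_Ccv (u : nat -> C) (l : C) : Cser u l <-> Ccv (sum_n u) l.
Proof.
  unfold Cser, Ccv. rewrite !is_series_is_lim_seq. split; intros [H1 H2]; split.
  - apply is_lim_seq_ext with (2 := H1). intros; now rewrite Re_sum_n.
  - apply is_lim_seq_ext with (2 := H2). intros; now rewrite Im_sum_n.
  - apply is_lim_seq_ext with (2 := H1). intros; now rewrite Re_sum_n.
  - apply is_lim_seq_ext with (2 := H2). intros; now rewrite Im_sum_n.
Qed.

Lemma Cser_CSeries (u : nat -> C) (l : C) : Cser u l -> CSeries u = l.
Proof.
  intros [H1 H2]. unfold CSeries. rewrite (is_series_unique _ _ H1), (is_series_unique _ _ H2). now destruct l.
Qed.

Lemma Cser_ext (u v : nat -> C) (l : C) : (forall n, u n = v n) -> Cser u l -> Cser v l.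
Proof.
  intros H [H1 H2]; split.
  - apply is_series_ext with (2 := H1). intros; now rewrite H.
  - apply is_series_ext with (2 := H2). intros; now rewrite H.
Qed.

Lemma Cser_plus (u v : nat -> C) (l m : C) : Cser u l -> Cser v m -> Cser (fun n => (u n + v n)%C) (l + m)%C.
Proof. intros [H1 H2] [H3 H4]; split; simpl; apply (is_series_plus (V := R_NormedModule)); auto. Qed.

Lemma sum_n_Cmult_l (c : C) (u : nat -> C) (n : nat) : sum_n (fun k => (c * u k)%C) n = (c * sum_n u n)%C.
Proof. apply (sum_n_mult_l (K := C_Ring)). Qed.

Lemma sum_n_Cplus (u v : nat -> C) (n : nat) : sum_n (fun k => (u k + v k)%C) n = (sum_n u n + sum_n v n)%C.
Proof. apply (sum_n_plus (G := C_AbelianGroup)). Qed.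

Lemma sum_n_CS (u : nat -> C) (n : nat) : sum_n u (S n) = (sum_n u n + u (S n))%C.
Proof. apply (sum_Sn (G := C_AbelianGroup)). Qed.

Lemma Cser_scal (c : C) (u : nat -> C) (l : C) : Cser u l -> Cser (fun n => (c * u n)%C) (c * l)%C.
Proof.
  rewrite !Cser_Ccv. intros H. apply Ccv_ext with (fun n => (c * sum_n u n)%C).
  - intros n; symmetry; apply sum_n_Cmult_l.
  - apply Ccv_mult; auto. apply Ccv_const.
Qed.

Lemma Cser_RtoC (u : nat -> R) (l : R) : is_series u l -> Cser (fun n => RtoC (u n)) l.
Proof.
  intros H; split; simpl; auto.
  now apply is_series_0.
Qed.

Lemma Cser_dominated (u : nat -> C) (V : nat -> R) :
  (forall n, Cmod (u n) <= V n) -> ex_series V -> Cser u (CSeries u).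
Proof.
  intros H HV. unfold CSeries. split; simpl; apply Series_correct; apply ex_series_Rabs_le with (2 := HV); intros n.
  - apply Rle_trans with (2 := H n). apply re_le_Cmod.
  - apply Rle_trans with (2 := H n). apply im_le_Cmod.
Qed.

Lemma Cmod_sum_n_le (u : nat -> C) (n : nat) : Cmod (sum_n u n) <= sum_n (fun k => Cmod (u k)) n.
Proof.
  induction n; [rewrite !sum_O; lra|]. rewrite sum_n_CS, sum_n_S.
  eapply Rle_trans; [apply Cmod_triangle|]. lra.
Qed.

Lemma Cmod_Cser_le (u : nat -> C) (V : nat -> R) (l : C) :
  (forall n, Cmod (u n) <= V n) -> ex_series V -> Cser u l -> Cmod l <= Series V.
Proof.
  intros H HV Hl. apply Cser_Ccv in Hl. apply Ccv_Cmod_le with (1 := Hl). intros n.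
  eapply Rle_trans; [apply Cmod_sum_n_le|].
  eapply Rle_trans; [apply sum_n_m_le with (b := V); auto|].
  apply sum_n_le_is_series; [|now apply Series_correct].
  intros k. apply Rle_trans with (2 := H k). apply Cmod_ge_0.
Qed.

Lemma Ctannery (f : nat -> nat -> C) (g : nat -> C) (V : nat -> R) :
  (forall p n, Cmod (f p n) <= V n) -> ex_series V ->
  (forall n, Ccv (fun p => f p n) (g n)) ->
  Ccv (fun p => CSeries (f p)) (CSeries g).
Proof.
  intros Hf HV Hl. split; unfold CSeries; simpl.
  - apply (tannery (fun p n => Re (f p n)) (fun n => Re (g n)) V); auto.
    + intros p n. apply Rle_trans with (2 := Hf p n). apply re_le_Cmod.
    + intros n; apply Hl.
  - apply (tannery (fun p n => Im (f p n)) (fun n => Im (g n)) V); auto.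
    + intros p n. apply Rle_trans with (2 := Hf p n). apply im_le_Cmod.
    + intros n; apply Hl.
Qed.

Definition is_derive_RC (f : R -> C) (x : R) (l : C) : Prop :=
  is_derive (fun u => Re (f u)) x (Re l) /\ is_derive (fun u => Im (f u)) x (Im l).

Lemma is_derive_RC_plus (f g : R -> C) (x : R) (l m : C) :
  is_derive_RC f x l -> is_derive_RC g x m -> is_derive_RC (fun u => (f u + g u)%C) x (l + m)%C.
Proof. intros [H1 H2] [H3 H4]; split; simpl; apply (is_derive_plus (V := R_NormedModule)); auto. Qed.

Lemma is_derive_RC_mult (f g : R -> C) (x : R) (l m : C) :
  is_derive_RC f x l -> is_derive_RC g x m ->
  is_derive_RC (fun u => (f u * g u)%C) x (l * g x + f x * m)%C.
Proof.
  intros [H1 H2] [H3 H4]; split.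
  - evar_last; [simpl; apply (is_derive_minus (V := R_NormedModule)); apply (is_derive_mult (K := R_AbsRing)); eauto; intros; apply Rmult_comm|].
    destruct l, m, (f x), (g x). simpl. unfold minus, plus, opp, mult; simpl. ring.
  - evar_last; [simpl; apply (is_derive_plus (V := R_NormedModule)); apply (is_derive_mult (K := R_AbsRing)); eauto; intros; apply Rmult_comm|].
    destruct l, m, (f x), (g x). simpl. unfold minus, plus, opp, mult; simpl. ring.
Qed.

Lemma is_derive_RC_const (c : C) (x : R) : is_derive_RC (fun _ => c) x 0.
Proof. split; simpl; apply (is_derive_const (V := R_NormedModule)). Qed.

Lemma is_derive_RC_RtoC (f : R -> R) (x l : R) : is_derive f x l -> is_derive_RC (fun u => RtoC (f u)) x l.
Proof. split; simpl; auto. apply (is_derive_const (V := R_NormedModule)). Qed.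

Lemma is_derive_RC_Cexp (t : C) (x : R) :
  is_derive_RC (fun u => Cexp (t * RtoC u)%C) x (t * Cexp (t * RtoC x))%C.
Proof.
  destruct t as [p q]. split; unfold Cexp; simpl; auto_derive; auto; unfold Rminus; ring.
Qed.

Lemma is_derive_RC_sum_n (f f' : nat -> R -> C) (x : R) (p : nat) :
  (forall k, is_derive_RC (f k) x (f' k x)) ->
  is_derive_RC (fun u => sum_n (fun k => f k u) p) x (sum_n (fun k => f' k x) p).
Proof.
  intros H. split.
  - rewrite Re_sum_n. apply is_derive_ext with (fun u => sum_n (fun k => Re (f k u)) p).
    + intros; now rewrite Re_sum_n.
    + apply (is_derive_sum_n (V := R_NormedModule)) with (d := fun k => Re (f' k x)). intros k _; apply H.
  - rewrite Im_sum_n. apply is_derive_ext with (fun u => sum_n (fun k => Im (f k u)) p).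
    + intros; now rewrite Im_sum_n.
    + apply (is_derive_sum_n (V := R_NormedModule)) with (d := fun k => Im (f' k x)). intros k _; apply H.
Qed.

(** The mean value theorem has no complex form with equality, so real and imaginary parts are
    treated separately; this costs the factor 2. *)
Lemma MVT_bound_RC (f f' : R -> C) (b c K : R) :
  (forall u, Rmin b c <= u <= Rmax b c -> is_derive_RC f u (f' u)) ->
  (forall u, Rmin b c <= u <= Rmax b c -> Cmod (f' u) <= K) ->
  Cmod (f c - f b) <= 2 * K * Rabs (c - b).
Proof.
  intros Hd HK. eapply Rle_trans; [apply Cmod_le_Re_Im|].
  assert (H1 : Rabs (Re (f c) - Re (f b)) <= K * Rabs (c - b)).
  { apply (MVT_bound (fun u => Re (f u)) (fun u => Re (f' u))).
    - intros u Hu; now apply Hd.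
    - intros u Hu. apply Rle_trans with (2 := HK u Hu). apply re_le_Cmod. }
  assert (H2 : Rabs (Im (f c) - Im (f b)) <= K * Rabs (c - b)).
  { apply (MVT_bound (fun u => Im (f u)) (fun u => Im (f' u))).
    - intros u Hu; now apply Hd.
    - intros u Hu. apply Rle_trans with (2 := HK u Hu). apply im_le_Cmod. }
  change (Re (f c - f b)%C) with (Re (f c) - Re (f b)). change (Im (f c - f b)%C) with (Im (f c) - Im (f b)). lra.
Qed.

(** * Partial fractions of exp(-at)/(1 - exp(-t)) *)

Lemma RtoC_neq_0 (x : R) : x <> 0 -> RtoC x <> RtoC 0.
Proof. intros H E. apply H. now injection E. Qed.

Lemma ex_series_inv_S_sq : ex_series (fun m => / INR (S m) ^ 2).
Proof.
  apply ex_series_Rabs_le with (fun m => 2 * (/ INR (S m) - / INR (S (S m)))).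
  - intros m. pose proof (INR_S_pos m). rewrite Rabs_pos_eq by (left; apply Rinv_0_lt_compat; nra).
    rewrite (S_INR (S m)). pose proof (INR_S_ge_1 m).
    set (k := INR (S m)) in *. replace (2 * (/ k - / (k + 1))) with (2 / (k * (k + 1))) by (field; lra).
    apply Rmult_le_reg_r with (k ^ 2 * (k + 1)); [nra|].
    replace (/ k ^ 2 * (k ^ 2 * (k + 1))) with (k + 1) by (field; lra).
    replace (2 / (k * (k + 1)) * (k ^ 2 * (k + 1))) with (2 * k) by (field; lra). lra.
  - apply (ex_series_scal 2 (fun m => / INR (S m) - / INR (S (S m)))). exists 1. apply is_series_inv_S_telescope.
Qed.

Lemma Series_inv_S_sq_nonneg : 0 <= Series (fun m => / INR (S m) ^ 2).
Proof.
  apply Rle_trans with (sum_n (fun n => / INR (S n) ^ 2) 0).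
  - rewrite sum_O. left; apply inv_S_pow_pos.
  - apply sum_n_le_is_series; [|apply Series_correct, ex_series_inv_S_sq]. intros n; left; apply inv_S_pow_pos.
Qed.

Definition pf_den (t : C) (m : nat) : C := (t * t + RtoC (4 * PI ^ 2 * INR (S m) ^ 2))%C.
Definition pf_cos (t : C) (m : nat) : C := (2 * t / pf_den t m)%C.
(** With m for [S m]: 4 pi m/(t^2 + 4 pi^2 m^2) = 1/(pi m) - t^2/(pi m (t^2 + 4 pi^2 m^2)). The
    first part sums to the sawtooth 1/2 - a; the second, kept here, decreases like m^(-3). *)
Definition pf_sin (t : C) (m : nat) : C := (RtoC (/ (PI * INR (S m))) * (t * t / pf_den t m))%C.
Definition pf_term (t : C) (a : R) (m : nat) : C :=
  (RtoC (cos (2 * PI * INR (S m) * a)) * pf_cos t m - RtoC (sin (2 * PI * INR (S m) * a)) * pf_sin t m)%C.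
Definition pf_sum (t : C) (a : R) : C := CSeries (pf_term t a).

(* [t] stays away from the poles [2 pi i m], m <> 0, proportionally to [m^2]. *)
Definition pf_admissible (t : C) : Prop :=
  t <> 0 /\ exists c, 0 < c /\ forall m, c * INR (S m) ^ 2 <= Cmod (pf_den t m).

Lemma pf_den_neq_0 (t : C) (m : nat) : pf_admissible t -> pf_den t m <> 0.
Proof.
  intros [_ [c [Hc H]]]. apply Cmod_gt_0. pose proof (INR_S_pos m). specialize (H m).
  assert (0 < c * INR (S m) ^ 2) by (apply Rmult_lt_0_compat; auto; nra). lra.
Qed.

Lemma Rabs_sin_le_1 (x : R) : Rabs (sin x) <= 1.
Proof. apply Rabs_le, SIN_bound. Qed.
Lemma Rabs_cos_le_1 (x : R) : Rabs (cos x) <= 1.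
Proof. apply Rabs_le, COS_bound. Qed.

Lemma pf_term_bound (t : C) (c : R) (m : nat) (a : R) :
  0 < c -> c * INR (S m) ^ 2 <= Cmod (pf_den t m) -> t <> 0 ->
  Cmod (pf_term t a m) <= (2 * Cmod t + Cmod t ^ 2) / c * / INR (S m) ^ 2.
Proof.
  intros Hc H Ht. pose proof (INR_S_pos m) as Hm. pose proof PI2_1 as HPI.
  assert (H0 : 0 < c * INR (S m) ^ 2) by (apply Rmult_lt_0_compat; auto; nra).
  assert (Hd : pf_den t m <> 0) by (apply Cmod_gt_0; lra).
  assert (T0 := Cmod_ge_0 t).
  unfold pf_term. unfold Cminus. eapply Rle_trans; [apply Cmod_triangle|]. rewrite Cmod_opp.
  unfold pf_cos, pf_sin. rewrite !Cmod_mult, !Cmod_div, !Cmod_mult, !Cmod_R; auto.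
  assert (Hi : / Cmod (pf_den t m) <= / c * / INR (S m) ^ 2).
  { rewrite <- Rinv_mult. apply Rinv_le_contravar; auto. }
  assert (Hi0 : 0 < / Cmod (pf_den t m)) by (apply Rinv_0_lt_compat; lra).
  rewrite (Rabs_pos_eq 2) by lra.
  assert (Hpm : Rabs (/ (PI * INR (S m))) <= 1).
  { pose proof (INR_S_ge_1 m).
    assert (1 <= PI * INR (S m)) by nra.
    rewrite Rabs_pos_eq by (left; apply Rinv_0_lt_compat; lra).
    rewrite <- Rinv_1. apply Rinv_le_contravar; lra. }
  apply Rle_trans with (1 * (2 * Cmod t / Cmod (pf_den t m)) + 1 * (1 * (Cmod t * Cmod t / Cmod (pf_den t m)))).
  - assert (0 <= 2 * Cmod t / Cmod (pf_den t m)) by (apply Rmult_le_pos; lra).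
    assert (0 <= Cmod t * Cmod t / Cmod (pf_den t m)) by (apply Rmult_le_pos; nra).
    apply Rplus_le_compat.
    + apply Rmult_le_compat_r; auto. apply Rabs_cos_le_1.
    + apply Rmult_le_compat; auto using Rabs_pos. apply Rmult_le_pos; auto using Rabs_pos. apply Rabs_sin_le_1.
      apply Rmult_le_compat_r; auto.
  - replace (1 * (2 * Cmod t / Cmod (pf_den t m)) + 1 * (1 * (Cmod t * Cmod t / Cmod (pf_den t m))))
      with ((2 * Cmod t + Cmod t ^ 2) * / Cmod (pf_den t m)) by (unfold Rdiv; ring).
    unfold Rdiv. rewrite Rmult_assoc. apply Rmult_le_compat_l; auto. nra.
Qed.

Lemma pf_sum_correct (t : C) (a : R) : pf_admissible t -> Cser (pf_term t a) (pf_sum t a).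
Proof.
  intros [Ht [c [Hc H]]]. apply Cser_dominated with (fun m => (2 * Cmod t + Cmod t ^ 2) / c * / INR (S m) ^ 2).
  - intros m. now apply pf_term_bound.
  - apply (ex_series_scal ((2 * Cmod t + Cmod t ^ 2) / c) (fun m => / INR (S m) ^ 2)). apply ex_series_inv_S_sq.
Qed.

(** The majorant is uniform in [a], so [pf_sum] is continuous even at the integers, where the
    sawtooth series jumps. *)
Lemma pf_sum_continuous (t : C) (b : nat -> R) (a : R) : pf_admissible t ->
  is_lim_seq b a -> Ccv (fun p => pf_sum t (b p)) (pf_sum t a).
Proof.
  intros [Ht [c [Hc H]]] Hb. unfold pf_sum.
  apply (Ctannery (fun p => pf_term t (b p)) (pf_term t a) (fun m => (2 * Cmod t + Cmod t ^ 2) / c * / INR (S m) ^ 2)).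
  - intros p m. now apply pf_term_bound.
  - apply (ex_series_scal ((2 * Cmod t + Cmod t ^ 2) / c) (fun m => / INR (S m) ^ 2)). apply ex_series_inv_S_sq.
  - intros m. unfold pf_term.
    assert (L : is_lim_seq (fun p => 2 * PI * INR (S m) * b p) (2 * PI * INR (S m) * a)).
    { apply is_lim_seq_mult'; auto. apply is_lim_seq_const. }
    apply Ccv_minus; apply Ccv_mult; try apply Ccv_const; apply Ccv_RtoC.
    + apply (is_lim_seq_continuous cos); auto. apply continuity_cos.
    + apply (is_lim_seq_continuous sin); auto. apply continuity_sin.
Qed.

(* Partial sums of the partial fraction expansion, with the conditionally convergent sine terms kept whole. *)
Definition pf_partial (t : C) (M : nat) (a : R) : C :=
  (/ t + sum_n (fun m => RtoC (cos (2 * PI * INR (S m) * a)) * pf_cos t m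
                     + RtoC (sin (2 * PI * INR (S m) * a)) * (RtoC (4 * PI * INR (S m)) / pf_den t m)) M)%C.

Lemma pf_partial_cv (t : C) (a : R) : pf_admissible t -> 0 < a < 1 ->
  Ccv (fun M => pf_partial t M a) (/ t + (RtoC (1 / 2 - a) + pf_sum t a))%C.
Proof.
  intros Ht Ha. pose proof PI_RGT_0. unfold pf_partial. apply Ccv_plus; [apply Ccv_const|].
  apply Cser_Ccv. apply Cser_ext with (fun m => (RtoC (sin (2 * PI * INR (S m) * a) / (PI * INR (S m))) + pf_term t a m)%C).
  - intros m. pose proof (pf_den_neq_0 t m Ht) as Hd. unfold pf_term, pf_sin, pf_cos.
    pose proof (INR_S_pos m) as Hm.
    assert (E : RtoC (/ (PI * INR (S m))) = ((RtoC (4 * PI * INR (S m)) + RtoC (/ (PI * INR (S m))) * (t * t)) / pf_den t m)%C).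
    { replace (RtoC (4 * PI * INR (S m)) + RtoC (/ (PI * INR (S m))) * (t * t))%C
        with (RtoC (/ (PI * INR (S m))) * pf_den t m)%C.
      - unfold Cdiv. rewrite <- Cmult_assoc, Cinv_r; auto. ring.
      - unfold pf_den. replace (RtoC (4 * PI * INR (S m))) with (RtoC (/ (PI * INR (S m))) * RtoC (4 * PI ^ 2 * INR (S m) ^ 2))%C.
        + ring.
        + rewrite <- RtoC_mult. f_equal. field. split; lra. }
    unfold Rdiv. rewrite RtoC_mult. rewrite E at 1. field. auto.
  - apply Cser_plus; [|now apply pf_sum_correct]. apply Cser_RtoC. now apply is_series_sin_div.
Qed.

Lemma exp_le_mono (x y : R) : x <= y -> exp x <= exp y.
Proof. intros [H|H]; [left; now apply exp_increasing|subst; lra]. Qed.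

(** With the corrector added, exp(tu) times the partial expansion has derivative exp(tu) (t
    [dirichlet_corr] + [dirichlet_rem]), of size O(1/M) between [b] and [c]; the correctors at the
    two ends vanish in the limit. *)
Lemma pf_const_partial (t : C) (b c : R) : pf_admissible t -> 0 < b < 1 -> 0 < c < 1 ->
  Ccv (fun M => (Cexp (t * RtoC c) * pf_partial t M c - Cexp (t * RtoC b) * pf_partial t M b)%C) 0.
Proof.
  intros Ht Hb Hc. pose proof PI_RGT_0 as HPI.
  set (s := Rmin (sin (PI * b)) (sin (PI * c))).
  assert (Hs : 0 < s) by (apply Rmin_glb_lt; apply sin_PI_pos; lra).
  set (L := fun M : nat => INR (2 * M + 3)).
  assert (HL : forall M, 0 < L M) by (intros M; apply lt_0_INR; lia).
  set (V := fun M u => (Cexp (t * RtoC u) * (pf_partial t M u + RtoC (dirichlet_corr (L M) u)))%C).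
  set (V' := fun M u => (Cexp (t * RtoC u) * (t * RtoC (dirichlet_corr (L M) u) + RtoC (dirichlet_rem (L M) u)))%C).
  set (K := exp (Rabs (Re t)) * (Cmod t * / s + / s ^ 2)).
  assert (HV : forall M, Cmod (V M c - V M b) <= 2 * (K * / L M) * Rabs (c - b)).
  { intros M. apply MVT_bound_RC with (f' := V' M).
    - intros u Hu. pose proof (sin_PI_lower b c u Hb Hc Hu) as Hl. fold s in Hl.
      assert (Hd : is_derive_RC (fun u => (pf_partial t M u + RtoC (dirichlet_corr (L M) u))%C) u
        ((0 + sum_n (fun m => RtoC (- (2 * PI * INR (S m)) * sin (2 * PI * INR (S m) * u)) * pf_cos t m
                     + RtoC ((2 * PI * INR (S m)) * cos (2 * PI * INR (S m) * u)) * (RtoC (4 * PI * INR (S m)) / pf_den t m)) M)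
         + RtoC (- (sin (L M * PI * u) / sin (PI * u)) + dirichlet_rem (L M) u))%C).
      { apply is_derive_RC_plus.
        - unfold pf_partial. apply is_derive_RC_plus; [apply is_derive_RC_const|].
          apply is_derive_RC_sum_n with (f' := fun m u => (RtoC (- (2 * PI * INR (S m)) * sin (2 * PI * INR (S m) * u)) * pf_cos t m
                     + RtoC ((2 * PI * INR (S m)) * cos (2 * PI * INR (S m) * u)) * (RtoC (4 * PI * INR (S m)) / pf_den t m))%C).
          intros m.
          apply is_derive_RC_plus.
          + match goal with |- is_derive_RC _ _ (?x * ?y)%C => replace (x * y)%C with (x * y + RtoC (cos (2 * PI * INR (S m) * u)) * 0)%C by ring end.
            apply (is_derive_RC_mult (fun u => RtoC (cos (2 * PI * INR (S m) * u))) (fun _ => pf_cos t m)); [|apply is_derive_RC_const].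
            apply is_derive_RC_RtoC. generalize (INR (S m)); intros k. auto_derive; auto; ring.
          + match goal with |- is_derive_RC _ _ (?x * ?y)%C => replace (x * y)%C with (x * y + RtoC (sin (2 * PI * INR (S m) * u)) * 0)%C by ring end.
            apply (is_derive_RC_mult (fun u => RtoC (sin (2 * PI * INR (S m) * u))) (fun _ => (RtoC (4 * PI * INR (S m)) / pf_den t m)%C)); [|apply is_derive_RC_const].
            apply is_derive_RC_RtoC. generalize (INR (S m)); intros k. auto_derive; auto; ring.
        - apply is_derive_RC_RtoC. apply is_derive_dirichlet_corr; auto; lra. }
      pose proof (is_derive_RC_mult _ _ u _ _ (is_derive_RC_Cexp t u) Hd) as HD.
      match type of HD with is_derive_RC _ _ ?X => replace (V' M u) with X; [exact HD|] end.
      unfold V', pf_partial.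
      assert (ED : RtoC (sin (L M * PI * u) / sin (PI * u)) = (1 + sum_n (fun m => RtoC (2 * cos (2 * PI * INR (S m) * u))) M)%C).
      { pose proof (sum_cos_2 u M) as E.
        transitivity (1 + RtoC (2 * sum_n (fun k => cos (2 * PI * INR (S k) * u)) M))%C.
        - rewrite <- RtoC_plus. f_equal. unfold L.
          replace (sin (INR (2 * M + 3) * PI * u)) with
            (2 * sin (PI * u) * sum_n (fun k => cos (2 * PI * INR (S k) * u)) M + sin (PI * u)) by lra.
          field; lra.
        - f_equal. rewrite <- sum_n_Rmult_l. apply RtoC_sum_n. }
      (* Termwise, t times the expansion plus its derivative: the sines cancel and the cosines
         combine to (2 t^2 + 8 pi^2 m^2)/(t^2 + 4 pi^2 m^2) = 2. Together with t * (1/t) = 1 this is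
         the Dirichlet kernel. *)
      assert (ES : (t * sum_n (fun m => RtoC (cos (2 * PI * INR (S m) * u)) * pf_cos t m
                     + RtoC (sin (2 * PI * INR (S m) * u)) * (RtoC (4 * PI * INR (S m)) / pf_den t m)) M
              + sum_n (fun m => RtoC (- (2 * PI * INR (S m)) * sin (2 * PI * INR (S m) * u)) * pf_cos t m
                     + RtoC ((2 * PI * INR (S m)) * cos (2 * PI * INR (S m) * u)) * (RtoC (4 * PI * INR (S m)) / pf_den t m)) M
              = sum_n (fun m => RtoC (2 * cos (2 * PI * INR (S m) * u))) M)%C).
      { rewrite <- sum_n_Cmult_l, <- sum_n_Cplus. apply sum_n_ext. intros m.
        pose proof (pf_den_neq_0 t m Ht) as Hd'. unfold pf_cos.
        rewrite !RtoC_mult, !RtoC_opp, !RtoC_mult.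
        assert (E1 : (RtoC 2 * RtoC (cos (2 * PI * INR (S m) * u)))%C = (RtoC 2 * RtoC (cos (2 * PI * INR (S m) * u)) * (t * t + RtoC 4 * RtoC PI * RtoC PI * RtoC (INR (S m)) * RtoC (INR (S m))) / pf_den t m)%C).
        { replace (t * t + RtoC 4 * RtoC PI * RtoC PI * RtoC (INR (S m)) * RtoC (INR (S m)))%C with (pf_den t m).
          - field; auto.
          - unfold pf_den. rewrite <- !RtoC_mult. do 2 f_equal. simpl; ring. }
        as_C. rewrite E1. field. auto. }
      rewrite RtoC_plus, RtoC_opp, ED, <- ES. field. exact (proj1 Ht).
    - intros u Hu. pose proof (sin_PI_lower b c u Hb Hc Hu) as Hl. fold s in Hl.
      unfold V'. rewrite Cmod_mult, Cmod_Cexp. unfold K. rewrite Rmult_assoc.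
      apply Rmult_le_compat; try apply Cmod_ge_0. left; apply exp_pos.
      + apply exp_le_mono. replace (Re (t * RtoC u)) with (Re t * u) by (destruct t; simpl; ring).
        assert (0 < u < 1).
        { destruct Hu as [Hu1 Hu2]. split.
          - apply Rlt_le_trans with (2 := Hu1). apply Rmin_glb_lt; lra.
          - apply Rle_lt_trans with (1 := Hu2). apply Rmax_lub_lt; lra. }
        apply Rle_trans with (Rabs (Re t) * u).
        * apply Rmult_le_compat_r; [lra|]. apply Rle_abs.
        * rewrite <- (Rmult_1_r (Rabs (Re t))) at 2. apply Rmult_le_compat_l; [apply Rabs_pos|lra].
      + eapply Rle_trans; [apply Cmod_triangle|]. rewrite Cmod_mult, !Cmod_R.
        rewrite Rmult_plus_distr_r. apply Rplus_le_compat.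
        * rewrite Rmult_assoc. apply Rmult_le_compat_l; [apply Cmod_ge_0|]. now apply dirichlet_corr_bound.
        * now apply dirichlet_rem_bound. }
  apply Ccv_ext with (fun M => ((V M c - V M b) + (Cexp (t * RtoC b) * RtoC (dirichlet_corr (L M) b) - Cexp (t * RtoC c) * RtoC (dirichlet_corr (L M) c)))%C).
  - intros M. unfold V. ring.
  - replace (RtoC 0) with (0 + (Cexp (t * RtoC b) * 0 - Cexp (t * RtoC c) * 0))%C by ring.
    assert (Hcr : forall u, 0 < u < 1 -> Ccv (fun M => RtoC (dirichlet_corr (L M) u)) 0).
    { intros u Hu. apply Ccv_RtoC. apply is_lim_seq_squeeze_0 with (fun M => / sin (PI * u) * / INR (2 * M + 3)).
      - intros M. rewrite Rminus_0_r. apply dirichlet_corr_bound; [apply HL|]. pose proof (sin_PI_pos u Hu); lra.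
      - apply is_lim_seq_scal_0, is_lim_seq_inv_2n3. }
    apply Ccv_plus; [|apply Ccv_minus; apply Ccv_mult; auto; apply Ccv_const].
    apply Ccv_Cmod_0.
    apply is_lim_seq_le_le with (fun _ => 0) (fun M => (2 * K * Rabs (c - b)) * / INR (2 * M + 3)).
    + intros M. split; [apply Cmod_ge_0|]. replace (V M c - V M b - 0)%C with (V M c - V M b)%C by ring.
      eapply Rle_trans; [apply HV|]. right. unfold L; ring.
    + apply is_lim_seq_const.
    + apply is_lim_seq_scal_0, is_lim_seq_inv_2n3.
Qed.

Lemma pf_const (t : C) (b c : R) : pf_admissible t -> 0 < b < 1 -> 0 < c < 1 ->
  (Cexp (t * RtoC c) * (/ t + (RtoC (1 / 2 - c) + pf_sum t c)) =
   Cexp (t * RtoC b) * (/ t + (RtoC (1 / 2 - b) + pf_sum t b)))%C.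
Proof.
  intros Ht Hb Hc.
  assert (E : (Cexp (t * RtoC c) * (/ t + (RtoC (1 / 2 - c) + pf_sum t c)) -
   Cexp (t * RtoC b) * (/ t + (RtoC (1 / 2 - b) + pf_sum t b)) = 0)%C).
  { apply Ccv_unique with (2 := pf_const_partial t b c Ht Hb Hc).
    apply Ccv_minus; apply Ccv_mult; try apply Ccv_const; now apply pf_partial_cv. }
  rewrite <- (Cplus_0_r (Cexp (t * RtoC b) * _)), <- E. ring.
Qed.

Lemma pf_sum_0_1 (t : C) : pf_sum t 0 = pf_sum t 1.
Proof.
  assert (E : forall m, pf_term t 0 m = pf_term t 1 m).
  { intros m. unfold pf_term. rewrite Rmult_0_r, Rmult_1_r.
    replace (2 * PI * INR (S m)) with (0 + 2 * INR (S m) * PI) by ring.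
    rewrite cos_period, sin_period. reflexivity. }
  unfold pf_sum, CSeries. f_equal; apply Series_ext; intros m; now rewrite E.
Qed.

Lemma Cexp_cv (t : C) (b : nat -> R) (a : R) : is_lim_seq b a ->
  Ccv (fun p => Cexp (t * RtoC (b p))) (Cexp (t * RtoC a)).
Proof.
  intros Hb. destruct t as [p q].
  assert (Hx : is_lim_seq (fun n => p * b n - q * 0) (p * a - q * 0)).
  { apply is_lim_seq_minus'; [apply is_lim_seq_mult'|]; auto; apply is_lim_seq_const. }
  assert (Hy : is_lim_seq (fun n => p * 0 + q * b n) (p * 0 + q * a)).
  { apply is_lim_seq_plus'; [|apply is_lim_seq_mult']; auto; apply is_lim_seq_const. }
  split; simpl; apply is_lim_seq_mult'.
  - apply (is_lim_seq_continuous exp); auto. apply derivable_continuous, derivable_exp.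
  - apply (is_lim_seq_continuous cos); auto. apply continuity_cos.
  - apply (is_lim_seq_continuous exp); auto. apply derivable_continuous, derivable_exp.
  - apply (is_lim_seq_continuous sin); auto. apply continuity_sin.
Qed.

Lemma pf_limit (t : C) (b : nat -> R) (a : R) : pf_admissible t -> is_lim_seq b a -> (forall n, 0 < b n < 1) ->
  (Cexp (t * RtoC a) * (/ t + (RtoC (1 / 2 - a) + pf_sum t a)) =
   Cexp (t * RtoC (1/2)) * (/ t + (RtoC (1 / 2 - 1 / 2) + pf_sum t (1/2))))%C.
Proof.
  intros Ht Hb Hb1.
  apply Ccv_unique with (fun p => (Cexp (t * RtoC (b p)) * (/ t + (RtoC (1 / 2 - b p) + pf_sum t (b p))))%C).
  - apply Ccv_mult; [now apply Cexp_cv|]. apply Ccv_plus; [apply Ccv_const|]. apply Ccv_plus.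
    + apply Ccv_RtoC. apply is_lim_seq_minus'; auto. apply is_lim_seq_const.
    + now apply pf_sum_continuous.
  - apply Ccv_ext with (2 := Ccv_const _). intros n. symmetry. apply pf_const; auto. lra.
Qed.

(** The function of [a] on the open interval is a constant [K] by [pf_const]; continuity of [pf_sum]
    extends it to both ends, where [pf_sum] takes the same value. *)
Theorem partial_fraction (t : C) (a : R) : pf_admissible t -> 0 < a <= 1 ->
  ((1 - Cexp (- t)) * (/ t + (RtoC (1 / 2 - a) + pf_sum t a)) = Cexp (- (t * RtoC a)))%C.
Proof.
  intros Ht Ha.
  set (K := (Cexp (t * RtoC (1/2)) * (/ t + (RtoC (1 / 2 - 1 / 2) + pf_sum t (1/2))))%C).
  assert (B : forall n, 0 < / INR (S (S n)) < 1).
  { intros n. pose proof (INR_S_pos (S n)). split; [now apply Rinv_0_lt_compat|].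
    rewrite <- Rinv_1. apply Rinv_lt_contravar. lra. change 1 with (INR 1). apply lt_INR; lia. }
  assert (L0 : is_lim_seq (fun n => / INR (S (S n))) 0).
  { apply (is_lim_seq_incr_1 (fun n => / INR (S n))). apply is_lim_seq_inv_S. }
  assert (H0 := pf_limit t (fun n => / INR (S (S n))) 0 Ht L0 B). fold K in H0.
  assert (H1 : (Cexp (t * RtoC 1) * (/ t + (RtoC (1 / 2 - 1) + pf_sum t 1)) = K)%C).
  { apply (pf_limit t (fun n => 1 - / INR (S (S n))) 1 Ht).
    - replace (Finite 1) with (Finite (1 - 0)) by (f_equal; ring). apply is_lim_seq_minus'; auto. apply is_lim_seq_const.
    - intros n; specialize (B n); lra. }
  assert (Hall : (Cexp (t * RtoC a) * (/ t + (RtoC (1 / 2 - a) + pf_sum t a)) = K)%C).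
  { destruct (Req_dec a 1) as [->|Hn]; auto. apply pf_const; auto; lra. }
  rewrite pf_sum_0_1 in H0.
  replace (t * RtoC 0)%C with (RtoC 0) in H0 by ring. rewrite Cexp_0 in H0.
  replace (t * RtoC 1)%C with t in H1 by ring.
  (* With s the common value of [pf_sum] at 0 and 1, the two ends give K = 1/t + 1/2 + s and exp(-t)
     K = 1/t - 1/2 + s. *)
  assert (EK : ((1 - Cexp (- t)) * K = 1)%C).
  { rewrite Cexp_opp. pose proof (Cexp_neq_0 t). 
    assert (E2 : (/ Cexp t * K = / t + (RtoC (1 / 2 - 1) + pf_sum t 1))%C).
    { rewrite <- H1, Cmult_assoc, Cinv_l; auto. ring. }
    transitivity (K - / Cexp t * K)%C; [ring|]. rewrite E2, <- H0.
    replace (RtoC (1 / 2 - 0)) with (RtoC 1 + RtoC (1 / 2 - 1))%C by (rewrite <- RtoC_plus; f_equal; field). ring. }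
  rewrite (Cexp_opp (t * RtoC a)). pose proof (Cexp_neq_0 (t * RtoC a)).
  transitivity (/ Cexp (t * RtoC a) * ((1 - Cexp (- t)) * K))%C; [|rewrite EK; ring].
  rewrite <- Hall.
  transitivity ((/ Cexp (t * RtoC a) * Cexp (t * RtoC a)) * ((1 - Cexp (- t)) * (/ t + (RtoC (1 / 2 - a) + pf_sum t a))))%C; [|ring].
  rewrite Cinv_l; auto. ring.
Qed.

Lemma pf_den_RtoC (t : R) (m : nat) : pf_den t m = RtoC (t ^ 2 + 4 * PI ^ 2 * INR (S m) ^ 2).
Proof. unfold pf_den. rewrite <- RtoC_mult, <- RtoC_plus. f_equal. ring. Qed.

Lemma pf_den_pos (t : R) (m : nat) : 0 < t ^ 2 + 4 * PI ^ 2 * INR (S m) ^ 2.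
Proof.
  pose proof (INR_S_pos m). pose proof PI_RGT_0.
  assert (0 < PI * INR (S m)) by now apply Rmult_lt_0_compat. nra.
Qed.

Lemma pf_admissible_RtoC (t : R) : t <> 0 -> pf_admissible t.
Proof.
  intros Ht. split; [now apply RtoC_neq_0|]. exists (4 * PI ^ 2). pose proof PI_RGT_0. split; [nra|].
  intros m. rewrite pf_den_RtoC, Cmod_R. pose proof (pf_den_pos t m).
  rewrite Rabs_pos_eq by lra. pose proof (pow2_ge_0 t). lra.
Qed.

Definition pf_rterm (t a : R) (m : nat) : R :=
  cos (2 * PI * INR (S m) * a) * (2 * t / (t ^ 2 + 4 * PI ^ 2 * INR (S m) ^ 2))
  - sin (2 * PI * INR (S m) * a) * (t ^ 2 / (PI * INR (S m) * (t ^ 2 + 4 * PI ^ 2 * INR (S m) ^ 2))).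

Lemma RtoC_div (x y : R) : y <> 0 -> RtoC (x / y) = (RtoC x / RtoC y)%C.
Proof. intros H. unfold Rdiv, Cdiv. rewrite RtoC_mult, RtoC_inv; auto. Qed.

Lemma pf_term_RtoC (t a : R) (m : nat) : pf_term t a m = RtoC (pf_rterm t a m).
Proof.
  pose proof (pf_den_pos t m). pose proof (INR_S_pos m). pose proof PI_RGT_0.
  unfold pf_term, pf_rterm, pf_cos, pf_sin. rewrite pf_den_RtoC.
  rewrite <- !RtoC_mult, <- !RtoC_div, <- !RtoC_mult, <- RtoC_minus by lra. f_equal.
  replace (t ^ 2 / (PI * INR (S m) * (t ^ 2 + 4 * PI ^ 2 * INR (S m) ^ 2))) with
   (/ (PI * INR (S m)) * (t * t / (t ^ 2 + 4 * PI ^ 2 * INR (S m) ^ 2))); [ring|].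
  field. repeat split; lra.
Qed.

Lemma partial_fraction_R (t a : R) : t <> 0 -> 0 < a <= 1 ->
  is_series (pf_rterm t a) (exp (- a * t) / (1 - exp (- t)) - / t - (1 / 2 - a)).
Proof.
  intros Ht Ha. pose proof (pf_admissible_RtoC t Ht) as HA.
  pose proof (partial_fraction t a HA Ha) as E.
  pose proof (pf_sum_correct t a HA) as Hs.
  pose proof (Cser_ext _ _ _ (pf_term_RtoC t a) Hs) as Hs'.
  destruct Hs' as [H1 H2]. simpl in H1.
  assert (E3 : pf_sum t a = RtoC (Re (pf_sum t a))).
  { apply C_eq; auto. change (Im (RtoC (Re (pf_sum t a)))) with 0.
    pose proof (is_series_0 (fun n => Im (RtoC (pf_rterm t a n))) (fun _ => eq_refl)) as H0.
    apply is_series_unique in H0, H2. congruence. }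
  rewrite E3 in E. set (s := Re (pf_sum t a)) in *.
  assert (He : 1 - exp (- t) <> 0).
  { intros F. apply Ht. assert (exp (- t) = exp 0) by (rewrite exp_0; lra). apply exp_inv in H. lra. }
  rewrite <- RtoC_opp, Cexp_RtoC, <- RtoC_inv, <- !RtoC_plus, <- RtoC_minus, <- !RtoC_mult, <- RtoC_opp, Cexp_RtoC in E; auto.
  injection E as E.
  replace (exp (- a * t) / (1 - exp (- t)) - / t - (1 / 2 - a)) with s; auto.
  replace (- a * t) with (- (t * a)) by ring. rewrite <- E. field. auto.
Qed.

(** Adding the sawtooth series back restores the sine kernel in the form that splits over roots of
    unity, at the price of conditional convergence and of the endpoint. *)
Lemma partial_fraction_R_cond (t a : R) : t <> 0 -> 0 < a < 1 ->
  is_series (fun m => cos (2 * PI * INR (S m) * a) * (2 * t / (t ^ 2 + 4 * PI ^ 2 * INR (S m) ^ 2))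
     + sin (2 * PI * INR (S m) * a) * (4 * PI * INR (S m) / (t ^ 2 + 4 * PI ^ 2 * INR (S m) ^ 2)))
   (exp (- a * t) / (1 - exp (- t)) - / t).
Proof.
  intros Ht Ha.
  replace (exp (- a * t) / (1 - exp (- t)) - / t) with ((exp (- a * t) / (1 - exp (- t)) - / t - (1 / 2 - a)) + (1 / 2 - a)) by ring.
  eapply is_series_ext; [|apply (is_series_plus (V := R_NormedModule)); [apply (partial_fraction_R t a); auto; lra|apply is_series_sin_div; auto]].
  intros m. simpl. unfold pf_rterm. change (@plus R_NormedModule) with Rplus. as_R.
  pose proof (pf_den_pos t m). pose proof (INR_S_pos m). pose proof PI_RGT_0.
  change (match m with 0%nat => 1 | S _ => INR m + 1 end) with (INR (S m)).
  field. repeat split; lra.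
Qed.

(** This is the expansion at a = 1, where the sines vanish: the sum is 1/(exp t - 1) - 1/t + 1/2,
    and exp t - 1 >= t. It will measure the total variation of the kernels. *)
Lemma is_series_inv_sum_sq (t : R) : 0 < t ->
  exists l, is_series (fun m => 2 * t / (t ^ 2 + 4 * PI ^ 2 * INR (S m) ^ 2)) l /\ l <= 1 / 2.
Proof.
  intros Ht. exists (exp (- 1 * t) / (1 - exp (- t)) - / t - (1 / 2 - 1)). split.
  - eapply is_series_ext; [|apply (partial_fraction_R t 1); lra].
    intros m. unfold pf_rterm. as_R. rewrite Rmult_1_r.
    replace (2 * PI * INR (S m)) with (0 + 2 * INR (S m) * PI) by ring.
    rewrite cos_period, sin_period, cos_0, sin_0. ring.
  - replace (-1 * t) with (- t) by ring.
    assert (exp (- t) < 1) by (rewrite <- exp_0; apply exp_increasing; lra).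
    assert (exp (- t) * exp t = 1) by (rewrite <- exp_plus, <- exp_0; f_equal; ring).
    pose proof (exp_ineq1_le t). pose proof (exp_pos (- t)).
    assert (exp (- t) / (1 - exp (- t)) <= / t); [|lra].
    apply Rmult_le_reg_r with (t * (1 - exp (- t))); [apply Rmult_lt_0_compat; lra|].
    replace (exp (- t) / (1 - exp (- t)) * (t * (1 - exp (- t)))) with (exp (- t) * t) by (field; lra).
    replace (/ t * (t * (1 - exp (- t)))) with (1 - exp (- t)) by (field; lra). nra.
Qed.

Lemma series_inv_sum_sq (r : R) : 0 < r ->
  ex_series (fun m => / (INR (S m) ^ 2 + r ^ 2)) /\ Series (fun m => / (INR (S m) ^ 2 + r ^ 2)) <= PI / (2 * r).
Proof.
  intros Hr. pose proof PI_RGT_0. destruct (is_series_inv_sum_sq (2 * PI * r)) as [l [Hl Hl2]].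
  { apply Rmult_lt_0_compat; lra. }
  assert (H1 : is_series (fun m => / (INR (S m) ^ 2 + r ^ 2)) (PI / r * l)).
  { eapply is_series_ext; [|apply (is_series_scal (V := R_NormedModule) (PI / r)); exact Hl].
    intros m. change (@scal R_AbsRing R_NormedModule) with Rmult. simpl scal. as_R.
    cbv beta. pose proof (INR_S_pos m). set (k := INR (S m)) in *. field.
    assert (0 < k ^ 2) by nra. assert (0 < r ^ 2) by nra. assert (0 < PI ^ 2) by nra.
    assert (0 < PI ^ 2 * r ^ 2) by now apply Rmult_lt_0_compat.
    assert (0 < PI ^ 2 * k ^ 2) by now apply Rmult_lt_0_compat. repeat split; try lra. }
  split; [eexists; eauto|]. rewrite (is_series_unique _ _ H1).
  replace (PI / (2 * r)) with (PI / r * (1 / 2)) by (field; lra). apply Rmult_le_compat_l; auto.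
  left; apply Rdiv_lt_0_compat; lra.
Qed.

Definition cpolar (r th : R) : C := (r * cos th, r * sin th).

Lemma Cmod_cpolar (r th : R) : 0 <= r -> Cmod (cpolar r th) = r.
Proof.
  intros Hr. unfold Cmod, cpolar. simpl fst; simpl snd.
  replace ((r * cos th) ^ 2 + (r * sin th) ^ 2) with (r ^ 2).
  - now apply sqrt_pow2.
  - pose proof (sin2_cos2 th) as E. unfold Rsqr in E.
    replace (r ^ 2) with (r ^ 2 * (sin th * sin th + cos th * cos th)) by (rewrite E; ring). ring.
Qed.

(** The squared modulus equals cos^2(th) (u^2 + r^2)^2 + sin^2(th) (u^2 - r^2)^2. *)
Lemma Cmod_sq_add_polar (u r th : R) : 0 <= cos th ->
  cos th * (u ^ 2 + r ^ 2) <= Cmod (RtoC (u ^ 2) + cpolar r th * cpolar r th).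
Proof.
  intros Hc.
  apply Rsqr_incr_0_var; [|apply Cmod_ge_0].
  rewrite !Rsqr_pow2, Cmod2_alt. simpl Re; simpl Im.
  pose proof (sin2_cos2 th) as E. unfold Rsqr in E.
  assert (E2 : sin th * sin th = 1 - cos th * cos th) by lra.
  match goal with |- ?Y <= ?X => assert (E3 : X = Y + (sin th * sin th) * (u ^ 2 - r ^ 2) ^ 2) by ring [E2] end.
  rewrite E3.
  assert (0 <= (sin th * sin th) * (u ^ 2 - r ^ 2) ^ 2) by (apply Rmult_le_pos; [apply Rle_0_sqr|apply pow2_ge_0]). lra.
Qed.

(** * The kernels w/(n^2 + w^2) and n/(n^2 + w^2) *)

Section CothPsi.
Variables (r th : R).
Hypothesis (Hr : 0 < r) (Hth : - (PI / 2) < th < PI / 2).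
Let w : C := cpolar r th.

Lemma cpolar_cos_pos : 0 < cos th.
Proof. apply cos_gt_0; lra. Qed.

Lemma cpolar_neq_0 : w <> 0.
Proof. apply Cmod_gt_0. unfold w. rewrite Cmod_cpolar; lra. Qed.

Lemma cpolar_den_lower (u : R) : cos th * (u ^ 2 + r ^ 2) <= Cmod (RtoC (u ^ 2) + w * w).
Proof. apply Cmod_sq_add_polar. left; apply cpolar_cos_pos. Qed.

Lemma cpolar_den_neq_0 (u : R) : (RtoC (u ^ 2) + w * w)%C <> 0.
Proof.
  apply Cmod_gt_0. apply Rlt_le_trans with (2 := cpolar_den_lower u).
  apply Rmult_lt_0_compat; [apply cpolar_cos_pos|]. pose proof (pow2_ge_0 u). nra.
Qed.

Lemma cpolar_exp_neq_1 : (Cexp (2 * PI * w) - 1)%C <> 0.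
Proof.
  intros E. assert (E2 : Cexp (2 * PI * w) = 1) by (rewrite <- (Cplus_0_l 1), <- E; ring).
  apply (f_equal Cmod) in E2. rewrite Cmod_Cexp, Cmod_1 in E2.
  assert (0 < Re (2 * PI * w)).
  { unfold w, cpolar; simpl. pose proof PI_RGT_0. pose proof cpolar_cos_pos.
    assert (0 < r * cos th) by now apply Rmult_lt_0_compat. 
    assert (0 < PI * (r * cos th)) by now apply Rmult_lt_0_compat. lra. }
  apply exp_increasing in H. rewrite exp_0 in H. lra.
Qed.

Lemma pf_den_cpolar (m : nat) : pf_den (2 * PI * w) m = (RtoC (4 * PI ^ 2) * (RtoC (INR (S m) ^ 2) + w * w))%C.
Proof.
  unfold pf_den. rewrite !RtoC_mult, !RtoC_pow. ring_simplify. reflexivity.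
Qed.

Lemma pf_admissible_cpolar : pf_admissible (2 * PI * w).
Proof.
  pose proof PI_RGT_0. pose proof cpolar_cos_pos. split.
  - apply Cmod_gt_0. rewrite !Cmod_mult, !Cmod_R, !Rabs_pos_eq by lra. unfold w; rewrite Cmod_cpolar by lra.
    apply Rmult_lt_0_compat; lra.
  - exists (4 * PI ^ 2 * cos th). assert (0 < 4 * PI ^ 2) by nra. split; [now apply Rmult_lt_0_compat|].
    intros m. rewrite pf_den_cpolar, Cmod_mult, Cmod_R, Rabs_pos_eq by lra. rewrite Rmult_assoc.
    apply Rmult_le_compat_l; [lra|].
    apply Rle_trans with (2 := cpolar_den_lower _). apply Rmult_le_compat_l; [lra|]. nra.
Qed.

(** The partial fraction theorem at t = 2 pi w and a = 1. The value is (pi/2) coth(pi w) - 1/(2w),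
    written with exp(2 pi w) - 1 as in the final formula. *)
Lemma coth_series : Cser (fun m => (w / (RtoC (INR (S m) ^ 2) + w * w))%C)
  (- (/ (2 * w)) + PI / 2 + PI / (Cexp (2 * PI * w) - 1))%C.
Proof.
  pose proof PI_RGT_0 as HPI. pose proof cpolar_exp_neq_1 as He. pose proof cpolar_neq_0 as Hw.
  pose proof (Cexp_neq_0 (2 * PI * w)) as Hx.
  assert (HP : RtoC PI <> 0) by (apply RtoC_neq_0; lra).
  assert (H2 : RtoC 2 <> 0) by (apply RtoC_neq_0; lra).
  pose proof (partial_fraction (2 * PI * w) 1 pf_admissible_cpolar ltac:(lra)) as E.
  pose proof (pf_sum_correct (2 * PI * w) 1 pf_admissible_cpolar) as Hs.
  rewrite Cmult_1_r, Cexp_opp in E.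
  set (X := Cexp (2 * PI * w)) in *. set (p := pf_sum (2 * PI * w) 1) in *.
  assert (Ep : p = (/ (X - 1) - / (2 * PI * w) + 1 / 2)%C).
  { assert (E1 : ((X - 1) * (/ (2 * PI * w) + (RtoC (1 / 2 - 1) + p)) = 1)%C).
    { transitivity (X * ((1 - / X) * (/ (2 * PI * w) + (RtoC (1 / 2 - 1) + p))))%C.
      - field. repeat split; auto.
      - rewrite E. field. auto. }
    assert (E2 : (/ (2 * PI * w) + (RtoC (1 / 2 - 1) + p) = / (X - 1))%C).
    { transitivity (/ (X - 1) * ((X - 1) * (/ (2 * PI * w) + (RtoC (1 / 2 - 1) + p))))%C; [|rewrite E1; ring].
      rewrite Cmult_assoc, Cinv_l; auto. ring. }
    rewrite <- E2. replace (RtoC (1 / 2 - 1)) with (- (1 / 2))%C; [ring|].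
    rewrite <- RtoC_div, <- RtoC_opp by lra. f_equal. field. }
  replace (- (/ (2 * w)) + PI / 2 + PI / (X - 1))%C with (PI * p)%C.
  - apply Cser_ext with (2 := Cser_scal PI _ _ Hs). intros m. unfold pf_term, pf_cos, pf_sin.
    replace (2 * PI * INR (S m) * 1) with (0 + 2 * INR (S m) * PI) by ring.
    rewrite cos_period, sin_period, cos_0, sin_0, pf_den_cpolar.
    pose proof (cpolar_den_neq_0 (INR (S m))). rewrite RtoC_mult, RtoC_pow.
    assert (RtoC 4 <> 0) by (apply RtoC_neq_0; lra).
    replace (RtoC 4) with (RtoC 2 * RtoC 2)%C by (rewrite <- RtoC_mult; f_equal; ring).
    field. repeat split; auto.
  - rewrite Ep. field. repeat split; auto.
Qed.

(* Tends to [(psi (i z) + psi (- i z)) / 2]: the terms [k = 0] of the two digamma functions cancel. *)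
Definition Psi_partial (z : C) (n : nat) : C :=
  (RtoC (ln (INR (S n))) - sum_n (fun k => RtoC (INR (S k)) / (RtoC (INR (S k) ^ 2) + z * z)) n)%C.

Let p := Re (w * w).
Let q := Im (w * w).

Lemma log_den_pos (u : R) : 0 < (u ^ 2 + p) ^ 2 + q ^ 2.
Proof.
  pose proof (cpolar_den_neq_0 u) as H. apply Cmod_gt_0 in H.
  assert (0 < Cmod (RtoC (u ^ 2) + w * w) ^ 2) by nra. rewrite Cmod2_alt in H0.
  replace (Re (RtoC (u ^ 2) + w * w)) with (u ^ 2 + p) in H0 by reflexivity.
  replace (Im (RtoC (u ^ 2) + w * w)) with (0 + q) in H0 by reflexivity. 
  rewrite Rplus_0_l in H0. exact H0.
Qed.

(** Half the argument of u^2 + w^2 up to a constant, taken as an arctangent of the inverse slope: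
    the denominator [q] is constant, whereas u^2 + p may vanish. If q = 0, then w is real and the
    argument is constant. *)
Let G (u : R) : R := if Req_dec_T q 0 then 0 else - (1 / 2) * atan ((u ^ 2 + p) / q).
(* A branch of [1/2 Log (u^2 + w^2)] up to an additive imaginary constant. *)
Let F (u : R) : C := (1 / 4 * ln ((u ^ 2 + p) ^ 2 + q ^ 2), G u).

Lemma is_derive_RC_halflog (u : R) : is_derive_RC F u (RtoC u / (RtoC (u ^ 2) + w * w)).
Proof.
  pose proof (log_den_pos u) as Hd.
  assert (E : (RtoC u / (RtoC (u ^ 2) + w * w))%C =
    (u * (u ^ 2 + p) / ((u ^ 2 + p) ^ 2 + q ^ 2), - (u * q) / ((u ^ 2 + p) ^ 2 + q ^ 2))).
  { unfold Cdiv, Cinv.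
    replace (fst (RtoC (u ^ 2) + w * w)%C) with (u ^ 2 + p) by reflexivity.
    replace (snd (RtoC (u ^ 2) + w * w)%C) with (0 + q) by reflexivity. rewrite Rplus_0_l.
    apply C_eq; simpl Re; simpl Im; unfold Re, Im; cbn [fst snd Cmult RtoC]; unfold Cmult; cbn [fst snd]; field; lra. }
  rewrite E. split; cbn [Re Im fst snd].
  - unfold F, Re; cbn [fst]. auto_derive; [exact Hd|]. field. lra.
  - unfold F, Im; cbn [snd]. unfold G. destruct (Req_dec_T q 0) as [Hq|Hq].
    + rewrite Hq. replace (- (u * 0) / ((u ^ 2 + p) ^ 2 + 0 ^ 2)) with 0 by (unfold Rdiv; ring).
      apply (is_derive_const (V := R_NormedModule)).
    + auto_derive; auto. unfold Rsqr. field. split; auto.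
      replace (q ^ 2 + (u ^ 2 + p) ^ 2) with ((u ^ 2 + p) ^ 2 + q ^ 2) by ring. lra.
Qed.

(** Error of the right-endpoint rule for F' = u/(u^2 + w^2). Here F'(u) - F'(v) = (v - u)(uv -
    w^2)/((u^2 + w^2)(v^2 + w^2)), and |uv - w^2| <= v^2 + r^2 cancels one denominator, which leaves
    a summable bound. *)
Lemma halflog_step (k : nat) :
  Cmod (F (INR (S k)) - F (INR k) - RtoC (INR (S k)) / (RtoC (INR (S k) ^ 2) + w * w))
  <= 2 / (cos th) ^ 2 * / (INR k ^ 2 + r ^ 2).
Proof.
  pose proof cpolar_cos_pos as Hc. set (v := INR (S k)). set (b := INR k).
  assert (Hv : v = b + 1) by (unfold v, b; apply S_INR). assert (Hb : 0 <= b) by apply pos_INR.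
  set (fv := (RtoC v / (RtoC (v ^ 2) + w * w))%C).
  pose proof (cpolar_den_lower v) as Lv. pose proof (cpolar_den_neq_0 v) as Nv.
  assert (Pv : 0 < v ^ 2 + r ^ 2) by nra.
  replace (F v - F b - fv)%C with ((F v + - (RtoC v) * fv) - (F b + - (RtoC b) * fv))%C.
  2: { rewrite Hv at 2. rewrite RtoC_plus. ring. }
  eapply Rle_trans.
  - apply (MVT_bound_RC (fun u => (F u + - (RtoC u) * fv)%C) (fun u => (RtoC u / (RtoC (u ^ 2) + w * w) + (- (1) * fv + - RtoC u * 0))%C)
      b v (/ (cos th) ^ 2 * / (b ^ 2 + r ^ 2))).
    + intros u Hu. apply is_derive_RC_plus; [apply is_derive_RC_halflog|].
      apply (is_derive_RC_mult (fun u => (- RtoC u)%C) (fun _ => fv)); [|apply is_derive_RC_const].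
      split; simpl; auto_derive; auto; ring.
    + intros u Hu. rewrite Rmin_left, Rmax_right in Hu by lra.
      pose proof (cpolar_den_lower u) as Lu. pose proof (cpolar_den_neq_0 u) as Nu.
      assert (Pu : 0 < u ^ 2 + r ^ 2) by nra.
      replace (RtoC u / (RtoC (u ^ 2) + w * w) + (- (1) * fv + - RtoC u * 0))%C with
        (RtoC (v - u) * (RtoC (u * v) - w * w) / ((RtoC (u ^ 2) + w * w) * (RtoC (v ^ 2) + w * w)))%C.
      2: { unfold fv. rewrite RtoC_minus, RtoC_mult. rewrite !RtoC_pow in *. field. split; auto. }
      assert (N2 : ((RtoC (u ^ 2) + w * w) * (RtoC (v ^ 2) + w * w))%C <> 0) by (apply Cmult_neq_0; auto).
      rewrite Cmod_div, !Cmod_mult, Cmod_R by auto.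
      assert (B1 : Rabs (v - u) <= 1) by (apply Rabs_le; lra).
      assert (B2 : Cmod (RtoC (u * v) - w * w) <= v ^ 2 + r ^ 2).
      { eapply Rle_trans; [apply Cmod_triangle|]. rewrite Cmod_opp, Cmod_mult, Cmod_R. unfold w; rewrite Cmod_cpolar by lra.
        rewrite Rabs_pos_eq by nra. nra. }
      assert (Qu : 0 < cos th * (u ^ 2 + r ^ 2)) by now apply Rmult_lt_0_compat.
      assert (Qv : 0 < cos th * (v ^ 2 + r ^ 2)) by now apply Rmult_lt_0_compat.
      apply Rle_trans with (1 * (v ^ 2 + r ^ 2) / ((cos th * (u ^ 2 + r ^ 2)) * (cos th * (v ^ 2 + r ^ 2)))).
      * unfold Rdiv. apply Rmult_le_compat.
        -- apply Rmult_le_pos; [apply Rabs_pos|apply Cmod_ge_0].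
        -- left; apply Rinv_0_lt_compat. apply Rmult_lt_0_compat; lra.
        -- apply Rmult_le_compat; auto using Rabs_pos, Cmod_ge_0.
        -- apply Rinv_le_contravar; [now apply Rmult_lt_0_compat|]. apply Rmult_le_compat; lra.
      * replace (1 * (v ^ 2 + r ^ 2) / ((cos th * (u ^ 2 + r ^ 2)) * (cos th * (v ^ 2 + r ^ 2))))
          with (/ (cos th) ^ 2 * / (u ^ 2 + r ^ 2)) by (field; repeat split; lra).
        apply Rmult_le_compat_l; [left; apply Rinv_0_lt_compat; nra|].
        apply Rinv_le_contravar; nra.
  - rewrite Hv. replace (b + 1 - b) with 1 by ring. rewrite Rabs_R1. right. unfold Rdiv; ring.
Qed.

Lemma halflog_sum (n : nat) :
  Psi_partial w n = (RtoC (ln (INR (S n))) - F (INR (S n)) + F 0 +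
    sum_n (fun k => F (INR (S k)) - F (INR k) - RtoC (INR (S k)) / (RtoC (INR (S k) ^ 2) + w * w)) n)%C.
Proof.
  unfold Psi_partial.
  assert (E : forall n, sum_n (fun k => F (INR (S k)) - F (INR k) - RtoC (INR (S k)) / (RtoC (INR (S k) ^ 2) + w * w))%C n
    = (F (INR (S n)) - F 0 - sum_n (fun k => RtoC (INR (S k)) / (RtoC (INR (S k) ^ 2) + w * w)) n)%C).
  { clear n. intros n. induction n.
    - rewrite !sum_O. reflexivity.
    - rewrite !sum_n_CS, IHn. as_C. ring. }
  rewrite E. ring.
Qed.

Lemma is_lim_seq_inv_S_pow (k : nat) : (0 < k)%nat -> is_lim_seq (fun n => / INR (S n) ^ k) 0.
Proof.
  intros Hk. apply is_lim_seq_squeeze_0 with (2 := is_lim_seq_inv_S). intros n. rewrite Rminus_0_r.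
  pose proof (INR_S_pos n). pose proof (INR_S_ge_1 n).
  rewrite Rabs_pos_eq by (left; apply Rinv_0_lt_compat, pow_lt; auto).
  apply Rinv_le_contravar; auto. rewrite <- (pow_1 (INR (S n))) at 1. apply Rle_pow; auto.
Qed.

(** F(0) is half a logarithm of w^2, and ln n - F(n) contributes the constant of the branch. Since
    |2 th| < pi, the two add up to the principal logarithm of w. *)
Lemma halflog_limit : Ccv (fun n => (RtoC (ln (INR (S n))) - F (INR (S n)) + F 0)%C) (ln r, th).
Proof.
  assert (Hp : p = r ^ 2 * cos (2 * th)) by (unfold p, w, cpolar; simpl; rewrite cos_2a; ring).
  assert (Hq : q = r ^ 2 * sin (2 * th)) by (unfold q, w, cpolar; simpl; rewrite sin_2a; ring).
  assert (Hr2 : 0 < r ^ 2) by nra.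
  split.
  - replace (Re (ln r, th)) with (0 + ln r) by (simpl; ring).
    apply is_lim_seq_ext with (fun n => - (1 / 4) * ln ((1 + p * / INR (S n) ^ 2) ^ 2 + q ^ 2 * / INR (S n) ^ 4) + ln r).
    + intros n. unfold F, Re, Cminus, Cplus, Copp, RtoC; cbn [fst]. pose proof (INR_S_pos n) as Hn.
      pose proof (log_den_pos (INR (S n))) as Hd.
      replace ((0 ^ 2 + p) ^ 2 + q ^ 2) with (r ^ 4).
      2: { rewrite Hp, Hq. pose proof (sin2_cos2 (2 * th)) as E. unfold Rsqr in E.
           transitivity (r ^ 4 * (sin (2 * th) * sin (2 * th) + cos (2 * th) * cos (2 * th))); [rewrite E|]; ring. }
      replace ((1 + p * / INR (S n) ^ 2) ^ 2 + q ^ 2 * / INR (S n) ^ 4) with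
        (((INR (S n) ^ 2 + p) ^ 2 + q ^ 2) / INR (S n) ^ 4) by (field; lra).
      rewrite ln_div by (auto; apply pow_lt; auto). rewrite !ln_pow by auto. simpl (INR 4). field.
    + apply is_lim_seq_plus'; [|apply is_lim_seq_const].
      replace (Finite 0) with (Finite (- (1 / 4) * ln ((1 + p * 0) ^ 2 + q ^ 2 * 0))).
      2: { f_equal. replace ((1 + p * 0) ^ 2 + q ^ 2 * 0) with 1 by ring. rewrite ln_1; ring. }
      apply is_lim_seq_mult'; [apply is_lim_seq_const|].
      apply (is_lim_seq_continuous ln).
      * apply continuity_pt_filterlim, (ex_derive_continuous ln). exists (/ ((1 + p * 0) ^ 2 + q ^ 2 * 0)). apply is_derive_ln. 
        replace ((1 + p * 0) ^ 2 + q ^ 2 * 0) with 1 by ring. lra.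
      * apply is_lim_seq_plus'.
        -- apply is_lim_seq_ext with (fun n => (1 + p * / INR (S n) ^ 2) * (1 + p * / INR (S n) ^ 2)); [intros; ring|].
           replace ((1 + p * 0) ^ 2) with ((1 + p * 0) * (1 + p * 0)) by ring.
           apply is_lim_seq_mult'; (apply is_lim_seq_plus'; [apply is_lim_seq_const|apply is_lim_seq_mult'; [apply is_lim_seq_const|apply is_lim_seq_inv_S_pow; lia]]).
        -- apply is_lim_seq_mult'; [apply is_lim_seq_const|apply is_lim_seq_inv_S_pow; lia].
  - unfold F, Im, Cminus, Cplus, Copp, RtoC; cbn [snd].
    unfold G. destruct (Req_dec_T q 0) as [Hq0|Hq0].
    + replace (Finite th) with (Finite 0).
      * apply is_lim_seq_ext with (2 := is_lim_seq_const 0). intros; ring.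
      * f_equal. rewrite Hq, sin_2a in Hq0. pose proof cpolar_cos_pos.
        assert (Hs : sin th = 0).
        { apply Rmult_integral in Hq0. destruct Hq0; [lra|]. nra. }
        rewrite <- sin_0 in Hs. apply sin_inj in Hs; lra.
    (* The index shift past |a| makes n^2 + a positive, so that atan y = pi/2 - atan(1/y) applies
       and the limit becomes one at 0. *)
    + assert (Hlim : forall a b : R, 0 < b -> is_lim_seq (fun n => atan ((INR (S n) ^ 2 + a) / b)) (PI / 2)).
      { intros a b Hb. apply (is_lim_seq_incr_n _ (Z.to_nat (up (Rabs a)))).
        apply is_lim_seq_ext with (fun n => PI / 2 - atan (b * / INR (S (n + Z.to_nat (up (Rabs a)))) ^ 2 * / (1 + a * / INR (S (n + Z.to_nat (up (Rabs a)))) ^ 2))).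
        - intros n. set (m := INR (S (n + Z.to_nat (up (Rabs a))))).
          assert (Hm : Rabs a < m).
          { unfold m. rewrite S_INR, plus_INR, INR_IZR_INZ, (INR_IZR_INZ (Z.to_nat _)), Z2Nat.id.
            - destruct (archimed (Rabs a)). pose proof (pos_INR n). rewrite INR_IZR_INZ in H1. lra.
            - apply le_IZR. destruct (archimed (Rabs a)). pose proof (Rabs_pos a). lra. }
          assert (1 <= m) by (unfold m; change 1 with (INR 1); apply le_INR; lia).
          assert (Ha : 0 < m ^ 2 + a). { apply Rabs_def2 in Hm. nra. }
          replace (b * / m ^ 2 * / (1 + a * / m ^ 2)) with (/ ((m ^ 2 + a) / b)).
          + rewrite atan_inv; [ring|]. now apply Rdiv_lt_0_compat.
          + field. repeat split; try lra.
        - replace (Finite (PI / 2)) with (Finite (PI / 2 - atan (b * 0 * / (1 + a * 0)))).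
          2: { f_equal. replace (b * 0 * / (1 + a * 0)) with 0 by ring. rewrite atan_0; ring. }
          apply is_lim_seq_minus'; [apply is_lim_seq_const|]. apply (is_lim_seq_continuous atan).
          { apply derivable_continuous_pt, derivable_pt_atan. }
          assert (L : is_lim_seq (fun n => / INR (S (n + Z.to_nat (up (Rabs a)))) ^ 2) 0).
          { apply (is_lim_seq_incr_n (fun n => / INR (S n) ^ 2)). apply is_lim_seq_inv_S_pow; lia. }
          apply is_lim_seq_mult'; [apply is_lim_seq_mult'; auto; apply is_lim_seq_const|].
          replace (Finite (/ (1 + a * 0))) with (Rbar_inv (1 + a * 0)) by reflexivity.
          apply is_lim_seq_inv.
          + apply is_lim_seq_plus'; [apply is_lim_seq_const|]. apply is_lim_seq_mult'; auto; apply is_lim_seq_const.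
          + intros E. injection E. lra. }
      replace ((0 ^ 2 + p) / q) with (cos (2 * th) / sin (2 * th)).
      2: { assert (sin (2 * th) <> 0). { intros E; apply Hq0; rewrite Hq, E; ring. } rewrite Hp, Hq. field. split; auto. lra. }
      assert (Hcot : forall x, 0 < x < PI -> atan (cos x / sin x) = PI / 2 - x).
      { intros x Hx. replace (cos x / sin x) with (tan (PI / 2 - x)).
        - apply atan_tan. lra.
        - unfold tan. 
          rewrite sin_shift, cos_shift. reflexivity. }
      (* The sign of [q] is that of [th]. It decides whether the arctangent tends to pi/2 or to
         -pi/2 and which reflection of the cotangent is used. *)
      destruct (Rle_dec q 0) as [Hneg|Hpos].
      * assert (Hth2 : - PI < 2 * th < 0).
        { split; [lra|]. destruct (Rlt_dec (2 * th) 0); auto. exfalso.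
          assert (0 <= sin (2 * th)) by (apply sin_ge_0; lra). assert (sin (2 * th) <> 0) by (intros E; apply Hq0; rewrite Hq, E; ring). nra. }
        replace (cos (2 * th) / sin (2 * th)) with (- (cos (- (2 * th)) / sin (- (2 * th)))).
        2: { rewrite cos_neg, sin_neg. field. intros E; apply Hq0; rewrite Hq, E; ring. }
        rewrite atan_opp, Hcot by lra.
        apply is_lim_seq_ext with (fun n => - (1 / 2) * atan ((INR (S n) ^ 2 + p) / (- q)) + (1 / 2) * (PI / 2 + 2 * th)).
        { intros n. replace ((INR (S n) ^ 2 + p) / (- q)) with (- ((INR (S n) ^ 2 + p) / q)) by (field; auto). rewrite atan_opp. field. }
        replace (Finite th) with (Finite (- (1 / 2) * (PI / 2) + (1 / 2) * (PI / 2 + 2 * th))) by (f_equal; field).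
        apply is_lim_seq_plus'; [|apply is_lim_seq_const]. apply is_lim_seq_mult'; [apply is_lim_seq_const|]. apply Hlim; lra.
      * assert (Hth2 : 0 < 2 * th < PI).
        { split; [|lra]. destruct (Rlt_dec 0 (2 * th)); auto. exfalso.
          assert (0 <= sin (- (2 * th))) by (apply sin_ge_0; lra). rewrite sin_neg in H. nra. }
        rewrite Hcot by lra.
        apply is_lim_seq_ext with (fun n => (1 / 2) * atan ((INR (S n) ^ 2 + p) / q) + - (1 / 2) * (PI / 2 - 2 * th)).
        { intros n. ring. }
        replace (Finite th) with (Finite ((1 / 2) * (PI / 2) + - (1 / 2) * (PI / 2 - 2 * th))) by (f_equal; field).
        apply is_lim_seq_plus'; [|apply is_lim_seq_const]. apply is_lim_seq_mult'; [apply is_lim_seq_const|]. apply Hlim; lra.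
Qed.

(** The step errors add up to at most a multiple of sum_k 1/(k^2 + r^2) <= 1/r^2 + pi/(2r). The
    decay in [r] is what makes the sine series of the final formula converge absolutely. *)
Theorem Psi_bound : exists l, Ccv (Psi_partial w) l /\
  Cmod (l - (ln r, th)) <= 2 / (cos th) ^ 2 * (/ r ^ 2 + PI / (2 * r)).
Proof.
  pose proof cpolar_cos_pos as Hc.
  set (e := fun k => (F (INR (S k)) - F (INR k) - RtoC (INR (S k)) / (RtoC (INR (S k) ^ 2) + w * w))%C).
  destruct (series_inv_sum_sq r Hr) as [E1 E2].
  assert (E0 : is_series (fun k => / (INR k ^ 2 + r ^ 2)) (/ r ^ 2 + Series (fun m => / (INR (S m) ^ 2 + r ^ 2)))).
  { replace (/ r ^ 2) with (/ (INR 0 ^ 2 + r ^ 2)) by (f_equal; simpl; ring).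
    apply (is_series_cons (fun k => / (INR k ^ 2 + r ^ 2))). now apply Series_correct. }
  set (V := fun k => 2 / (cos th) ^ 2 * / (INR k ^ 2 + r ^ 2)).
  assert (EV : is_series V (2 / (cos th) ^ 2 * (/ r ^ 2 + Series (fun m => / (INR (S m) ^ 2 + r ^ 2))))).
  { apply (is_series_scal (V := R_NormedModule)). exact E0. }
  assert (He : Cser e (CSeries e)) by (apply Cser_dominated with V; [apply halflog_step|eexists; eauto]).
  exists ((ln r, th) + CSeries e)%C. split.
  - apply Ccv_ext with (fun n => ((RtoC (ln (INR (S n))) - F (INR (S n)) + F 0) + sum_n e n)%C).
    + intros n. symmetry. apply halflog_sum.
    + apply Ccv_plus; [apply halflog_limit|]. now apply Cser_Ccv.
  - replace ((ln r, th) + CSeries e - (ln r, th))%C with (CSeries e) by ring.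
    eapply Rle_trans; [apply (Cmod_Cser_le e V); [apply halflog_step|eexists; eauto|auto]|].
    rewrite (is_series_unique _ _ EV). apply Rmult_le_compat_l.
    + left. apply Rdiv_lt_0_compat; [lra|]. nra.
    + lra.
Qed.
End CothPsi.

(** * Gamma and digamma functions *)

Lemma is_derive_C_intro (f : C -> C) (z l : C) (d K : R) :
  0 < d -> (forall h, Cmod h < d -> Cmod (f (z + h)%C - f z - h * l) <= K * Cmod h ^ 2) ->
  is_derive (K := C_AbsRing) (V := C_NormedModule) f z l.
Proof.
  intros Hd H. split; [apply is_linear_scal_l|].
  intros x Hx. apply (is_filter_lim_locally_unique (K := C_AbsRing) (V := AbsRing_NormedModule C_AbsRing)) in Hx. subst x. intros eps.
  assert (HK : 0 < Rabs K + 1) by (pose proof (Rabs_pos K); lra).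
  assert (Hd' : 0 < Rmin d (eps / (Rabs K + 1))).
  { apply Rmin_glb_lt; auto. apply Rdiv_lt_0_compat; auto. apply cond_pos. }
  exists (mkposreal _ Hd'). intros y Hy.
  change (Cmod (y - z) < Rmin d (eps / (Rabs K + 1))) in Hy.
  change (Cmod (f y - f z - (y - z) * l) <= eps * Cmod (y - z)).
  set (h := (y - z)%C) in *. replace y with (z + h)%C by (unfold h; ring).
  eapply Rle_trans; [apply H|].
  - apply Rlt_le_trans with (1 := Hy). apply Rmin_l.
  - assert (Hh : Cmod h < eps / (Rabs K + 1)) by (apply Rlt_le_trans with (1 := Hy); apply Rmin_r).
    replace (K * Cmod h ^ 2) with (K * Cmod h * Cmod h) by ring.
    apply Rmult_le_compat_r; [apply Cmod_ge_0|].
    pose proof (Cmod_ge_0 h).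
    apply Rle_trans with ((Rabs K + 1) * Cmod h).
    + apply Rmult_le_compat_r; auto. pose proof (Rle_abs K). lra.
    + replace (pos eps) with ((Rabs K + 1) * (eps / (Rabs K + 1))) by (field; lra).
      apply Rmult_le_compat_l; lra.
Qed.

(** [CDeriv] is some derivative picked by [epsilon], so only uniqueness identifies its value. Small
    real increments are enough to compare two candidates. *)
Lemma is_derive_C_unique (f : C -> C) (z l1 l2 : C) :
  is_derive (K := C_AbsRing) (V := C_NormedModule) f z l1 ->
  is_derive (K := C_AbsRing) (V := C_NormedModule) f z l2 -> l1 = l2.
Proof.
  intros [_ H1] [_ H2].
  assert (Hz : is_filter_lim (locally (T := AbsRing_UniformSpace C_AbsRing) z) z) by (intros P HP; exact HP).
  specialize (H1 z Hz). specialize (H2 z Hz).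
  assert (E : Cmod (l1 - l2) <= 0).
  { apply le_epsilon. intros e He. rewrite Rplus_0_l.
    assert (He' : 0 < e / 2) by lra.
    destruct (H1 (mkposreal _ He')) as [d1 D1]. destruct (H2 (mkposreal _ He')) as [d2 D2].
    assert (Hd : 0 < Rmin d1 d2 / 2) by (pose proof (cond_pos d1); pose proof (cond_pos d2); unfold Rmin; destruct (Rle_dec d1 d2); lra).
    set (h := RtoC (Rmin d1 d2 / 2)).
    assert (Hh : Cmod h = Rmin d1 d2 / 2) by (unfold h; rewrite Cmod_R, Rabs_pos_eq; lra).
    assert (B1 : ball (M := AbsRing_UniformSpace C_AbsRing) z d1 (z + h)%C).
    { change (Cmod (z + h - z) < d1). replace (z + h - z)%C with h by ring. rewrite Hh. pose proof (Rmin_l d1 d2). lra. }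
    assert (B2 : ball (M := AbsRing_UniformSpace C_AbsRing) z d2 (z + h)%C).
    { change (Cmod (z + h - z) < d2). replace (z + h - z)%C with h by ring. rewrite Hh. pose proof (Rmin_r d1 d2). lra. }
    specialize (D1 _ B1). specialize (D2 _ B2).
    change (Cmod (f (z + h)%C - f z - (z + h - z) * l1) <= e / 2 * Cmod (z + h - z)) in D1.
    change (Cmod (f (z + h)%C - f z - (z + h - z) * l2) <= e / 2 * Cmod (z + h - z)) in D2.
    replace (z + h - z)%C with h in D1, D2 by ring.
    apply Rmult_le_reg_l with (Cmod h); [lra|]. rewrite <- Cmod_mult.
    replace (h * (l1 - l2))%C with ((f (z + h)%C - f z - h * l2) - (f (z + h)%C - f z - h * l1))%C by ring.
    eapply Rle_trans; [apply Cmod_triangle|]. rewrite Cmod_opp. lra. }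
  assert (Cmod (l1 - l2) = 0) by (pose proof (Cmod_ge_0 (l1 - l2)); lra).
  apply Cmod_eq_0 in H. rewrite <- (Cplus_0_r l2), <- H. ring.
Qed.

Lemma CDeriv_unique (f : C -> C) (z l : C) :
  is_derive (K := C_AbsRing) (V := C_NormedModule) f z l -> CDeriv f z = l.
Proof.
  intros H. apply is_derive_C_unique with f z; auto.
  unfold CDeriv. apply epsilon_spec. now exists l.
Qed.

Lemma Cexp_1_bound (z : C) : Cmod (Cexp z - 1) <= 2 * Cmod z * exp (Cmod z).
Proof.
  assert (B : forall u, 0 <= u <= 1 -> Cmod (z * Cexp (z * RtoC u)) <= Cmod z * exp (Cmod z)).
  { intros u Hu. rewrite Cmod_mult, Cmod_Cexp. apply Rmult_le_compat_l; [apply Cmod_ge_0|]. apply exp_le_mono.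
    eapply Rle_trans; [apply Rle_abs|]. eapply Rle_trans; [apply re_le_Cmod|].
    rewrite Cmod_mult, Cmod_R, Rabs_pos_eq by lra. pose proof (Cmod_ge_0 z). nra. }
  pose proof (MVT_bound_RC (fun u => Cexp (z * RtoC u)) (fun u => (z * Cexp (z * RtoC u))%C) 0 1 (Cmod z * exp (Cmod z))) as M.
  rewrite Rmin_left, Rmax_right in M by lra.
  replace (z * RtoC 1)%C with z in M by ring. replace (z * RtoC 0)%C with (RtoC 0) in M by ring. rewrite Cexp_0 in M.
  rewrite Rminus_0_r, Rabs_R1 in M. eapply Rle_trans; [apply M; auto|right; ring].
  intros u _. apply is_derive_RC_Cexp.
Qed.

(** Mean value inequality on the segment from 0 to z for exp(zu) - zu, whose derivative z (exp(zu) -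
    1) is controlled by [Cexp_1_bound]. *)
Lemma Cexp_2_bound (z : C) : Cmod (Cexp z - 1 - z) <= 4 * Cmod z ^ 2 * exp (Cmod z).
Proof.
  pose proof (Cmod_ge_0 z) as Hz.
  assert (B : forall u, 0 <= u <= 1 -> Cmod (z * Cexp (z * RtoC u) + - z) <= Cmod z * (2 * Cmod z * exp (Cmod z))).
  { intros u Hu. replace (z * Cexp (z * RtoC u) + - z)%C with (z * (Cexp (z * RtoC u) - 1))%C by ring.
    rewrite Cmod_mult. apply Rmult_le_compat_l; auto.
    eapply Rle_trans; [apply Cexp_1_bound|]. rewrite Cmod_mult, Cmod_R, Rabs_pos_eq by lra.
    apply Rmult_le_compat; try nra. left; apply exp_pos. apply exp_le_mono. nra. }
  pose proof (MVT_bound_RC (fun u => (Cexp (z * RtoC u) + - z * RtoC u)%C) (fun u => (z * Cexp (z * RtoC u) + - z)%C) 0 1 (Cmod z * (2 * Cmod z * exp (Cmod z)))) as M.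
  rewrite Rmin_left, Rmax_right in M by lra.
  replace (z * RtoC 1)%C with z in M by ring. replace (z * RtoC 0)%C with (RtoC 0) in M by ring. rewrite Cexp_0 in M.
  replace (Cexp z + - z * 1 - (1 + - z * 0))%C with (Cexp z - 1 - z)%C in M by ring.
  rewrite Rminus_0_r, Rabs_R1 in M. eapply Rle_trans; [apply M; auto|right; ring].
  intros u _. apply is_derive_RC_plus; [apply is_derive_RC_Cexp|].
  split; simpl; destruct z; simpl; auto_derive; auto; ring.
Qed.

Lemma Ccv_lower_bound (u : nat -> C) (l : C) :
  (forall n, u n <> 0) -> Ccv u l -> l <> 0 -> exists c, 0 < c /\ forall n, c <= Cmod (u n).
Proof.
  intros Hu Hl Hl0. apply Cmod_gt_0 in Hl0.
  pose proof (Ccv_Cmod u l Hl) as H. apply is_lim_seq_spec in H.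
  assert (He : 0 < Cmod l / 2) by lra.
  destruct (H (mkposreal _ He)) as [n0 Hn0]. simpl in Hn0.
  assert (G : forall m, exists c, 0 < c /\ forall n, (n < m)%nat -> c <= Cmod (u n)).
  { induction m as [|m [c [Hc IH]]].
    - exists 1. split; [lra|]. intros; lia.
    - exists (Rmin c (Cmod (u m))). split; [apply Rmin_glb_lt; auto; apply Cmod_gt_0; auto|].
      intros n Hn. destruct (Nat.eq_dec n m) as [->|]; [apply Rmin_r|].
      apply Rle_trans with c; [apply Rmin_l|apply IH; lia]. }
  destruct (G n0) as [c [Hc IH]]. exists (Rmin c (Cmod l / 2)). split; [apply Rmin_glb_lt; auto|].
  intros n. destruct (Nat.lt_ge_cases n n0) as [Hn|Hn].
  - apply Rle_trans with c; [apply Rmin_l|auto].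
  - apply Rle_trans with (Cmod l / 2); [apply Rmin_r|]. specialize (Hn0 n Hn). apply Rabs_def2 in Hn0. lra.
Qed.

Lemma product_step_bound (u : nat -> C) (a : nat -> R) :
  (forall n, Cmod (u (S n) - u n) <= Cmod (u n) * a n) -> (forall n, 0 <= a n) -> forall n,
  Cmod (u (S n)) <= Cmod (u 0%nat) * exp (sum_n a n).
Proof.
  intros H Ha.
  assert (Hs : forall n, Cmod (u (S n)) <= Cmod (u n) * exp (a n)).
  { intros n. replace (u (S n)) with (u n + (u (S n) - u n))%C by ring.
    eapply Rle_trans; [apply Cmod_triangle|]. specialize (H n). pose proof (exp_ineq1_le (a n)).
    pose proof (Cmod_ge_0 (u n)). nra. }
  intros n. induction n.
  - rewrite sum_O. apply Hs.
  - rewrite sum_n_S, exp_plus. eapply Rle_trans; [apply Hs|].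
    rewrite <- Rmult_assoc. apply Rmult_le_compat_r; auto. left; apply exp_pos.
Qed.

(** Infinite products as sequences with summable relative increments: such a sequence is bounded,
    hence its increments are summable. The bound on the distance to the first term is what yields
    the derivative of Gamma. *)
Lemma product_step_cv (u : nat -> C) (a : nat -> R) :
  (forall n, Cmod (u (S n) - u n) <= Cmod (u n) * a n) -> (forall n, 0 <= a n) -> ex_series a ->
  exists l, Ccv u l /\ Cmod (l - u 0%nat) <= Cmod (u 0%nat) * (Series a * exp (Series a)).
Proof.
  intros H Ha Ea.
  assert (Hs : forall n, sum_n a n <= Series a) by (intros n; apply sum_n_le_is_series; auto; now apply Series_correct).
  assert (Hu : forall n, Cmod (u n) <= Cmod (u 0%nat) * exp (Series a)).
  { intros n. pose proof (Cmod_ge_0 (u 0%nat)).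
    assert (0 <= Series a) by (apply Rle_trans with (2 := Hs 0%nat); rewrite sum_O; auto).
    destruct n.
    - rewrite <- (Rmult_1_r (Cmod (u 0%nat))) at 1. apply Rmult_le_compat_l; auto. rewrite <- exp_0. apply exp_le_mono; auto.
    - eapply Rle_trans; [now apply product_step_bound|]. apply Rmult_le_compat_l; auto. apply exp_le_mono; auto. }
  set (d := fun n => (u (S n) - u n)%C).
  set (V := fun n => Cmod (u 0%nat) * exp (Series a) * a n).
  assert (EV : ex_series V) by (apply (ex_series_scal (V := R_NormedModule)); auto).
  assert (Hd : forall n, Cmod (d n) <= V n).
  { intros n. eapply Rle_trans; [apply H|]. apply Rmult_le_compat_r; auto. }
  pose proof (Cser_dominated d V Hd EV) as HS.
  exists (u 0%nat + CSeries d)%C. split.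
  - apply Ccv_incr_1. apply Ccv_ext with (fun n => (u 0%nat + sum_n d n)%C).
    + intros n. induction n; [rewrite sum_O; unfold d; ring|]. rewrite sum_n_CS, Cplus_assoc, IHn. unfold d. ring.
    + apply Ccv_plus; [apply Ccv_const|]. now apply Cser_Ccv.
  - replace (u 0%nat + CSeries d - u 0%nat)%C with (CSeries d) by ring.
    eapply Rle_trans; [apply (Cmod_Cser_le d V _ Hd EV HS)|].
    unfold V. rewrite Series_scal_l. right; ring.
Qed.

Lemma ln_le_sub_1 (y : R) : 0 < y -> ln y <= y - 1.
Proof. intros H. pose proof (exp_ineq1_le (ln y)). rewrite exp_ln in H0; lra. Qed.

Lemma ln_step_bounds (x : R) : 0 < x -> / (x + 1) <= ln (x + 1) - ln x <= / x.
Proof.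
  intros Hx. split.
  - pose proof (ln_le_sub_1 (x / (x + 1)) ltac:(apply Rdiv_lt_0_compat; lra)) as H.
    rewrite ln_div in H by lra. replace (x / (x + 1) - 1) with (- / (x + 1)) in H by (field; lra). lra.
  - pose proof (ln_le_sub_1 ((x + 1) / x) ltac:(apply Rdiv_lt_0_compat; lra)) as H.
    rewrite ln_div in H by lra. replace ((x + 1) / x - 1) with (/ x) in H by (field; lra). lra.
Qed.

Lemma Cinv_neq_0 (z : C) : z <> 0 -> (/ z)%C <> 0.
Proof. intros H. apply Cmod_gt_0. rewrite Cmod_inv by auto. apply Rinv_0_lt_compat. now apply Cmod_gt_0. Qed.

(** * Gauss quotients, their limit and their logarithmic derivative *)

Definition gauss (z : C) (n : nat) : C :=
  Cdiv (Cmult (RtoC (INR (fact n))) (Cexp (Cmult z (RtoC (ln (INR n)))))) (Cpochhammer_prod z n).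

(** The logarithmic derivative of [gauss z n] with respect to [z]. *)
Definition psi_partial (z : C) (n : nat) : C :=
  (RtoC (ln (INR n)) - sum_n (fun k => / (z + RtoC (INR k))) n)%C.

Definition not_pole (z : C) : Prop := forall k : nat, (z + RtoC (INR k))%C <> 0.

Lemma Cpochhammer_neq_0 (z : C) (n : nat) : not_pole z -> Cpochhammer_prod z n <> 0.
Proof.
  intros H. induction n.
  - simpl. rewrite <- (Cplus_0_r z). apply (H 0%nat).
  - cbn [Cpochhammer_prod]. apply Cmult_neq_0; auto.
Qed.

(** The quotients (z + k)/(k + 1) never vanish and tend to 1, so their moduli are bounded below. *)
Lemma not_pole_lower (z : C) : not_pole z ->
  exists c, 0 < c /\ forall k, c * INR (S k) <= Cmod (z + RtoC (INR k)).
Proof.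
  intros H.
  assert (N : forall k, RtoC (INR (S k)) <> 0) by (intros k; apply RtoC_neq_0; pose proof (INR_S_pos k); lra).
  destruct (Ccv_lower_bound (fun k => (z + RtoC (INR k)) * RtoC (/ INR (S k)))%C 1) as [c [Hc HB]].
  - intros k. apply Cmult_neq_0; auto. apply RtoC_neq_0. apply Rinv_neq_0_compat. pose proof (INR_S_pos k); lra.
  - apply Ccv_ext with (fun k => ((z - 1) * RtoC (/ INR (S k)) + 1)%C).
    + intros k. pose proof (INR_S_pos k). rewrite RtoC_inv by lra.
      replace (RtoC (INR k)) with (RtoC (INR (S k)) - 1)%C by (rewrite <- RtoC_minus, S_INR; f_equal; ring). field. auto.
    + apply Ccv_eq with ((z - 1) * 0 + 1)%C; [ring|].
      apply Ccv_plus; [|apply Ccv_const]. apply Ccv_mult; [apply Ccv_const|]. apply Ccv_RtoC, is_lim_seq_inv_S.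
  - apply RtoC_neq_0; lra.
  - exists c; split; auto. intros k. specialize (HB k). pose proof (INR_S_pos k) as Hk.
    rewrite Cmod_mult, Cmod_R, Rabs_pos_eq in HB by (left; now apply Rinv_0_lt_compat).
    apply Rmult_le_compat_r with (r := INR (S k)) in HB; [|lra].
    replace (Cmod (z + INR k) * / INR (S k) * INR (S k)) with (Cmod (z + INR k)) in HB by (field; lra). exact HB.
Qed.

(* [n^(-z) (n+1)^z] against the rational factor [1 + z / (n + 1)] of the Euler product. *)
Lemma euler_factor_bound (z : C) (n : nat) :
  let d := ln (INR (S (S n))) - ln (INR (S n)) in
  0 < d <= 1 /\
  Cmod (Cexp (z * RtoC d) - 1 - z * RtoC (/ INR (S (S n)))) <= (4 * Cmod z ^ 2 * exp (Cmod z) + Cmod z) * / INR (S n) ^ 2.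
Proof.
  intros d. pose proof (INR_S_pos n) as Hn. pose proof (ln_step_bounds (INR (S n)) Hn) as [D1 D2].
  rewrite <- S_INR in D1, D2. fold d in D1, D2.
  pose proof (INR_S_ge_1 n) as H1.
  set (k := INR (S n)) in *. assert (Ek : INR (S (S n)) = k + 1) by apply S_INR. rewrite Ek in *.
  assert (I1 : 0 < / (k + 1)) by (apply Rinv_0_lt_compat; lra).
  assert (I2 : / k <= 1) by (rewrite <- Rinv_1; apply Rinv_le_contravar; lra).
  assert (I3 : 0 < / k) by (apply Rinv_0_lt_compat; lra).
  assert (I4 : d - / (k + 1) <= / k ^ 2).
  { apply Rle_trans with (/ k - / (k + 1)); [lra|].
    replace (/ k - / (k + 1)) with (/ (k * (k + 1))) by (field; lra).
    apply Rinv_le_contravar; nra. }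
  split; [lra|].
  replace (Cexp (z * RtoC d) - 1 - z * RtoC (/ (k + 1)))%C with ((Cexp (z * RtoC d) - 1 - z * RtoC d) + z * RtoC (d - / (k + 1)))%C.
  2: { rewrite RtoC_minus. ring. }
  pose proof (Cmod_ge_0 z) as Hz.
  eapply Rle_trans; [apply Cmod_triangle|]. rewrite Rmult_plus_distr_r. apply Rplus_le_compat.
  - eapply Rle_trans; [apply Cexp_2_bound|]. rewrite Cmod_mult, Cmod_R, Rabs_pos_eq by lra.
    replace (4 * (Cmod z * d) ^ 2 * exp (Cmod z * d)) with (4 * Cmod z ^ 2 * exp (Cmod z * d) * d ^ 2) by ring.
    assert (d ^ 2 <= / k ^ 2) by (rewrite <- pow_inv; apply pow_incr; lra).
    apply Rmult_le_compat; try nra.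
    + pose proof (exp_pos (Cmod z * d)). apply Rmult_le_pos; nra.
    + apply Rmult_le_compat_l; [nra|]. apply exp_le_mono. nra.
  - rewrite Cmod_mult, Cmod_R, Rabs_pos_eq by lra. apply Rmult_le_compat_l; lra.
Qed.

Lemma gauss_step (z : C) (n : nat) : not_pole z ->
  gauss z (S (S n)) = (gauss z (S n) * (Cexp (z * RtoC (ln (INR (S (S n))) - ln (INR (S n)))) * RtoC (INR (S (S n))) / (z + RtoC (INR (S (S n))))))%C.
Proof.
  intros H. unfold gauss.
  replace (z * RtoC (ln (INR (S (S n)))))%C with (z * RtoC (ln (INR (S n))) + z * RtoC (ln (INR (S (S n))) - ln (INR (S n))))%C.
  2: { rewrite RtoC_minus. ring. }
  rewrite Cexp_add.
  replace (INR (fact (S (S n)))) with (INR (S (S n)) * INR (fact (S n))) by (rewrite <- mult_INR; reflexivity).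
  rewrite RtoC_mult. change (Cpochhammer_prod z (S (S n))) with (Cpochhammer_prod z (S n) * (z + RtoC (INR (S (S n)))))%C.
  pose proof (Cpochhammer_neq_0 z (S n) H). pose proof (H (S (S n))). field. split; auto.
Qed.

Lemma gauss_neq_0 (z : C) (n : nat) : not_pole z -> gauss z n <> 0.
Proof.
  intros H. unfold gauss, Cdiv. apply Cmult_neq_0; [apply Cmult_neq_0|].
  - apply RtoC_neq_0. apply INR_fact_neq_0.
  - apply Cexp_neq_0.
  - apply Cinv_neq_0. now apply Cpochhammer_neq_0.
Qed.

(** The relative increments of [gauss] are O(1/n^2), and so are those of its inverse. Both sequences
    converge and their limits multiply to 1, hence Gamma does not vanish. *)
Lemma gauss_cv (z : C) : not_pole z -> Ccv (gauss z) (CGamma z) /\ CGamma z <> 0.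
Proof.
  intros H. destruct (not_pole_lower z H) as [c [Hc HB]].
  set (K := 4 * Cmod z ^ 2 * exp (Cmod z) + Cmod z).
  assert (HK : 0 <= K).
  { unfold K. pose proof (Cmod_ge_0 z). pose proof (exp_pos (Cmod z)).
    assert (0 <= 4 * Cmod z ^ 2 * exp (Cmod z)) by (apply Rmult_le_pos; nra). lra. }
  assert (Es : forall A, ex_series (fun n => A * / INR (S n) ^ 2)).
  { intros A. apply (ex_series_scal A (fun n => / INR (S n) ^ 2)). apply ex_series_inv_S_sq. }
  assert (Hp : forall n, 0 <= / INR (S n) ^ 2).
  { intros n. left; apply inv_S_pow_pos. }
  destruct (product_step_cv (fun n => gauss z (S n)) (fun n => (/ c * K) * / INR (S n) ^ 2)) as [l [Hl _]]; auto.
  { intros n. rewrite gauss_step by auto. destruct (euler_factor_bound z n) as [Hd HE]. fold K in HE.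
    set (d := ln (INR (S (S n))) - ln (INR (S n))) in *. set (m := INR (S (S n))) in *.
    assert (Hm : 0 < m) by apply INR_S_pos. pose proof (H (S (S n))) as Hz. fold m in Hz.
    assert (Hm' : RtoC m <> 0) by (apply RtoC_neq_0; lra).
    replace (gauss z (S n) * (Cexp (z * d) * m / (z + m)) - gauss z (S n))%C with
      (gauss z (S n) * ((Cexp (z * d) - 1 - z * RtoC (/ m)) * (m / (z + m))))%C.
    2: { rewrite RtoC_inv by lra. field. split; auto. }
    rewrite Cmod_mult. apply Rmult_le_compat_l; [apply Cmod_ge_0|]. rewrite Cmod_mult.
    rewrite (Rmult_comm (/ c)), Rmult_assoc, (Rmult_comm (/ c)), <- Rmult_assoc.
    apply Rmult_le_compat; try apply Cmod_ge_0; auto.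
    rewrite Cmod_div, Cmod_R, Rabs_pos_eq by (auto; lra).
    specialize (HB (S (S n))). fold m in HB. rewrite S_INR in HB. fold m in HB.
    assert (0 < c * m) by now apply Rmult_lt_0_compat.
    apply Rmult_le_reg_r with (Cmod (z + m)); [nra|].
    replace (m / Cmod (z + m) * Cmod (z + m)) with m by (field; nra).
    apply Rmult_le_reg_l with c; auto. rewrite <- Rmult_assoc, Rinv_r by lra. nra. }
  { intros n. apply Rmult_le_pos; auto. apply Rmult_le_pos; auto. left; now apply Rinv_0_lt_compat. }
  destruct (product_step_cv (fun n => / gauss z (S n))%C (fun n => (exp (Cmod z) * K) * / INR (S n) ^ 2)) as [l' [Hl' _]]; auto.
  { intros n. rewrite gauss_step by auto. destruct (euler_factor_bound z n) as [Hd HE]. fold K in HE.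
    set (d := ln (INR (S (S n))) - ln (INR (S n))) in *. set (m := INR (S (S n))) in *.
    assert (Hm : 0 < m) by apply INR_S_pos. pose proof (H (S (S n))) as Hz. fold m in Hz.
    assert (Hm' : RtoC m <> 0) by (apply RtoC_neq_0; lra).
    pose proof (Cexp_neq_0 (z * d)). pose proof (gauss_neq_0 z (S n) H).
    replace (/ (gauss z (S n) * (Cexp (z * d) * m / (z + m))) - / gauss z (S n))%C with
      (/ gauss z (S n) * (- (Cexp (z * d) - 1 - z * RtoC (/ m)) * Cexp (- (z * d))))%C.
    2: { rewrite RtoC_inv, Cexp_opp by lra. field. repeat split; auto. }
    rewrite Cmod_mult. apply Rmult_le_compat_l; [apply Cmod_ge_0|]. rewrite Cmod_mult, Cmod_opp.
    rewrite (Rmult_comm (exp _)), Rmult_assoc, (Rmult_comm (exp _)), <- Rmult_assoc.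
    apply Rmult_le_compat; try apply Cmod_ge_0; auto.
    rewrite Cmod_Cexp. apply exp_le_mono. eapply Rle_trans; [apply Rle_abs|].
    eapply Rle_trans; [apply re_le_Cmod|]. rewrite Cmod_opp, Cmod_mult, Cmod_R, Rabs_pos_eq by lra.
    pose proof (Cmod_ge_0 z). nra. }
  { intros n. apply Rmult_le_pos; auto. apply Rmult_le_pos; auto. left; apply exp_pos. }
  assert (HG : Ccv (gauss z) l) by (now apply Ccv_incr_1).
  assert (EG : CGamma z = l) by (apply Ccv_CLim; exact HG).
  rewrite EG. split; auto. intros E.
  assert (F : (CGamma z * l')%C = 1).
  { rewrite EG. apply Ccv_unique with (fun n => (gauss z (S n) * / gauss z (S n))%C).
    - apply Ccv_mult; auto.
    - apply Ccv_ext with (2 := Ccv_const 1). intros n. rewrite Cinv_r; auto. now apply gauss_neq_0. }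
  rewrite EG, E, Cmult_0_l in F. apply (RtoC_neq_0 1); [lra|]. now rewrite F.
Qed.

(** A Weierstrass product with factors exp(u)/(1 + u), u = h/(z + k); each factor is 1 +
    O(h^2/(k+1)^2). *)
Fixpoint psi_product (z h : C) (n : nat) : C :=
  match n with
  | O => 1
  | S m => (psi_product z h m * (Cexp (h / (z + RtoC (INR m))) / (1 + h / (z + RtoC (INR m)))))%C
  end.

(** The dependence on [h] is made exact before any limit is taken, so limit and derivative never
    have to be exchanged. *)
Lemma gauss_shift (z h : C) (n : nat) : not_pole z -> not_pole (z + h) ->
  gauss (z + h) n = (gauss z n * Cexp (h * psi_partial z n) * psi_product z h (S n))%C.
Proof.
  intros Hz Hh.
  assert (E : forall n, (Cpochhammer_prod z n * Cexp (h * sum_n (fun k => / (z + RtoC (INR k))) n) = Cpochhammer_prod (z + h) n * psi_product z h (S n))%C).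
  { clear n. intros n. induction n.
    - rewrite sum_O. cbn [Cpochhammer_prod psi_product]. pose proof (Hz 0%nat) as H1. pose proof (Hh 0%nat) as H2.
      simpl INR in *. rewrite Cplus_0_r in *. unfold Cdiv at 2. field_simplify_eq; auto.
    - rewrite sum_n_CS, Cmult_plus_distr_l, Cexp_add. 
      change (Cpochhammer_prod z (S n)) with (Cpochhammer_prod z n * (z + RtoC (INR (S n))))%C.
      change (Cpochhammer_prod (z + h) (S n)) with (Cpochhammer_prod (z + h) n * (z + h + RtoC (INR (S n))))%C.
      change (psi_product z h (S (S n))) with (psi_product z h (S n) * (Cexp (h / (z + RtoC (INR (S n)))) / (1 + h / (z + RtoC (INR (S n))))))%C.
      pose proof (Hz (S n)) as H1. pose proof (Hh (S n)) as H2.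
      transitivity ((Cpochhammer_prod z n * Cexp (h * sum_n (fun k => / (z + RtoC (INR k))) n)) * ((z + RtoC (INR (S n))) * Cexp (h * / (z + RtoC (INR (S n))))))%C; [ring|].
      rewrite IHn. unfold Cdiv at 2. field. split; auto.
      intros F. apply H2. rewrite <- F. ring. }
  unfold gauss, psi_partial. rewrite Cmult_plus_distr_r, Cexp_add.
  replace (h * (RtoC (ln (INR n)) - sum_n (fun k => / (z + RtoC (INR k))) n))%C with
    (h * RtoC (ln (INR n)) + - (h * sum_n (fun k => / (z + RtoC (INR k))) n))%C by ring.
  rewrite Cexp_add, Cexp_opp. specialize (E n).
  pose proof (Cpochhammer_neq_0 z n Hz). pose proof (Cpochhammer_neq_0 (z + h) n Hh).
  set (X := Cexp (h * sum_n (fun k => / (z + RtoC (INR k))) n)%C) in *.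
  assert (X <> 0) by apply Cexp_neq_0.
  replace (psi_product z h (S n)) with (Cpochhammer_prod z n * X / Cpochhammer_prod (z + h) n)%C.
  - field. repeat split; auto.
  - rewrite E. field. auto.
Qed.

Lemma exp_half_le_2 : exp (1 / 2) <= 2.
Proof.
  assert (E : exp (1 / 2) * exp (1 / 2) = exp 1) by (rewrite <- exp_plus; f_equal; field).
  pose proof exp_le_3. pose proof (exp_pos (1 / 2)). nra.
Qed.

(** The constant is 4 * 2 * 2: from [Cexp_2_bound], exp(1/2) <= 2, and 1/|1 + u| <= 2. *)
Lemma weierstrass_factor_bound (u : C) : Cmod u <= 1 / 2 ->
  (1 + u)%C <> 0 /\ Cmod (Cexp u / (1 + u) - 1) <= 16 * Cmod u ^ 2.
Proof.
  intros Hu.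
  assert (H1 : 1 / 2 <= Cmod (1 + u)).
  { pose proof (Cmod_triangle (1 + u) (- u)) as T. replace (1 + u + - u)%C with (RtoC 1) in T by ring.
    rewrite Cmod_1, Cmod_opp in T. lra. }
  assert (H2 : (1 + u)%C <> 0) by (apply Cmod_gt_0; lra).
  split; auto. replace (Cexp u / (1 + u) - 1)%C with ((Cexp u - 1 - u) / (1 + u))%C by (field; auto).
  rewrite Cmod_div by auto. apply Rmult_le_reg_r with (Cmod (1 + u)); [lra|].
  unfold Rdiv at 1. rewrite Rmult_assoc, Rinv_l, Rmult_1_r by lra.
  eapply Rle_trans; [apply Cexp_2_bound|].
  assert (exp (Cmod u) <= 2) by (apply Rle_trans with (2 := exp_half_le_2); apply exp_le_mono; auto).
  pose proof (pow2_ge_0 (Cmod u)). pose proof (exp_pos (Cmod u)). nra.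
Qed.

(** In the limit, Gamma(z + h) = Gamma(z) exp(hL) P with |P - 1| = O(h^2), which is a first-order
    expansion with quadratic remainder. *)
Lemma is_derive_CGamma (z L : C) : not_pole z -> Ccv (psi_partial z) L ->
  is_derive (K := C_AbsRing) (V := C_NormedModule) CGamma z (CGamma z * L)%C.
Proof.
  intros Hz HL. destruct (not_pole_lower z Hz) as [c [Hc HB]].
  set (Z := Series (fun n => / INR (S n) ^ 2)).
  set (S1 := 16 / c ^ 2 * Z).
  pose proof Series_inv_S_sq_nonneg as HZ. fold Z in HZ.
  assert (H16 : 0 < 16 / c ^ 2) by (apply Rdiv_lt_0_compat; [lra|apply pow_lt; auto]).
  assert (HS1 : 0 <= S1) by (apply Rmult_le_pos; lra).
  (* The radius c/2 gives |h/(z + k)| <= 1/2 for all k, so z + h meets no pole either; the radius 1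
     makes the exponential bounds independent of [h]. *)
  apply is_derive_C_intro with (d := Rmin 1 (c / 2))
    (K := Cmod (CGamma z) * (exp (Cmod L) * (S1 * exp S1) + 4 * Cmod L ^ 2 * exp (Cmod L))).
  { apply Rmin_glb_lt; lra. }
  intros h Hh. assert (Hh1 : Cmod h < 1) by (apply Rlt_le_trans with (1 := Hh); apply Rmin_l).
  assert (Hh2 : Cmod h < c / 2) by (apply Rlt_le_trans with (1 := Hh); apply Rmin_r).
  pose proof (Cmod_ge_0 h) as Hh0.
  assert (Hu : forall k, Cmod (h / (z + RtoC (INR k))) <= Cmod h / c * / INR (S k)).
  { intros k. specialize (HB k). pose proof (INR_S_pos k). rewrite Cmod_div by apply Hz.
    assert (0 < c * INR (S k)) by now apply Rmult_lt_0_compat.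
    unfold Rdiv. rewrite Rmult_assoc. apply Rmult_le_compat_l; auto. rewrite <- Rinv_mult. apply Rinv_le_contravar; auto. }
  assert (Hu2 : forall k, Cmod (h / (z + RtoC (INR k))) <= 1 / 2).
  { intros k. eapply Rle_trans; [apply Hu|]. 
    assert (/ INR (S k) <= 1) by (rewrite <- Rinv_1; apply Rinv_le_contravar; [lra|]; change 1 with (INR 1); apply le_INR; lia).
    assert (Cmod h / c <= 1 / 2) by (apply Rmult_le_reg_r with c; auto; unfold Rdiv; rewrite Rmult_assoc, Rinv_l; lra).
    assert (0 <= Cmod h / c) by (apply Rmult_le_pos; auto; left; now apply Rinv_0_lt_compat).
    pose proof (Rinv_0_lt_compat _ (INR_S_pos k)). nra. }
  assert (Hzh : not_pole (z + h)).
  { intros k F. destruct (weierstrass_factor_bound _ (Hu2 k)) as [N _]. apply N.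
    pose proof (Hz k). replace (1 + h / (z + RtoC (INR k)))%C with ((z + h + RtoC (INR k)) / (z + RtoC (INR k)))%C by (field; auto).
    rewrite F. unfold Cdiv; ring. }
  set (a := fun n => 16 * (Cmod h / c) ^ 2 * / INR (S n) ^ 2).
  assert (Ha : forall n, 0 <= a n).
  { intros n. unfold a. apply Rmult_le_pos; [pose proof (pow2_ge_0 (Cmod h / c)); lra|]. left; apply inv_S_pow_pos. }
  destruct (product_step_cv (psi_product z h) a) as [P [HP BP]]; auto.
  { intros n. destruct (weierstrass_factor_bound _ (Hu2 n)) as [N B].
    replace (psi_product z h (S n) - psi_product z h n)%C with (psi_product z h n * (Cexp (h / (z + RtoC (INR n))) / (1 + h / (z + RtoC (INR n))) - 1))%C.
    2: { cbn [psi_product]. ring. }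
    rewrite Cmod_mult. apply Rmult_le_compat_l; [apply Cmod_ge_0|]. eapply Rle_trans; [apply B|].
    unfold a. rewrite Rmult_assoc. apply Rmult_le_compat_l; [lra|]. rewrite <- pow_inv, <- Rpow_mult_distr.
    apply pow_incr. split; [apply Cmod_ge_0|apply Hu]. }
  { apply (ex_series_scal (16 * (Cmod h / c) ^ 2) (fun n => / INR (S n) ^ 2)), ex_series_inv_S_sq. }
  assert (Sa : Series a = S1 * Cmod h ^ 2).
  { unfold a. rewrite Series_scal_l. fold Z. unfold S1. field. lra. }
  rewrite Sa in BP. cbn [psi_product] in BP. rewrite Cmod_1, Rmult_1_l in BP.
  destruct (gauss_cv z Hz) as [HG _]. destruct (gauss_cv (z + h) Hzh) as [HGh _].
  assert (HE : forall u l, Ccv u l -> Ccv (fun n => Cexp (h * u n)) (Cexp (h * l))).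
  { intros u l Hul. apply Ccv_Cmod_0.
    assert (Hd : Ccv (fun n => (h * (u n - l))%C) 0).
    { apply Ccv_eq with (h * (l - l))%C; [ring|]. apply Ccv_mult; [apply Ccv_const|]. apply Ccv_minus; auto. apply Ccv_const. }
    apply Ccv_Cmod in Hd. rewrite Cmod_0 in Hd.
    apply is_lim_seq_le_le with (fun _ => 0) (fun n => Cmod (Cexp (h * l)) * (2 * Cmod (h * (u n - l)) * exp (Cmod (h * (u n - l))))).
    - intros n. split; [apply Cmod_ge_0|].
      replace (Cexp (h * u n) - Cexp (h * l))%C with (Cexp (h * l) * (Cexp (h * (u n - l)) - 1))%C.
      + rewrite Cmod_mult. apply Rmult_le_compat_l; [apply Cmod_ge_0|]. apply Cexp_1_bound.
      + replace (h * u n)%C with (h * l + h * (u n - l))%C by ring. rewrite Cexp_add. ring.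
    - apply is_lim_seq_const.
    - replace (Finite 0) with (Finite (Cmod (Cexp (h * l)) * (2 * 0 * exp 0))) by (f_equal; ring).
      apply is_lim_seq_mult'; [apply is_lim_seq_const|]. apply is_lim_seq_mult'; [apply is_lim_seq_mult'; auto; apply is_lim_seq_const|].
      apply (is_lim_seq_continuous exp); auto. apply derivable_continuous, derivable_exp. }
  assert (EG : CGamma (z + h) = (CGamma z * Cexp (h * L) * P)%C).
  { apply Ccv_unique with (gauss (z + h)); auto.
    apply Ccv_ext with (fun n => (gauss z n * Cexp (h * psi_partial z n) * psi_product z h (S n))%C).
    - intros n; symmetry; now apply gauss_shift.
    - apply Ccv_mult; [apply Ccv_mult; auto|]. now apply Ccv_incr_1. }
  rewrite EG.
  replace (CGamma z * Cexp (h * L) * P - CGamma z - h * (CGamma z * L))%C with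
    (CGamma z * (Cexp (h * L) * (P - 1) + (Cexp (h * L) - 1 - h * L)))%C by ring.
  rewrite Cmod_mult, (Rmult_assoc (Cmod (CGamma z))). apply Rmult_le_compat_l; [apply Cmod_ge_0|].
  eapply Rle_trans; [apply Cmod_triangle|]. rewrite Rmult_plus_distr_r.
  pose proof (Cmod_ge_0 L) as HL0.
  assert (HhL : Cmod (h * L) <= Cmod L) by (rewrite Cmod_mult; nra).
  assert (Hh4 : Cmod h ^ 2 <= 1) by nra.
  apply Rplus_le_compat.
  - rewrite Cmod_mult, Cmod_Cexp, !Rmult_assoc. apply Rmult_le_compat; try apply Cmod_ge_0. left; apply exp_pos.
    + apply exp_le_mono. eapply Rle_trans; [apply Rle_abs|]. eapply Rle_trans; [apply re_le_Cmod|]. auto.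
    + eapply Rle_trans; [apply BP|]. rewrite Rmult_assoc. apply Rmult_le_compat_l; auto.
      rewrite Rmult_comm. apply Rmult_le_compat_r; [apply pow2_ge_0|]. apply exp_le_mono. nra.
  - eapply Rle_trans; [apply Cexp_2_bound|]. rewrite Cmod_mult, Rpow_mult_distr.
    replace (4 * (Cmod h ^ 2 * Cmod L ^ 2) * exp (Cmod h * Cmod L)) with (4 * Cmod L ^ 2 * exp (Cmod h * Cmod L) * Cmod h ^ 2) by ring.
    apply Rmult_le_compat_r; [apply pow2_ge_0|]. apply Rmult_le_compat_l; [nra|]. apply exp_le_mono. nra.
Qed.

Lemma digamma_psi_partial (z L : C) : not_pole z -> Ccv (psi_partial z) L -> digamma z = L.
Proof.
  intros Hz HL. unfold digamma. rewrite (CDeriv_unique CGamma z (CGamma z * L)%C).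
  - destruct (gauss_cv z Hz) as [_ HN]. field. auto.
  - now apply is_derive_CGamma.
Qed.

Lemma psi_partial_cv (z : C) : not_pole z -> exists L, Ccv (psi_partial z) L.
Proof.
  intros Hz. destruct (not_pole_lower z Hz) as [c [Hc HB]].
  set (d := fun n => (psi_partial z (S (S n)) - psi_partial z (S n))%C).
  assert (Hd : forall n, Cmod (d n) <= (2 + Cmod z / c) * / INR (S n) ^ 2).
  { intros n. unfold d, psi_partial. rewrite (sum_n_CS _ (S n)).
    set (k := INR (S n)). pose proof (INR_S_pos n) as Hk. fold k in Hk.
    pose proof (ln_step_bounds k Hk) as [L1 L2]. unfold k in L1, L2. rewrite <- S_INR in L1, L2. 
    set (m := INR (S (S n))) in *. assert (Em : m = k + 1) by apply S_INR. fold k in L1, L2.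
    pose proof (Hz (S (S n))) as Hzm. fold m in Hzm. specialize (HB (S (S n))). fold m in HB.
    rewrite S_INR in HB. fold m in HB.
    assert (Hm : RtoC m <> 0) by (apply RtoC_neq_0; lra).
    (* The increment splits into ln m - ln k - 1/m, with m = k + 1, and 1/m - 1/(z + m) = z/(m (z +
       m)); both are O(1/k^2). *)
    match goal with |- Cmod ?X <= _ => replace X with (RtoC (ln m - ln k - / m) + z / (m * (z + m)))%C end.
    2: { rewrite !RtoC_minus, RtoC_inv by lra. field. split; auto. }
    eapply Rle_trans; [apply Cmod_triangle|]. rewrite Rmult_plus_distr_r.
    assert (Hk2 : / k - / m <= 2 * / k ^ 2).
    { replace (/ k - / m) with (/ (k * m)) by (rewrite Em; field; lra).
      assert (/ (k * m) <= / k ^ 2) by (apply Rinv_le_contravar; nra).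
      assert (0 < / k ^ 2) by (apply Rinv_0_lt_compat; nra). lra. }
    apply Rplus_le_compat.
    - rewrite Cmod_R, Rabs_pos_eq; lra.
    - rewrite Cmod_div by (apply Cmult_neq_0; auto). rewrite Cmod_mult, Cmod_R, Rabs_pos_eq by lra.
      unfold Rdiv. rewrite Rmult_assoc. apply Rmult_le_compat_l; [apply Cmod_ge_0|].
      rewrite <- Rinv_mult. 
      assert (0 < c * k ^ 2) by (apply Rmult_lt_0_compat; nra).
      apply Rinv_le_contravar; auto.
      apply Rle_trans with (m * (c * (m + 1))).
      + replace (m * (c * (m + 1))) with (c * (m * (m + 1))) by ring. apply Rmult_le_compat_l; nra.
      + apply Rmult_le_compat_l; lra. }
  assert (EV : ex_series (fun n => (2 + Cmod z / c) * / INR (S n) ^ 2)).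
  { apply (ex_series_scal (2 + Cmod z / c) (fun n => / INR (S n) ^ 2)), ex_series_inv_S_sq. }
  pose proof (Cser_dominated d _ Hd EV) as HS. apply Cser_Ccv in HS.
  exists (psi_partial z 1 + CSeries d)%C.
  apply (proj1 (Ccv_incr_1 _ _)), (proj1 (Ccv_incr_1 (fun n => psi_partial z (S n)) _)). apply Ccv_ext with (fun n => (psi_partial z 1 + sum_n d n)%C).
  - intros n. induction n; [rewrite sum_O; unfold d; ring|]. rewrite sum_n_CS, Cplus_assoc, IHn. unfold d. ring.
  - apply Ccv_plus; auto. apply Ccv_const.
Qed.

(** The points i w and -i w have imaginary part r cos th up to sign, hence are no poles. Pairing
    gives 1/(iw + k) + 1/(-iw + k) = 2k/(k^2 + w^2). *)
Lemma digamma_pair (r th : R) : 0 < r -> - (PI / 2) < th < PI / 2 ->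
  Ccv (Psi_partial (cpolar r th))
    (RtoC (1 / 2) * (digamma (Ci * cpolar r th) + digamma (- Ci * cpolar r th)))%C.
Proof.
  intros Hr Hth. set (w := cpolar r th).
  pose proof (cos_gt_0 th (proj1 Hth) (proj2 Hth)) as Hc.
  assert (Hx : 0 < r * cos th) by now apply Rmult_lt_0_compat.
  assert (N1 : not_pole (Ci * w)).
  { intros k E. apply (f_equal Im) in E. unfold w, cpolar in E. simpl in E. lra. }
  assert (N2 : not_pole (- Ci * w)).
  { intros k E. apply (f_equal Im) in E. unfold w, cpolar in E. simpl in E. lra. }
  destruct (psi_partial_cv _ N1) as [L1 H1]. destruct (psi_partial_cv _ N2) as [L2 H2].
  rewrite (digamma_psi_partial _ _ N1 H1), (digamma_psi_partial _ _ N2 H2).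
  apply Ccv_ext with (fun n => (RtoC (1 / 2) * (psi_partial (Ci * w) (S n) + psi_partial (- Ci * w) (S n)))%C).
  2: { apply Ccv_mult; [apply Ccv_const|]. apply Ccv_plus; now apply Ccv_incr_1. }
  intros n. unfold psi_partial, Psi_partial.
  assert (H2R : RtoC 2 <> 0) by (apply RtoC_neq_0; lra).
  assert (E : forall n, (sum_n (fun k => / (Ci * w + RtoC (INR k))) (S n) + sum_n (fun k => / (- Ci * w + RtoC (INR k))) (S n))%C
     = (2 * sum_n (fun k => RtoC (INR (S k)) / (RtoC (INR (S k) ^ 2) + w * w)) n)%C).
  { assert (Ep : forall k, (/ (Ci * w + RtoC (INR (S k))) + / (- Ci * w + RtoC (INR (S k))))%C = (2 * (RtoC (INR (S k)) / (RtoC (INR (S k) ^ 2) + w * w)))%C).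
    { intros k. pose proof (N1 (S k)) as A1. pose proof (N2 (S k)) as A2.
      assert (ED : (RtoC (INR (S k) ^ 2) + w * w)%C = ((Ci * w + RtoC (INR (S k))) * (- Ci * w + RtoC (INR (S k))))%C).
      { rewrite RtoC_pow. replace (w * w)%C with (- (Ci * Ci) * (w * w))%C by (replace (Ci * Ci)%C with (- (1))%C by C_comp; ring). ring. }
      rewrite ED. field. split; auto. }
    clear n. intros n. induction n.
    - rewrite !sum_n_CS, !sum_O. simpl (INR 0). rewrite !Cplus_0_r.
      rewrite <- Ep. 
      assert (A0 : w <> 0). { intros F. apply (f_equal Re) in F. unfold w, cpolar in F. simpl in F. lra. }
      assert (Ci <> 0) by (intros F; apply (f_equal Im) in F; simpl in F; lra).
      assert (Eo : (/ (- Ci * w))%C = (- / (Ci * w))%C) by (field; auto).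
      rewrite Eo. ring.
    - rewrite !(sum_n_CS _ (S n)). rewrite (sum_n_CS (fun k => RtoC (INR (S k)) / (RtoC (INR (S k) ^ 2) + w * w))%C n), Cmult_plus_distr_l, <- IHn, <- Ep. ring. }
  specialize (E n).
  transitivity (RtoC (ln (INR (S n))) - RtoC (1 / 2) * (sum_n (fun k => / (Ci * w + RtoC (INR k))) (S n) + sum_n (fun k => / (- Ci * w + RtoC (INR k))) (S n)))%C.
  - rewrite RtoC_div by lra. field. auto.
  - rewrite E. rewrite RtoC_div by lra. field.
Qed.

(** [euler_gamma] is the [real] part of an extended limit and means something only once convergence
    is known. Convergence is [psi_partial_cv] at z = 1, that is, psi(1) = -gamma. *)
Lemma euler_gamma_cv : is_lim_seq (fun n => sum_n (fun k => / INR (S k)) n - ln (INR (S n))) euler_gamma.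
Proof.
  assert (N : not_pole 1).
  { intros k. rewrite <- RtoC_plus. apply RtoC_neq_0. pose proof (pos_INR k). lra. }
  destruct (psi_partial_cv 1 N) as [L [HL _]].
  assert (E : forall n, Re (psi_partial 1 (S n)) = ln (INR (S n)) - sum_n (fun k => / INR (S k)) n - / INR (S (S n))).
  { intros n. unfold psi_partial.
    change (Re (RtoC (ln (INR (S n))) - sum_n (fun k => / (1 + RtoC (INR k))) (S n))%C) with
      (ln (INR (S n)) - Re (sum_n (fun k => / (1 + RtoC (INR k)))%C (S n))).
    rewrite Re_sum_n. rewrite (sum_n_ext _ (fun k => / INR (S k))).
    - rewrite sum_n_S. ring.
    - intros k. rewrite <- RtoC_plus, <- RtoC_inv. 
      + rewrite S_INR. simpl. f_equal. ring.
      + pose proof (pos_INR k). lra. }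
  assert (H : is_lim_seq (fun n => sum_n (fun k => / INR (S k)) n - ln (INR (S n))) (- Re L - 0)).
  { apply is_lim_seq_ext with (fun n => - Re (psi_partial 1 (S n)) - / INR (S (S n))).
    - intros n. rewrite E. ring.
    - apply is_lim_seq_minus'.
      + apply is_lim_seq_opp in HL. simpl in HL. apply (is_lim_seq_incr_1 (fun n => - Re (psi_partial 1 n))). exact HL.
      + apply (is_lim_seq_incr_1 (fun n => / INR (S n))), is_lim_seq_inv_S. }
  assert (E2 : euler_gamma = - Re L - 0).
  { unfold euler_gamma. rewrite (is_lim_seq_unique _ (Finite (- Re L - 0))); [reflexivity|].
    apply is_lim_seq_incr_1. apply is_lim_seq_ext with (2 := H). intros n. f_equal. 
    apply (sum_n_m_S (G := R_AbelianMonoid) (fun k => / INR k)). }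
  rewrite E2. exact H.
Qed.

(** * Roots of unity *)

Definition cis (th : R) : C := (cos th, sin th).

Lemma cis_add (a b : R) : cis (a + b) = (cis a * cis b)%C.
Proof. unfold cis. C_comp; [rewrite cos_plus|rewrite sin_plus]; ring. Qed.

Lemma cis_0 : cis 0 = 1.
Proof. unfold cis. now rewrite cos_0, sin_0. Qed.

Lemma cis_neq_0 (a : R) : cis a <> 0.
Proof.
  intros E. pose proof (cis_add a (- a)) as F. rewrite E, Cmult_0_l, Rplus_opp_r, cis_0 in F.
  apply (RtoC_neq_0 1); [lra|auto].
Qed.

Lemma cis_pow (a : R) (n : nat) : (cis a ^ n)%C = cis (INR n * a).
Proof.
  induction n.
  - simpl. rewrite Rmult_0_l, cis_0. reflexivity.
  - rewrite S_INR, Rmult_plus_distr_r, Rmult_1_l, cis_add, <- IHn. simpl. ring.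
Qed.

Lemma Cexp_cis (th : R) : Cexp (0, th) = cis th.
Proof. unfold Cexp, cis; simpl. rewrite exp_0. C_comp. Qed.

Lemma cpolar_cis (r th : R) : cpolar r th = (RtoC r * cis th)%C.
Proof. unfold cpolar, cis. C_comp. Qed.

Lemma cis_2PI_Z (d : Z) : cis (2 * PI * IZR d) = 1.
Proof.
  assert (E : sin (PI * IZR d) = 0) by (apply sin_eq_0_1; exists d; ring).
  unfold cis. replace (2 * PI * IZR d) with (2 * (PI * IZR d)) by ring.
  rewrite cos_2a_sin, sin_2a, E. C_comp.
Qed.

Lemma cis_PI_nat (n : nat) : cis (PI * INR n) = RtoC ((-1) ^ n).
Proof.
  induction n.
  - simpl. rewrite Rmult_0_r, cis_0. reflexivity.
  - rewrite S_INR, Rmult_plus_distr_l, Rmult_1_r, cis_add, IHn. unfold cis. rewrite cos_PI, sin_PI.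
    simpl pow. rewrite RtoC_mult. replace (-1, 0) with (RtoC (-1)) by reflexivity. ring.
Qed.

Lemma m1_pow_sq (n : nat) : (-1) ^ n * (-1) ^ n = 1.
Proof. rewrite <- Rpow_mult_distr. replace (-1 * -1) with 1 by ring. apply pow1. Qed.

Lemma cis_geometric (a b : R) (n : nat) :
  ((cis b - 1) * sum_n (fun k => cis (a + INR k * b)) n = cis (a + INR (S n) * b) - cis a)%C.
Proof.
  induction n.
  - rewrite sum_O. simpl INR. rewrite Rmult_0_l, Rplus_0_r, Rmult_1_l, cis_add. ring.
  - rewrite sum_n_CS, Cmult_plus_distr_l, IHn.
    rewrite (S_INR (S n)). replace (a + (INR (S n) + 1) * b) with ((a + INR (S n) * b) + b) by ring.
    rewrite (cis_add _ b). ring.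
Qed.

Lemma sum_n_const_C (c : C) (n : nat) : sum_n (fun _ => c) n = (RtoC (INR (S n)) * c)%C.
Proof.
  induction n; [rewrite sum_O; simpl; as_C; ring|]. rewrite sum_n_CS, IHn, (S_INR (S n)), RtoC_plus. as_C. ring.
Qed.

(** Orthogonality of characters on the centred range -h, ..., h. For d <> 0 the ratio is not 1,
    because pi d/N lies strictly between -pi and pi and is not 0; the geometric sum then closes up
    after N steps. *)
Lemma character_sum (h : nat) (d : Z) : (Z.abs d < 2 * Z.of_nat h + 1)%Z ->
  sum_n (fun k => cis (2 * PI * IZR d * (INR k - INR h) / INR (2 * h + 1))) (2 * h) =
  if Z.eq_dec d 0 then RtoC (INR (2 * h + 1)) else RtoC 0.
Proof.
  intros Hd. assert (HN : 0 < INR (2 * h + 1)) by (apply lt_0_INR; lia).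
  destruct (Z.eq_dec d 0) as [->|Hd0].
  - rewrite (sum_n_ext _ (fun _ => RtoC 1)).
    + rewrite sum_n_const_C. replace (S (2 * h)) with (2 * h + 1)%nat by lia. as_C. ring.
    + intros k. as_C. replace (2 * PI * 0 * (INR k - INR h) / INR (2 * h + 1)) with 0 by (field; lra). apply cis_0.
  - set (b := 2 * PI * IZR d / INR (2 * h + 1)). set (a := - INR h * b).
    rewrite (sum_n_ext _ (fun k => cis (a + INR k * b))).
    2: { intros k. as_C. f_equal. unfold a, b. field. lra. }
    assert (Hb : (cis b - 1)%C <> 0).
    { intros E. apply (f_equal Re) in E. unfold cis in E; simpl in E.
      replace b with (2 * (PI * IZR d / INR (2 * h + 1))) in E by (unfold b; field; lra).
      rewrite cos_2a_sin in E.
      assert (Hs : sin (PI * IZR d / INR (2 * h + 1)) = 0) by nra.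
      assert (Hr : Rabs (IZR d) < INR (2 * h + 1)).
      { rewrite <- abs_IZR, INR_IZR_INZ. apply IZR_lt. lia. }
      assert (Hr0 : 0 < Rabs (IZR d)) by (apply Rabs_pos_lt, not_0_IZR; auto).
      pose proof PI_RGT_0.
      assert (Hp : 0 < sin (PI * Rabs (IZR d) / INR (2 * h + 1))).
      { apply sin_gt_0.
        - apply Rdiv_lt_0_compat; auto. now apply Rmult_lt_0_compat.
        - apply Rmult_lt_reg_r with (INR (2 * h + 1)); auto. unfold Rdiv. rewrite Rmult_assoc, Rinv_l by lra. nra. }
      revert Hp. unfold Rabs. destruct (Rcase_abs (IZR d)).
      - replace (PI * - IZR d / INR (2 * h + 1)) with (- (PI * IZR d / INR (2 * h + 1))) by (field; lra).
        rewrite sin_neg, Hs. lra.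
      - rewrite Hs. lra. }
    pose proof (cis_geometric a b (2 * h)) as G.
    replace (a + INR (S (2 * h)) * b) with (a + 2 * PI * IZR d) in G.
    2: { unfold b. replace (S (2 * h)) with (2 * h + 1)%nat by lia. field. lra. }
    rewrite cis_add, cis_2PI_Z in G.
    set (T := sum_n (fun k => cis (a + INR k * b)) (2 * h)) in *. as_C.
    transitivity (/ (cis b - 1) * ((cis b - 1) * T))%C.
    + rewrite Cmult_assoc, Cinv_l; auto. now rewrite Cmult_1_l.
    + rewrite G. cring.
Qed.

Lemma sum_n_C_zero (f : nat -> C) (n : nat) : (forall k, (k <= n)%nat -> f k = RtoC 0) -> sum_n f n = RtoC 0.
Proof.
  intros H. induction n; [rewrite sum_O; auto|]. rewrite sum_n_CS, IHn, H; auto. cring.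
Qed.

Lemma sum_n_kronecker (f : nat -> C) (s n : nat) : (s <= n)%nat ->
  sum_n (fun k => if Nat.eq_dec k s then f k else RtoC 0) n = f s.
Proof.
  intros H. induction n.
  - rewrite sum_O. replace s with 0%nat by lia. destruct (Nat.eq_dec 0 0); [auto|lia].
  - rewrite sum_n_CS. destruct (Nat.eq_dec (S n) s) as [<-|Hn].
    + rewrite sum_n_C_zero; [cring|]. intros k Hk. destruct (Nat.eq_dec k (S n)); [lia|auto].
    + rewrite IHn by lia. cring.
Qed.

Lemma geometric_C (q : C) (n : nat) : ((1 - q) * sum_n (fun k => q ^ k) n = 1 - q ^ (S n))%C.
Proof.
  induction n; [rewrite sum_O; simpl; cring|]. rewrite sum_n_CS, Cmult_plus_distr_l, IHn. simpl. cring.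
Qed.

Lemma sum_n_Cmult_r (c : C) (u : nat -> C) (n : nat) : sum_n (fun k => (u k * c)%C) n = (sum_n u n * c)%C.
Proof. rewrite Cmult_comm, <- sum_n_Cmult_l. apply sum_n_ext. intros k. cring. Qed.

Lemma root_of_unity_pow (h k : nat) (u : R) :
  ((cis (2 * PI * (INR k - INR h) / INR (2 * h + 1)) * RtoC u) ^ (S (2 * h)))%C = RtoC (u ^ (2 * h + 1)).
Proof.
  assert (HN : 0 < INR (2 * h + 1)) by (apply lt_0_INR; lia).
  rewrite Cpow_mult_l, RtoC_pow. replace (S (2 * h)) with (2 * h + 1)%nat by lia. rewrite cis_pow.
  replace (INR (2 * h + 1) * (2 * PI * (INR k - INR h) / INR (2 * h + 1))) with (2 * PI * IZR (Z.of_nat k - Z.of_nat h)).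
  - rewrite cis_2PI_Z. ring.
  - rewrite minus_IZR, <- !INR_IZR_INZ. field. lra.
Qed.

Lemma one_sub_odd_pow (h : nat) (u : R) : u <= 0 -> 1 <= 1 - u ^ (2 * h + 1).
Proof.
  intros Hu. rewrite pow_add, pow_mult, pow_1. pose proof (pow_le (u ^ 2) h ltac:(nra)). nra.
Qed.

(** The factor divides 1 - u^N, which is at least 1 for odd N and u <= 0. In use, u = -rho^2/n^2. *)
Lemma one_sub_root_neq_0 (h k : nat) (u : R) : u <= 0 ->
  (1 - cis (2 * PI * (INR k - INR h) / INR (2 * h + 1)) * RtoC u)%C <> 0.
Proof.
  intros Hu E. pose proof (geometric_C (cis (2 * PI * (INR k - INR h) / INR (2 * h + 1)) * RtoC u) (2 * h)) as G.
  rewrite E, root_of_unity_pow, Cmult_0_l, <- RtoC_minus in G.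
  pose proof (one_sub_odd_pow h u Hu). apply (RtoC_neq_0 (1 - u ^ (2 * h + 1))); [lra|auto].
Qed.

(* Partial fractions of [u^s / (1 - u^N)] over the N-th roots of unity, N = 2 h + 1. *)
Lemma roots_partial_fraction (h s : nat) (u : R) : (s <= 2 * h)%nat -> u <= 0 ->
  let om := fun k => cis (2 * PI * (INR k - INR h) / INR (2 * h + 1)) in
  sum_n (fun k => cis (- (2 * PI * INR s * (INR k - INR h) / INR (2 * h + 1))) / (1 - om k * RtoC u))%C (2 * h)
  = RtoC (INR (2 * h + 1) * u ^ s / (1 - u ^ (2 * h + 1))).
Proof.
  intros Hs Hu om. assert (HN : 0 < INR (2 * h + 1)) by (apply lt_0_INR; lia).
  assert (Hom : forall k, (1 - om k * RtoC u)%C <> 0) by (intros k; now apply one_sub_root_neq_0).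
  pose proof (one_sub_odd_pow h u Hu) as HuN.
  assert (HuN' : RtoC (1 - u ^ (2 * h + 1)) <> 0) by (apply RtoC_neq_0; lra).
  (* A finite geometric sum, since every root satisfies (om u)^N = u^N. *)
  assert (E1 : forall k, (/ (1 - om k * RtoC u))%C =
      (sum_n (fun i => cis (2 * PI * INR i * (INR k - INR h) / INR (2 * h + 1)) * RtoC (u ^ i)) (2 * h) / RtoC (1 - u ^ (2 * h + 1)))%C).
  { intros k. pose proof (geometric_C (om k * RtoC u) (2 * h)) as G.
    rewrite (sum_n_ext _ (fun i => cis (2 * PI * INR i * (INR k - INR h) / INR (2 * h + 1)) * RtoC (u ^ i))%C) in G.
    2: { intros i. rewrite Cpow_mult_l, RtoC_pow. f_equal. unfold om. rewrite cis_pow. f_equal. field. lra. }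
    assert (G2 : ((om k * RtoC u) ^ (S (2 * h)))%C = RtoC (u ^ (2 * h + 1))) by apply root_of_unity_pow.
    rewrite G2, <- RtoC_minus in G.
    pose proof (Hom k) as Hk.
    assert (Gen : forall x t y : C, x <> 0 -> y <> 0 -> (x * t)%C = y -> (/ x)%C = (t / y)%C).
    { intros x t y Hx Hy <-. assert (t <> 0) by (intros ->; apply Hy; ring). field. split; auto. }
    apply Gen; auto. }
  transitivity (sum_n (fun k => sum_n (fun i => cis (2 * PI * IZR (Z.of_nat i - Z.of_nat s) * (INR k - INR h) / INR (2 * h + 1)) * (RtoC (u ^ i) / RtoC (1 - u ^ (2 * h + 1)))) (2 * h)) (2 * h))%C.
  { apply sum_n_ext. intros k. as_C. unfold Cdiv at 1. rewrite E1.
    transitivity (cis (- (2 * PI * INR s * (INR k - INR h) / INR (2 * h + 1))) * / RtoC (1 - u ^ (2 * h + 1)) *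
      sum_n (fun i => cis (2 * PI * INR i * (INR k - INR h) / INR (2 * h + 1)) * RtoC (u ^ i)) (2 * h))%C; [unfold Cdiv; cring|].
    rewrite <- sum_n_Cmult_l. apply sum_n_ext. intros i. as_C.
    replace (2 * PI * IZR (Z.of_nat i - Z.of_nat s) * (INR k - INR h) / INR (2 * h + 1)) with
     (- (2 * PI * INR s * (INR k - INR h) / INR (2 * h + 1)) + 2 * PI * INR i * (INR k - INR h) / INR (2 * h + 1)).
    - rewrite cis_add. unfold Cdiv. cring.
    - rewrite minus_IZR, <- !INR_IZR_INZ. field. lra. }
  (* With the sum over the roots inside, orthogonality keeps only [i = s]. *)
  rewrite sum_n_switch.
  rewrite (sum_n_ext_loc _ (fun i => if Nat.eq_dec i s then (RtoC (INR (2 * h + 1)) * (RtoC (u ^ i) / RtoC (1 - u ^ (2 * h + 1))))%C else RtoC 0)).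
  - rewrite (sum_n_kronecker (fun i => (RtoC (INR (2 * h + 1)) * (RtoC (u ^ i) / RtoC (1 - u ^ (2 * h + 1))))%C) s (2 * h) Hs).
    as_C. rewrite <- RtoC_div, <- RtoC_mult by lra. f_equal. field. lra.
  - intros i Hi. rewrite sum_n_Cmult_r, character_sum by lia.
    destruct (Z.eq_dec (Z.of_nat i - Z.of_nat s) 0); destruct (Nat.eq_dec i s); try lia; cring.
Qed.

(** * Kernel sums over the roots *)

Lemma Ccv_sum_n (u : nat -> nat -> C) (l : nat -> C) (n : nat) :
  (forall k, (k <= n)%nat -> Ccv (u k) (l k)) -> Ccv (fun p => sum_n (fun k => u k p) n) (sum_n l n).
Proof.
  intros H. induction n.
  - rewrite sum_O. apply Ccv_ext with (u 0%nat); auto. intros; now rewrite sum_O.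
  - rewrite sum_n_CS. apply Ccv_ext with (fun p => (sum_n (fun k => u k p) n + u (S n) p)%C).
    + intros; now rewrite sum_n_CS.
    + apply Ccv_plus; auto.
Qed.

Lemma Cser_sum_n (u : nat -> nat -> C) (l : nat -> C) (n : nat) :
  (forall k, (k <= n)%nat -> Cser (u k) (l k)) -> Cser (fun p => sum_n (fun k => u k p) n) (sum_n l n).
Proof.
  intros H. apply Cser_Ccv. apply Ccv_ext with (fun p => sum_n (fun k => sum_n (u k) p) n).
  - intros p. apply (sum_n_switch (G := C_AbelianMonoid)).
  - apply Ccv_sum_n. intros k Hk. now apply Cser_Ccv, H.
Qed.

(* The summation index [k] in [0, 2h] stands for [j = k - h]; [root_w] is then [A_{N,j} / pi] for the
   appropriate modulus, and [root_sgn] is [(-1)^j]. *)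
Definition root_arg (h k : nat) : R := PI * (INR k - INR h) / INR (2 * h + 1).
Definition root_w (h : nat) (rho : R) (k : nat) : C := cpolar rho (root_arg h k).
Definition root_sgn (h k : nat) : C := RtoC ((-1) ^ (h + k)).

Lemma INR_odd_pos (h : nat) : 0 < INR (2 * h + 1).
Proof. apply lt_0_INR; lia. Qed.

(** |k - h| <= h < N/2: this places every root in the open right half-plane. *)
Lemma root_arg_bound (h k : nat) : (k <= 2 * h)%nat -> - (PI / 2) < root_arg h k < PI / 2.
Proof.
  intros Hk. pose proof (INR_odd_pos h) as HN. pose proof PI_RGT_0. apply le_INR in Hk. rewrite mult_INR in Hk.
  pose proof (pos_INR k). unfold root_arg. rewrite plus_INR, mult_INR in *. simpl (INR 1) in *. simpl (INR 2) in *.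
  split; apply Rmult_lt_reg_r with ((1 + 1) * INR h + 1); auto; unfold Rdiv; rewrite (Rmult_assoc (PI * _)), Rinv_l by lra; nra.
Qed.

(** The sign as exp(s i pi (k - h)). With s = -1 its product with the root w, and with s = 1 its
    quotient by w, becomes a constant multiple of a character of the N-th roots of unity. *)
Lemma root_sgn_cis (h k : nat) (s : Z) : s = 1%Z \/ s = (-1)%Z ->
  root_sgn h k = cis (IZR s * (PI * (INR k - INR h))).
Proof.
  intros [->| ->]; unfold root_sgn; rewrite <- cis_PI_nat, plus_INR.
  - replace (PI * (INR h + INR k)) with (1 * (PI * (INR k - INR h)) + 2 * PI * IZR (Z.of_nat h)).
    + rewrite (cis_add (1 * _)), cis_2PI_Z. ring.
    + rewrite <- INR_IZR_INZ. ring.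
  - replace (PI * (INR h + INR k)) with (-1 * (PI * (INR k - INR h)) + 2 * PI * IZR (Z.of_nat k)).
    + rewrite (cis_add (-1 * _)), cis_2PI_Z. ring.
    + rewrite <- INR_IZR_INZ. ring.
Qed.

Lemma root_w_sq (h k : nat) (rho : R) :
  (root_w h rho k * root_w h rho k)%C = (RtoC (rho ^ 2) * cis (2 * PI * (INR k - INR h) / INR (2 * h + 1)))%C.
Proof.
  pose proof (INR_odd_pos h). unfold root_w. rewrite cpolar_cis.
  replace (2 * PI * (INR k - INR h) / INR (2 * h + 1)) with (root_arg h k + root_arg h k) by (unfold root_arg; field; lra).
  rewrite cis_add, RtoC_pow. ring.
Qed.

Lemma root_den (h k : nat) (rho n : R) : 0 < n ->
  (RtoC (n ^ 2) + root_w h rho k * root_w h rho k)%C =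
  (RtoC (n ^ 2) * (1 - cis (2 * PI * (INR k - INR h) / INR (2 * h + 1)) * RtoC (- (rho ^ 2 / n ^ 2))))%C.
Proof.
  intros Hn. rewrite root_w_sq, RtoC_opp, RtoC_div by nra.
  assert (RtoC (n ^ 2) <> 0) by (apply RtoC_neq_0; nra). field. auto.
Qed.

Lemma root_u_nonpos (rho n : R) : 0 < n -> - (rho ^ 2 / n ^ 2) <= 0.
Proof.
  intros Hn. assert (0 < / n ^ 2) by (apply Rinv_0_lt_compat; nra). unfold Rdiv. nra.
Qed.

Lemma root_pow_den (h : nat) (rho n : R) : 0 < n -> 
  1 - (- (rho ^ 2 / n ^ 2)) ^ (2 * h + 1) = (n ^ (2 * (2 * h + 1)) + (rho ^ (2 * h + 1)) ^ 2) / n ^ (2 * (2 * h + 1)) /\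
  0 < n ^ (2 * (2 * h + 1)) + (rho ^ (2 * h + 1)) ^ 2.
Proof.
  intros Hn. assert (Hp : 0 < n ^ (2 * (2 * h + 1))) by (apply pow_lt; auto).
  split; [|pose proof (pow2_ge_0 (rho ^ (2 * h + 1))); lra].
  replace (- (rho ^ 2 / n ^ 2)) with (-1 * (rho ^ 2 * / n ^ 2)) by (unfold Rdiv; ring).
  rewrite !Rpow_mult_distr, pow_inv. rewrite (pow_add (-1)), pow_1_even, pow_1, Rmult_1_l.
  rewrite <- !pow_mult. rewrite (Nat.mul_comm (2 * h + 1) 2).
  field. lra.
Qed.

(** The exponent s = 0 in [roots_partial_fraction]. The term 1/n is kept apart because it will pair
    with ln n to give Euler's constant. *)
Lemma roots_sum_inv (h : nat) (rho n : R) : 0 < n ->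
  sum_n (fun k => RtoC n / (RtoC (n ^ 2) + root_w h rho k * root_w h rho k))%C (2 * h) =
  RtoC (INR (2 * h + 1) * (/ n - (rho ^ (2 * h + 1)) ^ 2 / (n * (n ^ (2 * (2 * h + 1)) + (rho ^ (2 * h + 1)) ^ 2)))).
Proof.
  intros Hn. pose proof (roots_partial_fraction h 0 (- (rho ^ 2 / n ^ 2)) ltac:(lia) (root_u_nonpos rho n Hn)) as P.
  cbv zeta in P. destruct (root_pow_den h rho n Hn) as [E1 E2]. rewrite E1 in P.
  assert (Hn2 : RtoC (n ^ 2) <> 0) by (apply RtoC_neq_0; nra).
  rewrite (sum_n_ext _ (fun k => RtoC (/ n) * (cis (- (2 * PI * INR 0 * (INR k - INR h) / INR (2 * h + 1))) / (1 - cis (2 * PI * (INR k - INR h) / INR (2 * h + 1)) * RtoC (- (rho ^ 2 / n ^ 2)))))%C).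
  - rewrite sum_n_Cmult_l, P. as_C. rewrite <- RtoC_mult. f_equal. rewrite pow_O.
    assert (0 < n ^ (2 * (2 * h + 1))) by (apply pow_lt; auto). field. repeat split; lra.
  - intros k. rewrite root_den by auto.
    pose proof (one_sub_root_neq_0 h k _ (root_u_nonpos rho n Hn)) as H1.
    replace (- (2 * PI * INR 0 * (INR k - INR h) / INR (2 * h + 1))) with 0 by (simpl INR; unfold Rdiv; ring).
    rewrite cis_0. replace (RtoC (/ n)) with (RtoC n / RtoC (n ^ 2))%C.
    + as_C. field. auto.
    + rewrite <- RtoC_div by nra. f_equal. field. lra.
Qed.

(** The exponent s = h in [roots_partial_fraction]; the power u^h of u = -rho^2/n^2 supplies the
    sign (-1)^h. *)
Lemma roots_sum_sgn (h : nat) (rho n : R) : 0 < n ->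
  sum_n (fun k => root_sgn h k * (root_w h rho k / (RtoC (n ^ 2) + root_w h rho k * root_w h rho k)))%C (2 * h) =
  RtoC ((-1) ^ h * INR (2 * h + 1) * rho ^ (2 * h + 1) * n ^ (2 * h) / (n ^ (2 * (2 * h + 1)) + (rho ^ (2 * h + 1)) ^ 2)).
Proof.
  intros Hn. pose proof (INR_odd_pos h) as HN.
  pose proof (roots_partial_fraction h h (- (rho ^ 2 / n ^ 2)) ltac:(lia) (root_u_nonpos rho n Hn)) as P.
  cbv zeta in P. destruct (root_pow_den h rho n Hn) as [E1 E2]. rewrite E1 in P.
  assert (Hn2 : RtoC (n ^ 2) <> 0) by (apply RtoC_neq_0; nra).
  rewrite (sum_n_ext _ (fun k => RtoC (rho / n ^ 2) * (cis (- (2 * PI * INR h * (INR k - INR h) / INR (2 * h + 1))) / (1 - cis (2 * PI * (INR k - INR h) / INR (2 * h + 1)) * RtoC (- (rho ^ 2 / n ^ 2)))))%C).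
  - rewrite sum_n_Cmult_l, P. as_C. rewrite <- RtoC_mult. f_equal.
    assert (0 < n ^ (2 * (2 * h + 1))) by (apply pow_lt; auto).
    replace (- (rho ^ 2 / n ^ 2)) with (-1 * (rho ^ 2 * / n ^ 2)) by (unfold Rdiv; ring).
    rewrite !Rpow_mult_distr, pow_inv, <- !pow_mult.
    replace (n ^ (2 * (2 * h + 1))) with (n ^ (2 * h) * n ^ (2 * h) * n ^ 2) in * by (rewrite <- !pow_add; f_equal; lia).
    rewrite (pow_add rho (2 * h) 1), pow_1.
    assert (0 < n ^ (2 * h)) by (apply pow_lt; auto).
    rewrite (pow_add rho (2 * h) 1), pow_1 in E2.
    field. replace (rho ^ ((2 * h + 1) * 2)) with ((rho ^ (2 * h) * rho) ^ 2) by (rewrite (pow_mult rho (2 * h + 1) 2), (pow_add rho (2 * h) 1), pow_1; reflexivity).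
    repeat split; lra.
  - intros k. rewrite root_den by auto.
    pose proof (one_sub_root_neq_0 h k _ (root_u_nonpos rho n Hn)) as H1.
    assert (Es : (root_sgn h k * root_w h rho k)%C = (RtoC rho * cis (- (2 * PI * INR h * (INR k - INR h) / INR (2 * h + 1))))%C).
    { rewrite (root_sgn_cis h k (-1)) by auto. unfold root_w. rewrite cpolar_cis.
      replace (- (2 * PI * INR h * (INR k - INR h) / INR (2 * h + 1))) with (-1 * (PI * (INR k - INR h)) + root_arg h k).
      - rewrite cis_add. ring.
      - unfold root_arg. assert (E : INR (2 * h + 1) = 2 * INR h + 1) by (rewrite plus_INR, mult_INR; simpl; ring).
        rewrite E in *. field. lra. }
    rewrite RtoC_div by nra. as_C. unfold Cdiv. rewrite !Cmult_assoc, Es. field. auto.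
Qed.

Lemma sum_root_sgn (h : nat) : sum_n (root_sgn h) (2 * h) = RtoC ((-1) ^ h).
Proof.
  assert (E : forall m, sum_n (root_sgn h) (2 * m) = RtoC ((-1) ^ h)).
  { induction m.
    - simpl. rewrite sum_O. unfold root_sgn. now rewrite Nat.add_0_r.
    - replace (2 * S m)%nat with (S (S (2 * m))) by lia. rewrite !sum_n_CS, IHm. unfold root_sgn.
      rewrite !Nat.add_succ_r. rewrite <- !RtoC_plus. as_C. f_equal. simpl. ring. }
  apply E.
Qed.

(** The terms -1/(2w) of the hyperbolic cotangents cancel over the roots unless N = 1. What survives
    for N = 1 becomes the Bernoulli term j = 1. *)
Lemma sum_root_sgn_inv (h : nat) (rho : R) : 0 < rho ->
  sum_n (fun k => root_sgn h k / root_w h rho k)%C (2 * h) = RtoC (if Nat.eq_dec h 0 then / rho else 0).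
Proof.
  intros Hr. pose proof (INR_odd_pos h) as HN.
  rewrite (sum_n_ext _ (fun k => RtoC (/ rho) * cis (2 * PI * IZR (Z.of_nat h) * (INR k - INR h) / INR (2 * h + 1)))%C).
  - rewrite sum_n_Cmult_l, character_sum by lia.
    destruct (Z.eq_dec (Z.of_nat h) 0); destruct (Nat.eq_dec h 0); try lia.
    + subst h. simpl INR. cring.
    + cring.
  - intros k. rewrite (root_sgn_cis h k 1) by auto. unfold root_w. rewrite cpolar_cis.
    replace (1 * (PI * (INR k - INR h))) with (2 * PI * IZR (Z.of_nat h) * (INR k - INR h) / INR (2 * h + 1) + root_arg h k).
    + rewrite cis_add. pose proof (cis_neq_0 (root_arg h k)). assert (RtoC rho <> 0) by (apply RtoC_neq_0; lra).
      rewrite RtoC_inv by lra. as_C. field. auto.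
    + unfold root_arg. rewrite <- INR_IZR_INZ. assert (E : INR (2 * h + 1) = 2 * INR h + 1) by (rewrite plus_INR, mult_INR; simpl; ring).
      rewrite E in *. field. lra.
Qed.

(** Summed over the N roots, [Psi_partial] is N (ln(M+1) - sum 1/n) plus N times the wanted partial
    sum. The bracket tends to -gamma, which is the source of the Euler constant in the formula. *)
Lemma sine_kernel_series (h : nat) (rho : R) (Ps : nat -> C) : 0 < rho ->
  (forall k, (k <= 2 * h)%nat -> Ccv (Psi_partial (root_w h rho k)) (Ps k)) ->
  Cser (fun n => RtoC ((rho ^ (2 * h + 1)) ^ 2 / (INR (S n) * (INR (S n) ^ (2 * (2 * h + 1)) + (rho ^ (2 * h + 1)) ^ 2))))
    (RtoC euler_gamma + RtoC (/ INR (2 * h + 1)) * sum_n Ps (2 * h))%C.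
Proof.
  intros Hr HP. pose proof (INR_odd_pos h) as HN. apply Cser_Ccv.
  apply Ccv_ext with (fun M => (RtoC (sum_n (fun k => / INR (S k))%R M - ln (INR (S M)))%R + RtoC (/ INR (2 * h + 1)) *
    sum_n (fun k => Psi_partial (root_w h rho k) M) (2 * h))%C).
  - intros M.
    assert (E : sum_n (fun k => Psi_partial (root_w h rho k) M) (2 * h) =
      (RtoC (INR (2 * h + 1) * ln (INR (S M))) - sum_n (fun n => RtoC (INR (2 * h + 1) * (/ INR (S n) - (rho ^ (2 * h + 1)) ^ 2 / (INR (S n) * (INR (S n) ^ (2 * (2 * h + 1)) + (rho ^ (2 * h + 1)) ^ 2))))) M)%C).
    { unfold Psi_partial, Cminus. rewrite sum_n_Cplus, sum_n_const_C.
      replace (S (2 * h)) with (2 * h + 1)%nat by lia. rewrite <- RtoC_mult. as_C. f_equal.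
      transitivity (sum_n (fun k => (- (1)) * sum_n (fun k0 => RtoC (INR (S k0)) / (RtoC (INR (S k0) ^ 2) + root_w h rho k * root_w h rho k)) M)%C (2 * h)).
      { apply sum_n_ext. intros k. cring. }
      rewrite sum_n_Cmult_l. rewrite sum_n_switch.
      rewrite (sum_n_ext (fun j => sum_n _ (2 * h)) (fun n => RtoC (INR (2 * h + 1) * (/ INR (S n) - (rho ^ (2 * h + 1)) ^ 2 / (INR (S n) * (INR (S n) ^ (2 * (2 * h + 1)) + (rho ^ (2 * h + 1)) ^ 2)))))).
      - cring.
      - intros n. apply roots_sum_inv. apply INR_S_pos. }
    rewrite E. rewrite <- !RtoC_sum_n, sum_n_Rmult_l.
    rewrite <- RtoC_minus, <- RtoC_mult, <- RtoC_plus. f_equal.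
    unfold Rminus. rewrite sum_n_Rplus.
    rewrite (sum_n_ext (fun k => - _) (fun k => (-1) * ((rho ^ (2 * h + 1)) ^ 2 / (INR (S k) * (INR (S k) ^ (2 * (2 * h + 1)) + (rho ^ (2 * h + 1)) ^ 2))))).
    2: { intros k. as_R. ring. }
    rewrite sum_n_Rmult_l. as_R. field. lra.
  - apply Ccv_plus.
    + apply Ccv_RtoC, euler_gamma_cv.
    + apply Ccv_mult; [apply Ccv_const|]. now apply Ccv_sum_n.
Qed.

(** [coth_series] at every root, weighted by the signs; the constants pi/2 add up to (-1)^h pi/2
    because the alternating sum has an odd number of terms. *)
Lemma cosine_kernel_series (h : nat) (rho : R) : 0 < rho ->
  Cser (fun n => RtoC ((-1) ^ h * INR (2 * h + 1) * rho ^ (2 * h + 1) * INR (S n) ^ (2 * h) / (INR (S n) ^ (2 * (2 * h + 1)) + (rho ^ (2 * h + 1)) ^ 2)))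
   (RtoC (PI / 2 * (-1) ^ h - / 2 * (if Nat.eq_dec h 0 then / rho else 0))
     + PI * sum_n (fun k => root_sgn h k / (Cexp (2 * PI * root_w h rho k) - 1)) (2 * h))%C.
Proof.
  intros Hr. 
  apply Cser_ext with (fun n => sum_n (fun k => root_sgn h k * (root_w h rho k / (RtoC (INR (S n) ^ 2) + root_w h rho k * root_w h rho k)))%C (2 * h)).
  { intros n. apply roots_sum_sgn, INR_S_pos. }
  apply Cser_eq with (sum_n (fun k => root_sgn h k * (- (/ (2 * root_w h rho k)) + PI / 2 + PI / (Cexp (2 * PI * root_w h rho k) - 1)))%C (2 * h)).
  - rewrite (sum_n_ext_loc _ (fun k => (RtoC (- / 2) * (root_sgn h k / root_w h rho k) + RtoC (PI / 2) * root_sgn h k) + PI * (root_sgn h k / (Cexp (2 * PI * root_w h rho k) - 1)))%C).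
    + rewrite !sum_n_Cplus, !sum_n_Cmult_l, sum_root_sgn, sum_root_sgn_inv by auto.
      as_C. rewrite RtoC_minus, !RtoC_mult, !RtoC_opp. ring.
    + intros k Hk. pose proof (root_arg_bound h k Hk) as Ha.
      pose proof (cpolar_neq_0 rho (root_arg h k) Hr) as H1. pose proof (cpolar_exp_neq_1 rho (root_arg h k) Hr Ha) as H2.
      fold (root_w h rho k) in H1, H2. as_C. rewrite RtoC_opp, RtoC_inv, RtoC_div by lra. field. repeat split; auto.
  - apply Cser_sum_n. intros k Hk. apply Cser_scal. apply coth_series; auto. now apply root_arg_bound.
Qed.

(** * Interchange of the summations *)

Lemma ker_cos_bound (t u : R) : 0 < t -> 0 < u -> Rabs (2 * t / (t ^ 2 + u ^ 2)) <= 4 / t.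
Proof.
  intros Ht Hu. assert (0 < t ^ 2 + u ^ 2) by nra.
  rewrite Rabs_pos_eq by (apply Rmult_le_pos; [lra|left; now apply Rinv_0_lt_compat]).
  apply Rmult_le_reg_r with (t * (t ^ 2 + u ^ 2)); [nra|].
  replace (2 * t / (t ^ 2 + u ^ 2) * (t * (t ^ 2 + u ^ 2))) with (2 * t ^ 2) by (field; lra).
  replace (4 / t * (t * (t ^ 2 + u ^ 2))) with (4 * (t ^ 2 + u ^ 2)) by (field; lra). nra.
Qed.

Lemma ker_sin_bound (t u : R) : 0 < t -> 0 < u -> Rabs (2 * u / (t ^ 2 + u ^ 2)) <= 4 / t.
Proof.
  intros Ht Hu. assert (0 < t ^ 2 + u ^ 2) by nra.
  rewrite Rabs_pos_eq by (apply Rmult_le_pos; [lra|left; now apply Rinv_0_lt_compat]).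
  apply Rmult_le_reg_r with (t * (t ^ 2 + u ^ 2)); [nra|].
  replace (2 * u / (t ^ 2 + u ^ 2) * (t * (t ^ 2 + u ^ 2))) with (2 * u * t) by (field; lra).
  replace (4 / t * (t * (t ^ 2 + u ^ 2))) with (4 * (t ^ 2 + u ^ 2)) by (field; lra). nra.
Qed.

(** The step is compared with p times the summand of the series at a = 1, so the variations add up
    to a sum known in closed form. *)
Lemma ker_cos_diff (t u v p : R) : 0 < t -> 0 < u -> v = u + p -> 0 < p ->
  Rabs (2 * t / (t ^ 2 + u ^ 2) - 2 * t / (t ^ 2 + v ^ 2)) <= 2 * p / (t ^ 2 + u ^ 2).
Proof.
  intros Ht Hu Hv Hp. assert (Du : 0 < t ^ 2 + u ^ 2) by nra. assert (Dv : 0 < t ^ 2 + v ^ 2) by nra.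
  replace (2 * t / (t ^ 2 + u ^ 2) - 2 * t / (t ^ 2 + v ^ 2)) with (2 * t * p * (u + v) / ((t ^ 2 + u ^ 2) * (t ^ 2 + v ^ 2))).
  2: { replace (2 * t * p * (u + v)) with (2 * t * (v ^ 2 - u ^ 2)) by (rewrite Hv; ring). field. lra. }
  assert (D2 : 0 < (t ^ 2 + u ^ 2) * (t ^ 2 + v ^ 2)) by now apply Rmult_lt_0_compat.
  assert (Hv0 : 0 < v) by lra.
  rewrite Rabs_pos_eq.
  2: { apply Rmult_le_pos; [|left; now apply Rinv_0_lt_compat]. repeat apply Rmult_le_pos; lra. }
  apply Rmult_le_reg_r with ((t ^ 2 + u ^ 2) * (t ^ 2 + v ^ 2)); auto.
  replace (2 * t * p * (u + v) / ((t ^ 2 + u ^ 2) * (t ^ 2 + v ^ 2)) * ((t ^ 2 + u ^ 2) * (t ^ 2 + v ^ 2))) with (2 * p * (t * (u + v))) by (field; lra).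
  replace (2 * p / (t ^ 2 + u ^ 2) * ((t ^ 2 + u ^ 2) * (t ^ 2 + v ^ 2))) with (2 * p * (t ^ 2 + v ^ 2)) by (field; lra).
  apply Rmult_le_compat_l; [lra|].
  pose proof (pow2_ge_0 (t - v)). assert (0 <= t * (v - u)) by (apply Rmult_le_pos; lra). nra.
Qed.

(** u/(t^2 + u^2) rises up to u = t and falls afterwards, so its variation is estimated stepwise;
    the bound is the one of the cosine kernel. *)
Lemma ker_sin_diff (t u v p : R) : 0 < t -> 0 < u -> v = u + p -> 0 < p ->
  Rabs (2 * u / (t ^ 2 + u ^ 2) - 2 * v / (t ^ 2 + v ^ 2)) <= 2 * p / (t ^ 2 + u ^ 2).
Proof.
  intros Ht Hu Hv Hp. assert (Du : 0 < t ^ 2 + u ^ 2) by nra. assert (Dv : 0 < t ^ 2 + v ^ 2) by nra.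
  replace (2 * u / (t ^ 2 + u ^ 2) - 2 * v / (t ^ 2 + v ^ 2)) with (2 * p * (u * v - t ^ 2) / ((t ^ 2 + u ^ 2) * (t ^ 2 + v ^ 2))).
  2: { replace (2 * p * (u * v - t ^ 2)) with (2 * (u * (t ^ 2 + v ^ 2) - v * (t ^ 2 + u ^ 2))) by (rewrite Hv; ring). field. lra. }
  assert (D2 : 0 < (t ^ 2 + u ^ 2) * (t ^ 2 + v ^ 2)) by now apply Rmult_lt_0_compat.
  unfold Rdiv at 1. rewrite !Rabs_mult, (Rabs_pos_eq 2), (Rabs_pos_eq p), (Rabs_pos_eq (/ _)) by (try lra; left; now apply Rinv_0_lt_compat).
  apply Rmult_le_reg_r with ((t ^ 2 + u ^ 2) * (t ^ 2 + v ^ 2)); auto.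
  rewrite Rmult_assoc, Rinv_l, Rmult_1_r by lra.
  replace (2 * p / (t ^ 2 + u ^ 2) * ((t ^ 2 + u ^ 2) * (t ^ 2 + v ^ 2))) with (2 * p * (t ^ 2 + v ^ 2)) by (field; lra).
  apply Rmult_le_compat_l; [lra|]. apply Rabs_le. split; nra.
Qed.

Definition kernel_term (t a : R) (m : nat) : R :=
  cos (2 * PI * INR (S m) * a) * (2 * t / (t ^ 2 + 4 * PI ^ 2 * INR (S m) ^ 2))
     + sin (2 * PI * INR (S m) * a) * (4 * PI * INR (S m) / (t ^ 2 + 4 * PI ^ 2 * INR (S m) ^ 2)).

(** Abel summation with D = 1/sin(pi a) and b = 4/t for each of the two kernels: 16 = 2 * (2 *
    4). *)
Lemma kernel_partial_bound (t a : R) (p : nat) : 0 < t -> 0 < a < 1 ->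
  Rabs (sum_n (kernel_term t a) p) <= 16 * / sin (PI * a) / t.
Proof.
  intros Ht Ha. pose proof PI_RGT_0 as HPI. pose proof PI_4 as HPI4. unfold kernel_term. rewrite sum_n_Rplus.
  set (u := fun m => 2 * PI * INR (S m)).
  assert (Hu : forall m, 0 < u m) by (intros m; pose proof (INR_S_pos m); unfold u; apply Rmult_lt_0_compat; lra).
  assert (Hus : forall m, u (S m) = u m + 2 * PI) by (intros m; unfold u; rewrite (S_INR (S m)); ring).
  assert (Hden : forall m, t ^ 2 + 4 * PI ^ 2 * INR (S m) ^ 2 = t ^ 2 + u m ^ 2) by (intros m; unfold u; ring).
  destruct (is_series_inv_sum_sq t Ht) as [l [Hl Hl2]].
  (* The total variation is at most (2 pi/t) * (1/2) = pi/t, and pi <= 4. *)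
  assert (HB : forall m, sum_n (fun m => 2 * (2 * PI) / (t ^ 2 + u m ^ 2)) m <= 4 / t).
  { intros m. rewrite (sum_n_ext _ (fun m => (2 * PI / t) * (2 * t / (t ^ 2 + 4 * PI ^ 2 * INR (S m) ^ 2)))).
    - rewrite sum_n_Rmult_l.
      apply Rle_trans with (2 * PI / t * (1 / 2)).
      + apply Rmult_le_compat_l; [left; apply Rdiv_lt_0_compat; lra|]. apply Rle_trans with (2 := Hl2).
        apply sum_n_le_is_series; auto. intros n. pose proof (pf_den_pos t n).
        apply Rmult_le_pos; [lra|left; now apply Rinv_0_lt_compat].
      + replace (2 * PI / t * (1 / 2)) with (PI / t) by (field; lra). unfold Rdiv. apply Rmult_le_compat_r; auto.
        left; now apply Rinv_0_lt_compat.
    - intros k. as_R. rewrite Hden. pose proof (Hu k). assert (0 < t ^ 2 + u k ^ 2) by nra. field. split; lra. }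
  assert (H1 : Rabs (sum_n (fun m => cos (2 * PI * INR (S m) * a) * (2 * t / (t ^ 2 + 4 * PI ^ 2 * INR (S m) ^ 2))) p) <= 2 * / sin (PI * a) * (4 / t)).
  { apply abel_bound with (B := fun m => 2 * (2 * PI) / (t ^ 2 + u m ^ 2)); auto.
    - intros m. now apply Rabs_sum_cos_le.
    - intros m. rewrite Hden. now apply ker_cos_bound.
    - intros m. rewrite !Hden. apply ker_cos_diff; auto. lra. }
  assert (H2 : Rabs (sum_n (fun m => sin (2 * PI * INR (S m) * a) * (4 * PI * INR (S m) / (t ^ 2 + 4 * PI ^ 2 * INR (S m) ^ 2))) p) <= 2 * / sin (PI * a) * (4 / t)).
  { apply abel_bound with (B := fun m => 2 * (2 * PI) / (t ^ 2 + u m ^ 2)); auto.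
    - intros m. now apply Rabs_sum_sin_le.
    - intros m. rewrite Hden. replace (4 * PI * INR (S m)) with (2 * u m) by (unfold u; ring). now apply ker_sin_bound.
    - intros m. rewrite !Hden. replace (4 * PI * INR (S m)) with (2 * u m) by (unfold u; ring).
      replace (4 * PI * INR (S (S m))) with (2 * u (S m)) by (unfold u; ring). apply ker_sin_diff; auto. lra. }
  eapply Rle_trans; [apply Rabs_triang|]. unfold Rdiv in *. lra.
Qed.

(* The summand on the left-hand side, with [N = 2 h + 1]. *)
Definition lam (a : R) (h : nat) (x : R) (n : nat) : R :=
  exp (- a * INR (S n) ^ (2 * h + 1) * x) / (INR (S n) * (1 - exp (- INR (S n) ^ (2 * h + 1) * x))).

Lemma zeta_pow (N : nat) : is_series (fun n => / INR (S n) ^ (S (S N))) (zeta (INR (S N) + 1)).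
Proof.
  unfold zeta. rewrite (Series_ext _ (fun n => / INR (S n) ^ (S (S N)))).
  - apply Series_correct. apply ex_series_Rabs_le with (2 := ex_series_inv_S_sq). intros n.
    pose proof (INR_S_pos n). pose proof (INR_S_ge_1 n).
    rewrite Rabs_pos_eq by (left; apply Rinv_0_lt_compat, pow_lt; auto).
    apply Rinv_le_contravar; [apply pow_lt; auto|]. apply Rle_pow; auto. lia.
  - intros n. rewrite <- S_INR, Rpower_pow; auto. apply INR_S_pos.
Qed.

(** Since t_n >= n x, the weight 1/n turns the bound on the partial sums in m into a multiple of
    1/n^2. The terms 1/(n t_n), excluded from the exchange, add up to zeta(N+1)/x. *)
Lemma lam_swap (a x : R) (h : nat) : 0 < a < 1 -> 0 < x ->
  (forall m, ex_series (fun n => / INR (S n) * kernel_term (INR (S n) ^ (2 * h + 1) * x) a m)) ->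
  is_series (fun m => Series (fun n => / INR (S n) * kernel_term (INR (S n) ^ (2 * h + 1) * x) a m))
    (Series (lam a h x) - zeta (INR (2 * h + 1) + 1) / x) /\ ex_series (lam a h x).
Proof.
  intros Ha Hx Hex.
  set (t := fun n => INR (S n) ^ (2 * h + 1) * x).
  pose proof INR_S_ge_1 as Hn1.
  assert (Ht : forall n, INR (S n) * x <= t n).
  { intros n. unfold t. apply Rmult_le_compat_r; [lra|]. rewrite <- (pow_1 (INR (S n))) at 1. apply Rle_pow; auto. lia. }
  assert (Ht0 : forall n, 0 < t n).
  { intros n. specialize (Ht n). pose proof (INR_S_pos n). assert (0 < INR (S n) * x) by now apply Rmult_lt_0_compat. lra. }
  assert (Hs : 0 < / sin (PI * a)) by (apply Rinv_0_lt_compat, sin_PI_pos; auto).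
  set (g := fun n => / INR (S n) * (exp (- a * t n) / (1 - exp (- t n)) - / t n)).
  destruct (series_swap_dominated (fun n m => / INR (S n) * kernel_term (t n) a m) g
     (fun n => (16 * / sin (PI * a) / x) * / INR (S n) ^ 2)) as [Eg Hsum]; auto.
  - intros n p. rewrite sum_n_Rmult_l, Rabs_mult. pose proof (INR_S_pos n) as Hn.
    rewrite Rabs_pos_eq by (left; now apply Rinv_0_lt_compat).
    apply Rle_trans with (/ INR (S n) * (16 * / sin (PI * a) / t n)).
    + apply Rmult_le_compat_l; [left; now apply Rinv_0_lt_compat|]. now apply kernel_partial_bound.
    + replace (16 * / sin (PI * a) / x * / INR (S n) ^ 2) with (/ INR (S n) * (16 * / sin (PI * a) / (INR (S n) * x))) by (field; repeat split; try lra; apply Rgt_not_eq, sin_PI_pos; auto).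
      apply Rmult_le_compat_l; [left; now apply Rinv_0_lt_compat|]. unfold Rdiv. apply Rmult_le_compat_l; [lra|].
      apply Rinv_le_contravar; auto. now apply Rmult_lt_0_compat.
  - apply (ex_series_scal (16 * / sin (PI * a) / x) (fun n => / INR (S n) ^ 2)), ex_series_inv_S_sq.
  - intros n. apply (is_series_scal (V := R_NormedModule) (/ INR (S n))). apply partial_fraction_R_cond; auto.
    apply Rgt_not_eq, Ht0.
  - assert (Hz : is_series (fun n => / INR (S n) * / t n) (zeta (INR (2 * h + 1) + 1) / x)).
    { replace (zeta (INR (2 * h + 1) + 1) / x) with (/ x * zeta (INR (2 * h + 1) + 1)) by (unfold Rdiv; ring).
      eapply is_series_ext; [|apply (is_series_scal (V := R_NormedModule) (/ x)); replace (2 * h + 1)%nat with (S (2 * h)) by lia; apply zeta_pow].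
      intros n. change (@scal R_AbsRing R_NormedModule) with Rmult. unfold t. as_R. pose proof (INR_S_pos n).
      replace (2 * h + 1)%nat with (S (2 * h)) by lia. rewrite <- !Rinv_mult. f_equal. rewrite <- !tech_pow_Rmult. ring. }
    assert (Hlam : is_series (lam a h x) (Series g + zeta (INR (2 * h + 1) + 1) / x)).
    { eapply is_series_ext; [|apply (is_series_plus (V := R_NormedModule)); [apply Series_correct; exact Eg|exact Hz]].
      intros n. change (@plus R_NormedModule) with Rplus. as_R. unfold g, lam. pose proof (INR_S_pos n).
      replace (- a * t n) with (- a * INR (S n) ^ (2 * h + 1) * x) by (unfold t; ring).
      replace (- t n) with (- INR (S n) ^ (2 * h + 1) * x) by (unfold t; ring).
      assert (1 - exp (- INR (S n) ^ (2 * h + 1) * x) <> 0).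
      { apply Rgt_not_eq. assert (exp (- INR (S n) ^ (2 * h + 1) * x) < exp 0); [|rewrite exp_0 in *; lra].
        apply exp_increasing. specialize (Ht0 n). unfold t in Ht0. lra. }
      specialize (Ht0 n). field. repeat split; lra. }
    split; [|eexists; eauto]. rewrite (is_series_unique _ _ Hlam).
    replace (Series g + zeta (INR (2 * h + 1) + 1) / x - zeta (INR (2 * h + 1) + 1) / x) with (Series g) by ring.
    exact Hsum.
Qed.

(** With g(m) = (m+1)^(-d), the inequality 1/(m+2) <= ln(m+2) - ln(m+1) gives d g(m+1)/(m+2) <= g(m)
    - g(m+1), a convergent telescoping series. *)
Lemma ex_series_inv_Rpower (d : R) : 0 < d -> ex_series (fun m => / INR (S m) * Rpower (INR (S m)) (- d)).
Proof.
  intros Hd. apply ex_series_incr_1.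
  set (g := fun m => Rpower (INR (S m)) (- d)).
  assert (Hg0 : forall m, 0 < g m) by (intros m; apply exp_pos).
  assert (Hstep : forall m, d * (/ INR (S (S m)) * g (S m)) <= g m - g (S m)).
  { intros m. pose proof (INR_S_pos m) as Hm. pose proof (ln_step_bounds (INR (S m)) Hm) as [L _]. rewrite <- S_INR in L.
    unfold g, Rpower in *. set (l1 := ln (INR (S m))) in *. set (l2 := ln (INR (S (S m)))) in *.
    replace (- d * l1) with (- d * l2 + d * (l2 - l1)) by ring. rewrite exp_plus.
    pose proof (exp_ineq1_le (d * (l2 - l1))). pose proof (exp_pos (- d * l2)).
    assert (d * / INR (S (S m)) <= d * (l2 - l1)) by (apply Rmult_le_compat_l; lra). nra. }
  assert (Hdec : forall m, g (S m) <= g m).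
  { intros m. specialize (Hstep m). pose proof (Rinv_0_lt_compat _ (INR_S_pos (S m))). pose proof (Hg0 (S m)).
    assert (0 <= / INR (S (S m)) * g (S m)) by (apply Rmult_le_pos; lra). nra. }
  destruct (ex_finite_lim_seq_decr g 0 Hdec (fun m => Rlt_le _ _ (Hg0 m))) as [l Hl].
  assert (EV : ex_series (fun m => g m - g (S m))).
  { exists (g 0%nat - l). apply is_series_is_lim_seq. apply is_lim_seq_ext with (fun n => g 0%nat - g (S n)).
    - intros n. induction n; [now rewrite sum_O|]. rewrite sum_n_S, <- IHn. ring.
    - apply is_lim_seq_minus'; [apply is_lim_seq_const|]. now apply (is_lim_seq_incr_1 g). }
  apply ex_series_Rabs_le with (fun m => / d * (g m - g (S m))).
  - intros m. specialize (Hstep m). fold (g (S m)). rewrite Rabs_pos_eq.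
    + apply Rmult_le_reg_l with d; auto. rewrite <- (Rmult_assoc d (/ d)), Rinv_r by lra. lra.
    + apply Rmult_le_pos; [left; apply Rinv_0_lt_compat, INR_S_pos|]. specialize (Hg0 (S m)); lra.
  - apply (ex_series_scal (/ d) (fun m => g m - g (S m))). exact EV.
Qed.

(** The modulus of A_{N,j}((m+1)/x)/pi, common to all j. *)
Definition rho (h : nat) (x : R) (m : nat) : R := Rpower (2 * PI * INR (S m) / x) (/ INR (2 * h + 1)).

Definition exp_part (h : nat) (x : R) (k m : nat) : C := (/ (Cexp (2 * PI * root_w h (rho h x m) k) - 1))%C.

(** The first pair is the principal logarithm of the root, written in polar coordinates so that
    logarithms can be summed over [k]. *)
Definition psi_part (h : nat) (x : R) (k m : nat) : C :=
  ((ln (rho h x m), root_arg h k) -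
   RtoC (1 / 2) * (digamma (Ci * root_w h (rho h x m) k) + digamma (- Ci * root_w h (rho h x m) k)))%C.

Lemma rho_pos (h m : nat) (x : R) : 0 < rho h x m.
Proof. apply exp_pos. Qed.

Lemma rho_arg_pos (m : nat) (x : R) : 0 < x -> 0 < 2 * PI * INR (S m) / x.
Proof.
  intros Hx. pose proof PI_RGT_0. apply Rdiv_lt_0_compat; auto. apply Rmult_lt_0_compat; [lra|apply INR_S_pos].
Qed.

Lemma rho_pow (h m : nat) (x : R) : 0 < x -> rho h x m ^ (2 * h + 1) = 2 * PI * INR (S m) / x.
Proof.
  intros Hx. pose proof (INR_odd_pos h). unfold rho. rewrite <- Rpower_pow by apply exp_pos.
  rewrite Rpower_mult, Rinv_l, Rpower_1; auto; [|lra]. now apply rho_arg_pos.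
Qed.

Lemma ln_rho (h m : nat) (x : R) : ln (rho h x m) = / INR (2 * h + 1) * ln (2 * PI * INR (S m) / x).
Proof. unfold rho, Rpower. now rewrite ln_exp. Qed.

Lemma inv_rho (h m : nat) (x : R) : 0 < x ->
  / rho h x m = Rpower (2 * PI / x) (- / INR (2 * h + 1)) * Rpower (INR (S m)) (- / INR (2 * h + 1)).
Proof.
  intros Hx. pose proof PI_RGT_0. pose proof (INR_S_pos m). unfold rho.
  rewrite <- Rpower_Ropp. replace (2 * PI * INR (S m) / x) with ((2 * PI / x) * INR (S m)) by (field; lra).
  symmetry. apply Rpower_mult_distr; auto. apply Rdiv_lt_0_compat; lra.
Qed.

Lemma inv_rho_le (h m : nat) (x : R) : 0 < x -> / rho h x m <= Rpower (2 * PI / x) (- / INR (2 * h + 1)).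
Proof.
  intros Hx. rewrite inv_rho by auto. rewrite <- (Rmult_1_r (Rpower (2 * PI / x) _)) at 2.
  apply Rmult_le_compat_l; [left; apply exp_pos|]. pose proof (INR_odd_pos h). unfold Rpower. rewrite <- exp_0. apply exp_le_mono.
  assert (0 <= ln (INR (S m))).
  { rewrite <- ln_1. destruct m; [right; reflexivity|]. left. apply ln_increasing; [lra|]. change 1 with (INR 1). apply lt_INR; lia. }
  pose proof (Rinv_0_lt_compat _ H). nra.
Qed.

(** |exp z - 1| >= exp(Re z) - 1 >= Re z. The decay is in fact exponential, but 1/rho matches what
    the digamma part allows. *)
Lemma exp_part_bound (h k m : nat) (x : R) : (k <= 2 * h)%nat ->
  Cmod (exp_part h x k m) <= / (2 * PI * cos (root_arg h k)) * / rho h x m.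
Proof.
  intros Hk. pose proof (root_arg_bound h k Hk) as Ha. pose proof (rho_pos h m x) as Hr. pose proof PI_RGT_0 as HPI.
  pose proof (cos_gt_0 _ (proj1 Ha) (proj2 Ha)) as Hc.
  set (z := (2 * PI * root_w h (rho h x m) k)%C).
  assert (Hz : Re z = 2 * PI * cos (root_arg h k) * rho h x m) by (unfold z, root_w, cpolar; simpl; ring).
  assert (Hp : 0 < 2 * PI * cos (root_arg h k) * rho h x m) by (apply Rmult_lt_0_compat; auto; apply Rmult_lt_0_compat; lra).
  assert (Hl : 2 * PI * cos (root_arg h k) * rho h x m <= Cmod (Cexp z - 1)).
  { pose proof (Cmod_triangle (Cexp z - 1) 1) as T. replace (Cexp z - 1 + 1)%C with (Cexp z) in T by ring.
    rewrite Cmod_Cexp, Cmod_1, Hz in T. pose proof (exp_ineq1_le (2 * PI * cos (root_arg h k) * rho h x m)). lra. }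
  unfold exp_part. fold z. rewrite Cmod_inv.
  - rewrite <- Rinv_mult. now apply Rinv_le_contravar.
  - apply Cmod_gt_0. lra.
Qed.

Lemma psi_part_bound (h k m : nat) (x : R) : (k <= 2 * h)%nat ->
  Cmod (psi_part h x k m) <= 2 / cos (root_arg h k) ^ 2 * (/ rho h x m ^ 2 + PI / (2 * rho h x m)).
Proof.
  intros Hk. pose proof (root_arg_bound h k Hk) as Ha. pose proof (rho_pos h m x) as Hr.
  destruct (Psi_bound (rho h x m) (root_arg h k) Hr Ha) as [l [Hl Hb]].
  pose proof (digamma_pair (rho h x m) (root_arg h k) Hr Ha) as Hd.
  rewrite (Ccv_unique _ _ _ Hl Hd) in Hb. unfold psi_part, root_w.
  match goal with |- Cmod (?a - ?b) <= _ => replace (a - b)%C with (- (b - a))%C by ring end.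
  rewrite Cmod_opp. exact Hb.
Qed.

(** 1/rho is a constant times (m+1)^(-1/N). With the weight 1/(m+1) both transformed series are
    dominated by a convergent power series exponent 1 + 1/N, uniformly in [a]. *)
Lemma part_majorant (h k : nat) (x : R) : 0 < x -> (k <= 2 * h)%nat -> exists K, forall m,
  Cmod (exp_part h x k m) <= K * Rpower (INR (S m)) (- / INR (2 * h + 1)) /\
  Cmod (psi_part h x k m) <= K * Rpower (INR (S m)) (- / INR (2 * h + 1)).
Proof.
  intros Hx Hk. pose proof (root_arg_bound h k Hk) as Ha. pose proof PI_RGT_0 as HPI.
  pose proof (cos_gt_0 _ (proj1 Ha) (proj2 Ha)) as Hc.
  set (r0 := Rpower (2 * PI / x) (- / INR (2 * h + 1))).
  assert (Hr0 : 0 < r0) by apply exp_pos.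
  set (K1 := / (2 * PI * cos (root_arg h k)) * r0).
  set (K2 := 2 / cos (root_arg h k) ^ 2 * ((r0 + PI / 2) * r0)).
  assert (HK1 : 0 < K1).
  { apply Rmult_lt_0_compat; auto. apply Rinv_0_lt_compat. apply Rmult_lt_0_compat; lra. }
  assert (Hc2 : 0 < 2 / cos (root_arg h k) ^ 2) by (apply Rdiv_lt_0_compat; [lra|apply pow_lt; auto]).
  assert (HK2 : 0 < K2).
  { apply Rmult_lt_0_compat; auto. apply Rmult_lt_0_compat; lra. }
  exists (K1 + K2). intros m.
  assert (HR : 0 < Rpower (INR (S m)) (- / INR (2 * h + 1))) by apply exp_pos.
  set (R0 := Rpower (INR (S m)) (- / INR (2 * h + 1))) in *.
  pose proof (inv_rho h m x Hx) as E. fold r0 R0 in E.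
  pose proof (inv_rho_le h m x Hx) as L. fold r0 in L.
  pose proof (rho_pos h m x) as Hr.
  split.
  - eapply Rle_trans; [now apply exp_part_bound|]. rewrite E. unfold K1. nra.
  - eapply Rle_trans; [now apply psi_part_bound|].
    apply Rle_trans with (K2 * R0); [|nra].
    unfold K2. rewrite Rmult_assoc. apply Rmult_le_compat_l; [lra|].
    replace (/ rho h x m ^ 2 + PI / (2 * rho h x m)) with ((/ rho h x m + PI / 2) * / rho h x m) by (field; lra).
    rewrite E at 2. rewrite <- Rmult_assoc. apply Rmult_le_compat_r; [lra|]. 
    apply Rmult_le_compat_r; lra.
Qed.

Lemma part_series_correct (h k : nat) (x : R) (c : nat -> R) : 0 < x -> (k <= 2 * h)%nat -> (forall m, Rabs (c m) <= 1) ->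
  let f := fun m => (RtoC (c m / INR (S m)) * exp_part h x k m)%C in
  let g := fun m => (RtoC (c m / INR (S m)) * psi_part h x k m)%C in
  Cser f (CSeries f) /\ Cser g (CSeries g).
Proof.
  intros Hx Hk Hc f g. destruct (part_majorant h k x Hx Hk) as [K HK].
  assert (EV : ex_series (fun m => K * (/ INR (S m) * Rpower (INR (S m)) (- / INR (2 * h + 1))))).
  { apply (ex_series_scal K (fun m => / INR (S m) * Rpower (INR (S m)) (- / INR (2 * h + 1)))).
    apply ex_series_inv_Rpower. apply Rinv_0_lt_compat, INR_odd_pos. }
  assert (Hco : forall m, Rabs (c m / INR (S m)) <= / INR (S m)).
  { intros m. pose proof (Rinv_0_lt_compat _ (INR_S_pos m)). unfold Rdiv. rewrite Rabs_mult, (Rabs_pos_eq (/ _)) by lra.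
    specialize (Hc m). nra. }
  split; apply Cser_dominated with (2 := EV); intros m; unfold f, g; rewrite Cmod_mult, Cmod_R;
    replace (K * (/ INR (S m) * Rpower (INR (S m)) (- / INR (2 * h + 1)))) with (/ INR (S m) * (K * Rpower (INR (S m)) (- / INR (2 * h + 1)))) by ring;
    apply Rmult_le_compat; auto using Rabs_pos, Cmod_ge_0; apply HK.
Qed.

Definition exp_sum (a : R) (h : nat) (x : R) (k : nat) : C :=
  CSeries (fun m => RtoC (cos (2 * PI * INR (S m) * a) / INR (S m)) * exp_part h x k m)%C.
Definition psi_sum (a : R) (h : nat) (x : R) (k : nat) : C :=
  CSeries (fun m => RtoC (sin (2 * PI * INR (S m) * a) / INR (S m)) * psi_part h x k m)%C.
(** The signs of the target are resolved: (-1)^((N+3)/2) = (-1)^h, and in the digamma part the two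
    factors (-1)^j cancel while (-1)^((N+3)/2 + (N+1)/2) = -1. *)
Definition transform_sum (a : R) (h : nat) (x : R) : C :=
  (RtoC ((-1) ^ h / INR (2 * h + 1)) * sum_n (fun k => root_sgn h k * exp_sum a h x k) (2 * h)
   - RtoC (/ (PI * INR (2 * h + 1))) * sum_n (psi_sum a h x) (2 * h))%C.

Lemma Cser_RtoC_inv (u : nat -> R) (l : C) : Cser (fun n => RtoC (u n)) l -> is_series u (Re l) /\ l = RtoC (Re l).
Proof.
  intros [H1 H2]. split; auto. apply C_eq; auto. simpl.
  pose proof (is_series_0 (fun n => Im (RtoC (u n))) (fun _ => eq_refl)) as H0.
  apply is_series_unique in H0, H2. congruence.
Qed.

(** The closed form of the inner sum over n for a fixed frequency m + 1. *)
Definition column (a : R) (h : nat) (x : R) (m : nat) : C :=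
  (RtoC (/ (PI * INR (S m))) *
   (RtoC (cos (2 * PI * INR (S m) * a)) * (RtoC (PI / (2 * INR (2 * h + 1)) - (if Nat.eq_dec h 0 then / (2 * rho h x m) else 0))
       + RtoC ((-1) ^ h * PI / INR (2 * h + 1)) * sum_n (fun k => root_sgn h k * exp_part h x k m) (2 * h))
    + RtoC (sin (2 * PI * INR (S m) * a)) * (RtoC (euler_gamma + / INR (2 * h + 1) * ln (2 * PI * INR (S m) / x))
       - RtoC (/ INR (2 * h + 1)) * sum_n (fun k => psi_part h x k m) (2 * h))))%C.

(** The arguments cancel by symmetry, so the logarithms of the roots add up to the real number
    ln(rho^N). *)
Lemma sum_root_arg (h : nat) : sum_n (root_arg h) (2 * h) = 0.
Proof.
  pose proof (INR_odd_pos h) as HN.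
  assert (E : forall n, sum_n (root_arg h) n = PI / INR (2 * h + 1) * (INR (S n) * (INR n / 2 - INR h))).
  { induction n.
    - rewrite sum_O. unfold root_arg. change (INR 0) with 0. change (INR 1) with 1. as_R. field. lra.
    - rewrite sum_n_S, IHn. unfold root_arg. rewrite !S_INR. as_R. field. lra. }
  rewrite E, mult_INR. change (INR 2) with 2. as_R. field. lra.
Qed.

(** In terms of y = rho^N = 2 pi (m+1)/x the denominator t_n^2 + 4 pi^2 (m+1)^2 equals x^2 (n^(2N) +
    y^2), so a column is a combination of the cosine and sine kernel series. *)
Lemma column_series (a x : R) (h m : nat) : 0 < x ->
  Cser (fun n => RtoC (/ INR (S n) * kernel_term (INR (S n) ^ (2 * h + 1) * x) a m)) (column a h x m).
Proof.
  intros Hx. pose proof (rho_pos h m x) as Hr. pose proof (rho_pow h m x Hx) as Ey. pose proof PI_RGT_0 as HPI.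
  pose proof (INR_odd_pos h) as HN. pose proof (INR_S_pos m) as Hm.
  set (y := 2 * PI * INR (S m) / x) in *. assert (Hy : 0 < y) by now apply rho_arg_pos.
  assert (Sm : INR (S m) = x * y / (2 * PI)) by (unfold y; field; lra).
  pose proof (cosine_kernel_series h (rho h x m) Hr) as KC.
  set (Ps := fun k => (RtoC (1 / 2) * (digamma (Ci * root_w h (rho h x m) k) + digamma (- Ci * root_w h (rho h x m) k)))%C).
  pose proof (sine_kernel_series h (rho h x m) Ps Hr) as KS.
  specialize (KS (fun k Hk => digamma_pair (rho h x m) (root_arg h k) Hr (root_arg_bound h k Hk))).
  rewrite Ey in KC, KS.
  assert (EPs : sum_n Ps (2 * h) = (RtoC (ln y) - sum_n (fun k => psi_part h x k m) (2 * h))%C).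
  { assert (E1 : sum_n (fun k => psi_part h x k m) (2 * h) = (sum_n (fun k => (ln (rho h x m), root_arg h k) : C) (2 * h) + RtoC (-1) * sum_n Ps (2 * h))%C).
    { rewrite <- sum_n_Cmult_l, <- sum_n_Cplus. apply sum_n_ext. intros k. unfold psi_part. fold (Ps k). as_C.
      replace (RtoC (-1)) with (- RtoC 1)%C by (rewrite <- RtoC_opp; reflexivity). ring. }
    assert (E2 : sum_n (fun k => (ln (rho h x m), root_arg h k) : C) (2 * h) = RtoC (ln y)).
    { apply C_eq.
      - rewrite Re_sum_n. unfold Re; cbn [fst].
        rewrite ln_rho. fold y. rewrite (sum_n_ext _ (fun _ => (/ INR (2 * h + 1) * ln y) * 1)) by (intros; as_R; ring).
        rewrite sum_n_Rmult_l. unfold sum_n. rewrite sum_n_m_const. replace (S (2 * h) - 0)%nat with (2 * h + 1)%nat by lia.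
        simpl fst. field. lra.
      - rewrite Im_sum_n. unfold Im; cbn [snd]. apply sum_root_arg. }
    rewrite E1, E2. replace (RtoC (-1)) with (- RtoC 1)%C by (rewrite <- RtoC_opp; reflexivity). as_C. symmetry. ring. }
  set (cc := cos (2 * PI * INR (S m) * a)). set (ss := sin (2 * PI * INR (S m) * a)).
  apply Cser_eq with (RtoC (cc * ((-1) ^ h / (INR (2 * h + 1) * PI * INR (S m)))) * (RtoC (PI / 2 * (-1) ^ h - / 2 * (if Nat.eq_dec h 0 then / rho h x m else 0))
     + PI * sum_n (fun k => root_sgn h k / (Cexp (2 * PI * root_w h (rho h x m) k) - 1)) (2 * h))
     + RtoC (ss * / (PI * INR (S m))) * (RtoC euler_gamma + RtoC (/ INR (2 * h + 1)) * sum_n Ps (2 * h)))%C.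
  - rewrite EPs. unfold column. fold cc ss y. change (sum_n (fun k => (root_sgn h k / (Cexp (2 * PI * root_w h (rho h x m) k) - 1))%C) (2 * h)) with
      (sum_n (fun k => (root_sgn h k * exp_part h x k m)%C) (2 * h)).
    set (SE := sum_n (fun k => (root_sgn h k * exp_part h x k m)%C) (2 * h)). set (SD := sum_n (fun k => psi_part h x k m) (2 * h)).
    pose proof (m1_pow_sq h) as Hsq.
    assert (E1 : RtoC (/ (PI * INR (S m)) * cc * (PI / (2 * INR (2 * h + 1)) - (if Nat.eq_dec h 0 then / (2 * rho h x m) else 0)))
       = RtoC (cc * ((-1) ^ h / (INR (2 * h + 1) * PI * INR (S m))) * (PI / 2 * (-1) ^ h - / 2 * (if Nat.eq_dec h 0 then / rho h x m else 0)))).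
    { f_equal. replace (cc * ((-1) ^ h / (INR (2 * h + 1) * PI * INR (S m))) * (PI / 2 * (-1) ^ h - / 2 * (if Nat.eq_dec h 0 then / rho h x m else 0)))
       with (cc * / (INR (2 * h + 1) * PI * INR (S m)) * (PI / 2 * ((-1) ^ h * (-1) ^ h) - / 2 * ((-1) ^ h * (if Nat.eq_dec h 0 then / rho h x m else 0)))) by (unfold Rdiv; ring).
      rewrite Hsq. destruct (Nat.eq_dec h 0) as [H0|H0].
      - rewrite H0. change (INR (2 * 0 + 1)) with 1. rewrite pow_O. rewrite H0 in Hr. field. repeat split; lra.
      - field. repeat split; lra. }
    assert (E2 : RtoC (cc * ((-1) ^ h / (INR (2 * h + 1) * PI * INR (S m))) * PI) = RtoC (/ (PI * INR (S m)) * cc * ((-1) ^ h * PI / INR (2 * h + 1)))).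
    { f_equal. field. repeat split; lra. }
    transitivity (RtoC (cc * ((-1) ^ h / (INR (2 * h + 1) * PI * INR (S m))) * (PI / 2 * (-1) ^ h - / 2 * (if Nat.eq_dec h 0 then / rho h x m else 0)))
      + RtoC (cc * ((-1) ^ h / (INR (2 * h + 1) * PI * INR (S m))) * PI) * SE + RtoC (ss * / (PI * INR (S m))) * (RtoC euler_gamma + RtoC (/ INR (2 * h + 1)) * (RtoC (ln y) - SD)))%C.
    + rewrite !RtoC_mult. ring.
    + rewrite <- E1, E2. rewrite RtoC_plus, !RtoC_mult. ring.
  - apply Cser_ext with (2 := Cser_plus _ _ _ _ (Cser_scal _ _ _ KC) (Cser_scal _ _ _ KS)).
    intros n. pose proof (INR_S_pos n) as Hn. rewrite <- !RtoC_mult, <- RtoC_plus. f_equal.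
    unfold kernel_term. fold cc ss. rewrite Sm.
    set (nn := INR (S n)) in *.
    replace ((nn ^ (2 * h + 1) * x) ^ 2 + 4 * PI ^ 2 * (x * y / (2 * PI)) ^ 2) with (x ^ 2 * (nn ^ (2 * (2 * h + 1)) + y ^ 2)).
    2: { rewrite (Nat.mul_comm 2 (2 * h + 1)), pow_mult. field. lra. }
    assert (Hd : 0 < nn ^ (2 * (2 * h + 1)) + y ^ 2) by (pose proof (pow_lt nn (2 * (2 * h + 1)) Hn); nra).
    rewrite (pow_add nn (2 * h) 1), pow_1.
    pose proof (m1_pow_sq h) as Hsq.
    set (e := (-1) ^ h) in *. set (D := nn ^ (2 * (2 * h + 1)) + y ^ 2) in *.
    replace (cc * (e / (INR (2 * h + 1) * PI * (x * y / (2 * PI)))) * (e * INR (2 * h + 1) * y * nn ^ (2 * h) / D))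
      with (cc * ((e * e) / (INR (2 * h + 1) * PI * (x * y / (2 * PI)))) * (INR (2 * h + 1) * y * nn ^ (2 * h) / D)) by (unfold Rdiv; ring).
    rewrite Hsq. field. repeat split; lra.
Qed.

(** * The transformation for 0 < a < 1, with Kummer's series still unevaluated *)

Definition cos_series (a : R) : R := Series (fun m => cos (2 * PI * INR (S m) * a) / INR (S m)).
Definition cos_series2 (a : R) : R := Series (fun m => cos (2 * PI * INR (S m) * a) * / INR (S m) ^ 2).
Definition kummer_series (a : R) : R := Series (fun m => sin (2 * PI * INR (S m) * a) * ln (INR (S m)) / (PI * INR (S m))).
(* Equals [log Gamma(a) - 1/2 log (2 pi)] by Kummer's formula; the cosine series is [- log (2 sin (pi a))]. *)
Definition kummer (a : R) : R :=
  cos_series a / 2 + kummer_series a + (euler_gamma + ln (2 * PI)) * (1 / 2 - a).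

Lemma cos_series2_correct (a : R) : is_series (fun m => cos (2 * PI * INR (S m) * a) * / INR (S m) ^ 2) (cos_series2 a).
Proof.
  apply Series_correct. apply ex_series_Rabs_le with (2 := ex_series_inv_S_sq). intros m.
  rewrite Rabs_mult. assert (H : 0 < / INR (S m) ^ 2) by apply inv_S_pow_pos.
  rewrite (Rabs_pos_eq (/ _)) by lra. rewrite <- (Rmult_1_l (/ INR (S m) ^ 2)) at 2.
  apply Rmult_le_compat_r; [lra|]. apply Rabs_cos_le_1.
Qed.

Lemma is_series_Rmult_l (c : R) (u : nat -> R) (l : R) : is_series u l -> is_series (fun n => c * u n) (c * l).
Proof. apply (is_series_scal (V := R_NormedModule) c). Qed.

(** The columns are split into elementary Fourier series [A1], the transformed terms [A2], and a
    remainder [v] with coefficients ln(m)/m. Convergence of [kummer_series] falls out here, as a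
    difference of convergent series. *)
Theorem transform_open (a x : R) (h : nat) : 0 < a < 1 -> 0 < x ->
  RtoC (Series (lam a h x)) =
  (RtoC (zeta (INR (2 * h + 1) + 1) / x
     + / INR (2 * h + 1) * (kummer a + (1 / 2 - a) * ((INR (2 * h + 1) - 1) * euler_gamma - ln x))
     - (if Nat.eq_dec h 0 then x / (4 * PI ^ 2) * cos_series2 a else 0))
   + transform_sum a h x)%C.
Proof.
  intros Ha Hx. pose proof PI_RGT_0 as HPI. pose proof (INR_odd_pos h) as HN.
  set (N := INR (2 * h + 1)) in *.
  set (T := Series (lam a h x) - zeta (N + 1) / x).
  assert (HT : Cser (column a h x) T).
  { assert (Hcol : forall m, is_series (fun n => / INR (S n) * kernel_term (INR (S n) ^ (2 * h + 1) * x) a m) (Re (column a h x m)) /\ column a h x m = RtoC (Re (column a h x m))).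
    { intros m. apply Cser_RtoC_inv. now apply column_series. }
    destruct (lam_swap a x h Ha Hx) as [HS _].
    { intros m. eexists. apply Hcol. }
    apply Cser_ext with (fun m => RtoC (Series (fun n => / INR (S n) * kernel_term (INR (S n) ^ (2 * h + 1) * x) a m))).
    - intros m. destruct (Hcol m) as [H1 H2]. rewrite (is_series_unique _ _ H1). now rewrite <- H2.
    - apply Cser_RtoC. exact HS. }
  set (c := fun m => cos (2 * PI * INR (S m) * a)). set (s := fun m => sin (2 * PI * INR (S m) * a)).
  set (A1 := fun m => / (2 * N) * (c m / INR (S m)) + - (if Nat.eq_dec h 0 then x / (4 * PI ^ 2) else 0) * (c m * / INR (S m) ^ 2)
        + (euler_gamma + / N * ln (2 * PI / x)) * (s m / (PI * INR (S m)))).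
  set (L1 := / (2 * N) * cos_series a + - (if Nat.eq_dec h 0 then x / (4 * PI ^ 2) else 0) * cos_series2 a
        + (euler_gamma + / N * ln (2 * PI / x)) * (1 / 2 - a)).
  assert (HA1 : is_series A1 L1).
  { apply (is_series_plus (V := R_NormedModule)); [apply (is_series_plus (V := R_NormedModule))|]; apply is_series_Rmult_l.
    - apply Series_correct. apply ex_series_dirichlet with (/ sin (PI * a)). intros m. now apply Rabs_sum_cos_le.
    - apply cos_series2_correct.
    - now apply is_series_sin_div. }
  set (A2 := fun m => (RtoC ((-1) ^ h / N) * sum_n (fun k => root_sgn h k * (RtoC (c m / INR (S m)) * exp_part h x k m)) (2 * h)
      + RtoC (- / (PI * N)) * sum_n (fun k => (RtoC (s m / INR (S m)) * psi_part h x k m)) (2 * h))%C).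
  assert (HA2 : Cser A2 (transform_sum a h x)).
  { apply Cser_eq with (RtoC ((-1) ^ h / N) * sum_n (fun k => root_sgn h k * exp_sum a h x k) (2 * h)
       + RtoC (- / (PI * N)) * sum_n (psi_sum a h x) (2 * h))%C.
    - unfold transform_sum. fold N. rewrite (RtoC_opp (/ (PI * N))). ring.
    - apply Cser_plus; apply Cser_scal.
      + apply Cser_sum_n. intros k Hk. apply Cser_scal. 
        apply (part_series_correct h k x c Hx Hk). intros m; apply Rabs_cos_le_1.
      + apply Cser_sum_n. intros k Hk. 
        apply (part_series_correct h k x s Hx Hk). intros m; apply Rabs_sin_le_1. }
  set (v := fun m => s m * ln (INR (S m)) / (PI * INR (S m))).
  (* ln(2 pi k/x) = ln(2 pi/x) + ln k: the first part goes with the sawtooth series, the second is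
     Kummer's. *)
  assert (Hsplit : forall m, (column a h x m + RtoC (-1) * (RtoC (A1 m) + A2 m))%C = RtoC (/ N * v m)).
  { intros m. unfold column, A2. fold N. fold (c m) (s m).
    pose proof (INR_S_pos m) as Hm. set (k1 := INR (S m)) in *.
    rewrite (sum_n_ext (fun k => (root_sgn h k * (RtoC (c m / k1) * exp_part h x k m))%C) (fun k => (RtoC (c m / k1) * (root_sgn h k * exp_part h x k m))%C)).
    2: { intros k. as_C. ring. }
    rewrite !sum_n_Cmult_l.
    set (SE := sum_n (fun k => (root_sgn h k * exp_part h x k m)%C) (2 * h)). set (SD := sum_n (fun k => psi_part h x k m) (2 * h)).
    transitivity (RtoC (/ (PI * k1) * (c m * (PI / (2 * N) - (if Nat.eq_dec h 0 then / (2 * rho h x m) else 0))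
         + s m * (euler_gamma + / N * ln (2 * PI * k1 / x))) - A1 m)
       + RtoC (/ (PI * k1) * c m * ((-1) ^ h * PI / N) - (-1) ^ h / N * (c m / k1)) * SE
       + RtoC (/ (PI * N) * (s m / k1) - / (PI * k1) * s m * / N) * SD)%C.
    { rewrite !RtoC_minus, !RtoC_mult, !RtoC_plus, !RtoC_mult, !RtoC_opp, !RtoC_minus.
      rewrite !RtoC_plus, !RtoC_mult. replace (RtoC (-1)) with (- RtoC 1)%C by (rewrite <- RtoC_opp; reflexivity). ring. }
    replace (/ (PI * k1) * c m * ((-1) ^ h * PI / N) - (-1) ^ h / N * (c m / k1)) with 0 by (field; lra).
    replace (/ (PI * N) * (s m / k1) - / (PI * k1) * s m * / N) with 0 by (field; lra).
    rewrite !Cmult_0_l, !Cplus_0_r. f_equal. unfold A1, v. fold k1.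
    replace (ln (2 * PI * k1 / x)) with (ln (2 * PI / x) + ln k1).
    2: { rewrite <- ln_mult; [f_equal; field; lra| |lra]. apply Rdiv_lt_0_compat; lra. }
    (* For N = 1, rho = 2 pi k/x, so the surviving 1/(2 rho) becomes the term x cos(2 pi k a)/(4
       pi^2 k^2). *)
    destruct (Nat.eq_dec h 0) as [H0|H0].
    - assert (Er : rho h x m = 2 * PI * k1 / x).
      { pose proof (rho_pow h m x Hx) as E. rewrite H0 in E at 2. simpl (2 * 0 + 1)%nat in E. rewrite pow_1 in E. exact E. }
      rewrite Er. assert (EN : N = 1) by (unfold N; rewrite H0; reflexivity). rewrite EN. field. lra.
    - field. lra. }
  assert (Hv : Cser (fun m => RtoC (/ N * v m)) (RtoC T + RtoC (-1) * (RtoC L1 + transform_sum a h x))%C).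
  { apply Cser_ext with (1 := Hsplit). apply Cser_plus; auto. apply Cser_scal. apply Cser_plus; auto. now apply Cser_RtoC. }
  destruct (Cser_RtoC_inv _ _ Hv) as [Hv1 Hv2].
  assert (EK : / N * kummer_series a = Re (RtoC T + RtoC (-1) * (RtoC L1 + transform_sum a h x))%C).
  { rewrite <- (is_series_unique _ _ Hv1), Series_scal_l. reflexivity. }
  rewrite <- EK in Hv2.
  assert (ET : RtoC T = (RtoC (L1 + / N * kummer_series a) + transform_sum a h x)%C).
  { rewrite RtoC_plus, <- Hv2. replace (RtoC (-1)) with (- RtoC 1)%C by (rewrite <- RtoC_opp; reflexivity). ring. }
  replace (Series (lam a h x)) with (T + zeta (N + 1) / x) by (unfold T; ring).
  rewrite RtoC_plus, ET.
  match goal with |- (RtoC ?u + ?w + RtoC ?v)%C = (RtoC ?z + ?w)%C => replace z with (u + v); [rewrite (RtoC_plus u v); ring|] end.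
  unfold L1, kummer. rewrite ln_div by lra. destruct (Nat.eq_dec h 0); field; lra.
Qed.

(** * Kummer's series *)

(** The tangent line at the mean point lies below the exponential at [u] and at [v]. *)
Lemma exp_convex (l u v : R) : 0 <= l <= 1 -> exp (l * u + (1 - l) * v) <= l * exp u + (1 - l) * exp v.
Proof.
  intros Hl. set (w := l * u + (1 - l) * v).
  assert (T : forall z, exp w * (1 + (z - w)) <= exp z).
  { intros z. replace (exp z) with (exp w * exp (z - w)) by (rewrite <- exp_plus; f_equal; ring).
    apply Rmult_le_compat_l; [left; apply exp_pos|apply exp_ineq1_le]. }
  pose proof (T u) as Tu. pose proof (T v) as Tv.
  assert (l * (exp w * (1 + (u - w))) <= l * exp u) by (apply Rmult_le_compat_l; lra).
  assert ((1 - l) * (exp w * (1 + (v - w))) <= (1 - l) * exp v) by (apply Rmult_le_compat_l; lra).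
  replace (exp w) with (l * (exp w * (1 + (u - w))) + (1 - l) * (exp w * (1 + (v - w)))) at 1 by (unfold w; ring).
  lra.
Qed.

(** The partial sum plus ln(1 - u) vanishes at 0 and has derivative -u^(n+1)/(1 - u), so the mean
    value inequality bounds it by a geometric sequence. *)
Lemma is_series_log (q : R) : 0 < q < 1 -> is_series (fun n => q ^ (S n) / INR (S n)) (- ln (1 - q)).
Proof.
  intros Hq. apply is_series_is_lim_seq.
  set (f := fun n u => sum_n (fun k => u ^ (S k) / INR (S k)) n + ln (1 - u)).
  apply is_lim_seq_squeeze_0 with (fun n => (/ (1 - q) * q) * q ^ n).
  2: { apply is_lim_seq_scal_0. apply is_lim_seq_geom. rewrite Rabs_pos_eq; lra. }
  intros n.
  assert (E0 : f n 0 = 0).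
  { unfold f. rewrite Rminus_0_r, ln_1, Rplus_0_r. transitivity (sum_n (fun _ => 0) n); [|apply sum_n_0]. apply sum_n_ext. intros k. as_R. rewrite <- tech_pow_Rmult. unfold Rdiv. ring. }
  replace (sum_n (fun k => q ^ S k / INR (S k)) n - - ln (1 - q)) with (f n q - f n 0) by (rewrite E0; unfold f; ring).
  eapply Rle_trans.
  - apply (MVT_bound (f n) (fun u => - (u ^ (S n) / (1 - u))) 0 q (/ (1 - q) * q ^ n)).
    + intros u Hu. rewrite Rmin_left, Rmax_right in Hu by lra.
      assert (Hg : forall n, sum_n (fun k => u ^ k) n = (1 - u ^ (S n)) / (1 - u)).
      { intros p. induction p; [rewrite sum_O; simpl; as_R; field; lra|]. rewrite sum_n_S, IHp. as_R. simpl. field. lra. }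
      evar_last.
      * unfold f. apply (is_derive_plus (V := R_NormedModule)).
        -- apply (is_derive_sum_n (V := R_NormedModule)) with (d := fun k => u ^ k). intros k _.
           evar_last. auto_derive; auto. pose proof (INR_S_pos k).
           change (match k with 0%nat => 1 | S _ => INR k + 1 end) with (INR (S k)). cbn [Init.Nat.pred]. field. lra.
        -- auto_derive; [lra|reflexivity].
      * rewrite Hg. unfold plus; simpl. field. lra.
    + intros u Hu. rewrite Rmin_left, Rmax_right in Hu by lra.
      assert (0 <= u ^ S n <= q ^ n).
      { split; [apply pow_le; lra|]. simpl. pose proof (pow_incr u q n ltac:(lra)). pose proof (pow_le u n ltac:(lra)). nra. }
      rewrite Rabs_Ropp, Rabs_pos_eq.
      * unfold Rdiv. rewrite Rmult_comm. apply Rmult_le_compat; try lra. left; apply Rinv_0_lt_compat; lra. apply Rinv_le_contravar; lra.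
      * apply Rmult_le_pos; [lra|]. left; apply Rinv_0_lt_compat; lra.
  - rewrite Rminus_0_r, Rabs_pos_eq by lra. right; ring.
Qed.

Lemma exp_pow_nat (y : R) (n : nat) : exp y ^ n = exp (INR n * y).
Proof. rewrite <- Rpower_pow by apply exp_pos. unfold Rpower. now rewrite ln_exp. Qed.

Lemma lam_0 (a x : R) (n : nat) :
  lam a 0 x n = exp (- (a * x)) ^ (S n) * / (INR (S n) * (1 - exp (- x) ^ (S n))).
Proof.
  unfold lam. change (2 * 0 + 1)%nat with 1%nat. rewrite pow_1. unfold Rdiv.
  rewrite !exp_pow_nat. replace (- a * INR (S n) * x) with (INR (S n) * - (a * x)) by ring.
  replace (- INR (S n) * x) with (INR (S n) * - x) by ring. reflexivity.
Qed.

Lemma exp_neg_bounds (y : R) : 0 < y -> 0 < exp (- y) < 1.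
Proof. intros H. split; [apply exp_pos|]. rewrite <- exp_0. apply exp_increasing. lra. Qed.

Lemma lam_den_lower (x : R) (n : nat) : 0 < x -> 1 - exp (- x) <= INR (S n) * (1 - exp (- x) ^ (S n)).
Proof.
  intros Hx. pose proof (exp_neg_bounds x Hx). pose proof (INR_S_ge_1 n).
  assert (exp (- x) ^ S n <= exp (- x)).
  { simpl. pose proof (pow_le (exp (- x)) n ltac:(lra)). pose proof (pow_incr (exp (- x)) 1 n ltac:(lra)). rewrite pow1 in *. nra. }
  nra.
Qed.

Lemma ex_series_lam_0 (a x : R) : 0 < a -> 0 < x -> ex_series (lam a 0 x).
Proof.
  intros Ha Hx. pose proof (exp_neg_bounds x Hx) as Bx.
  assert (Hax : 0 < a * x) by now apply Rmult_lt_0_compat. pose proof (exp_neg_bounds _ Hax) as Bq.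
  apply ex_series_Rabs_le with (fun n => / (1 - exp (- x)) * exp (- (a * x)) ^ n).
  - intros n. rewrite lam_0. pose proof (lam_den_lower x n Hx) as D.
    pose proof (pow_le (exp (- (a * x))) n ltac:(lra)) as P.
    rewrite Rabs_pos_eq.
    + rewrite (Rmult_comm (/ _)). apply Rmult_le_compat; try apply pow_le; try lra.
      * left; apply Rinv_0_lt_compat; lra.
      * simpl. nra.
      * apply Rinv_le_contravar; lra.
    + apply Rmult_le_pos; [apply pow_le; lra|]. left; apply Rinv_0_lt_compat; lra.
  - apply (ex_series_scal (/ (1 - exp (- x))) (fun n => exp (- (a * x)) ^ n)). eexists. apply is_series_geom. rewrite Rabs_pos_eq; lra.
Qed.

Lemma lam_sum_convex (l a b x : R) : 0 < a -> 0 < b -> 0 < x -> 0 <= l <= 1 ->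
  Series (lam (l * a + (1 - l) * b) 0 x) <= l * Series (lam a 0 x) + (1 - l) * Series (lam b 0 x).
Proof.
  intros Ha Hb Hx Hl. rewrite <- !Series_scal_l.
  pose proof (ex_series_lam_0 a x Ha Hx) as Ea. pose proof (ex_series_lam_0 b x Hb Hx) as Eb.
  assert (E1 : ex_series (fun n => l * lam a 0 x n)) by (apply (ex_series_scal l (lam a 0 x)); auto).
  assert (E2 : ex_series (fun n => (1 - l) * lam b 0 x n)) by (apply (ex_series_scal (1 - l) (lam b 0 x)); auto).
  rewrite <- Series_plus by auto.
  apply Series_le; [|now apply (ex_series_plus (V := R_NormedModule))].
  intros n. rewrite !lam_0.
  pose proof (exp_neg_bounds x Hx) as Bx. pose proof (lam_den_lower x n Hx) as D.
  assert (HD : 0 < / (INR (S n) * (1 - exp (- x) ^ S n))) by (apply Rinv_0_lt_compat; lra).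
  split.
  - apply Rmult_le_pos; [|lra]. apply pow_le. left; apply exp_pos.
  - rewrite <- !Rmult_assoc, <- Rmult_plus_distr_r. apply Rmult_le_compat_r; [lra|].
    rewrite !exp_pow_nat.
    replace (INR (S n) * - ((l * a + (1 - l) * b) * x)) with (l * (INR (S n) * - (a * x)) + (1 - l) * (INR (S n) * - (b * x))) by ring.
    now apply exp_convex.
Qed.

(** The difference of the summands carries the factor 1 - exp(-nx), which cancels the denominator
    and leaves q^n/n with q = exp(-ax). *)
Lemma lam_sum_shift (a x : R) : 0 < a -> 0 < x ->
  Series (lam (a + 1) 0 x) = Series (lam a 0 x) + ln (1 - exp (- (a * x))).
Proof.
  intros Ha Hx. assert (Hax : 0 < a * x) by now apply Rmult_lt_0_compat. pose proof (exp_neg_bounds _ Hax) as Bq.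
  pose proof (is_series_log _ Bq) as HL.
  pose proof (Series_correct _ (ex_series_lam_0 (a + 1) x ltac:(lra) Hx)) as H1.
  rewrite (is_series_unique (lam a 0 x) (Series (lam (a + 1) 0 x) + - ln (1 - exp (- (a * x))))); [ring|].
  eapply is_series_ext; [|apply (is_series_plus (V := R_NormedModule)); [exact H1|exact HL]].
  intros n. change (@plus R_NormedModule) with Rplus. as_R. rewrite !lam_0.
  pose proof (lam_den_lower x n Hx) as D. pose proof (exp_neg_bounds x Hx) as Bx. pose proof (INR_S_pos n).
  replace (exp (- ((a + 1) * x))) with (exp (- (a * x)) * exp (- x)) by (rewrite <- exp_plus; f_equal; ring).
  rewrite Rpow_mult_distr. field.
  assert (INR (S n) * (1 - exp (- x) ^ S n) <> 0) by lra.
  repeat split; try lra; intros F; apply H0; rewrite F; ring.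
Qed.

(* [qgam a x] is the logarithm of the q-Gamma function at [q = exp (- x)], up to a term vanishing as [x -> 0]. *)
Definition qgam (a x : R) : R := Series (lam a 0 x) - Series (lam 1 0 x) + (1 - a) * ln x.
Definition qlog (u x : R) : R := ln ((1 - exp (- (u * x))) / x).

Lemma qgam_shift (a x : R) : 0 < a -> 0 < x -> qgam (a + 1) x = qgam a x + qlog a x.
Proof.
  intros Ha Hx. assert (Hax : 0 < a * x) by now apply Rmult_lt_0_compat. pose proof (exp_neg_bounds _ Hax) as Bq.
  unfold qgam, qlog. rewrite lam_sum_shift, ln_div by lra. ring.
Qed.

Lemma qgam_1 (x : R) : qgam 1 x = 0.
Proof. unfold qgam. ring. Qed.

Lemma qgam_convex (l a b x : R) : 0 < a -> 0 < b -> 0 < x -> 0 <= l <= 1 ->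
  qgam (l * a + (1 - l) * b) x <= l * qgam a x + (1 - l) * qgam b x.
Proof.
  intros Ha Hb Hx Hl. pose proof (lam_sum_convex l a b x Ha Hb Hx Hl). unfold qgam.
  replace (1 - (l * a + (1 - l) * b)) with (l * (1 - a) + (1 - l) * (1 - b)) by ring. nra.
Qed.

Lemma qgam_shift_n (a x : R) (n : nat) : 0 < a -> 0 < x ->
  qgam (a + INR (S n)) x = qgam a x + sum_n (fun k => qlog (a + INR k) x) n.
Proof.
  intros Ha Hx. induction n.
  - rewrite sum_O. simpl INR. rewrite Rplus_0_r. now apply qgam_shift.
  - rewrite sum_n_S, (S_INR (S n)), <- Rplus_assoc, qgam_shift, IHn; auto. ring.
    pose proof (pos_INR (S n)). lra.
Qed.

(* Bohr-Mollerup: log-convexity pins [qgam a] down through its values at the integers. *)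
Lemma qgam_sandwich (a x : R) (n : nat) : 0 < a < 1 -> 0 < x ->
  let m := INR (S (S n)) in
  let r := qgam m x + a * qlog m x - sum_n (fun k => qlog (a + INR k) x) (S n) in
  r - a * (qlog m x - qlog (INR (S n)) x) <= qgam a x <= r.
Proof.
  intros Ha Hx m r. pose proof (INR_S_pos n) as Hn.
  assert (Em : m = INR (S n) + 1) by apply S_INR.
  pose proof (qgam_shift_n a x (S n) ltac:(lra) Hx) as E. fold m in E.
  (* Upper bound: a + m lies between m and m + 1. *)
  pose proof (qgam_convex (1 - a) m (m + 1) x ltac:(lra) ltac:(lra) Hx ltac:(lra)) as C1.
  replace ((1 - a) * m + (1 - (1 - a)) * (m + 1)) with (a + m) in C1 by ring.
  rewrite qgam_shift in C1 by lra.
  assert (Hla : 0 <= a / (1 + a) <= 1).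
  { split; [apply Rmult_le_pos; [lra|left; apply Rinv_0_lt_compat; lra]|].
    apply Rmult_le_reg_r with (1 + a); [lra|]. unfold Rdiv. rewrite Rmult_assoc, Rinv_l by lra. lra. }
  (* Lower bound: m lies between m - 1 and a + m, with weights a/(1+a) and 1/(1+a). *)
  pose proof (qgam_convex (a / (1 + a)) (INR (S n)) (a + m) x ltac:(lra) ltac:(lra) Hx Hla) as C2.
  replace (a / (1 + a) * INR (S n) + (1 - a / (1 + a)) * (a + m)) with m in C2 by (rewrite Em; field; lra).
  assert (C3 : (1 + a) * qgam m x <= a * qgam (INR (S n)) x + qgam (a + m) x).
  { apply Rmult_le_compat_l with (r := 1 + a) in C2; [|lra].
    replace ((1 + a) * (a / (1 + a) * qgam (INR (S n)) x + (1 - a / (1 + a)) * qgam (a + m) x))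
      with (a * qgam (INR (S n)) x + qgam (a + m) x) in C2 by (field; lra). exact C2. }
  assert (E2 : qgam m x = qgam (INR (S n)) x + qlog (INR (S n)) x) by (rewrite Em; now apply qgam_shift).
  unfold r. split; nra.
Qed.

(** (1 - exp(-ux))/x plays the role of the q-analogue of [u], so the functional equation of [qgam]
    tends to that of log Gamma. *)
Lemma qlog_lim (u : R) : 0 < u -> is_lim_seq (fun p => qlog u (/ INR (S p))) (ln u).
Proof.
  intros Hu. unfold qlog. apply (is_lim_seq_continuous ln).
  - apply continuity_pt_filterlim, (ex_derive_continuous ln). exists (/ u). now apply is_derive_ln.
  - apply is_lim_seq_squeeze_0 with (fun p => (4 * u ^ 2 * exp u) * / INR (S p)).
    + intros p. pose proof (INR_S_pos p) as Hp. set (x := / INR (S p)).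
      assert (Hx : 0 < x) by now apply Rinv_0_lt_compat.
      assert (Hx1 : x <= 1).
      { unfold x. rewrite <- Rinv_1. apply Rinv_le_contravar; [lra|]. change 1 with (INR 1). apply le_INR; lia. }
      pose proof (Cexp_2_bound (RtoC (- (u * x)))) as B. rewrite Cexp_RtoC, <- !RtoC_minus, !Cmod_R, Rabs_Ropp in B.
      rewrite (Rabs_pos_eq (u * x)) in B by (apply Rmult_le_pos; lra).
      replace ((1 - exp (- (u * x))) / x - u) with (- / x * (exp (- (u * x)) - 1 - - (u * x))) by (field; lra).
      rewrite Rabs_mult, Rabs_Ropp, (Rabs_pos_eq (/ x)) by (left; now apply Rinv_0_lt_compat).
      apply Rle_trans with (/ x * (4 * (u * x) ^ 2 * exp u)).
      * apply Rmult_le_compat_l; [left; now apply Rinv_0_lt_compat|]. apply Rle_trans with (1 := B).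
        apply Rmult_le_compat_l; [pose proof (pow2_ge_0 (u * x)); lra|]. apply exp_le_mono. nra.
      * right. field. lra.
    + apply is_lim_seq_scal_0, is_lim_seq_inv_S.
Qed.

(** * The logarithm of Gamma on the positive axis and Kummer's formula up to a constant *)

Definition ln_Gamma (a : R) : R := ln (Re (CGamma (RtoC a))).
Definition ln_gauss (a : R) (n : nat) : R :=
  ln (INR (fact n)) + a * ln (INR n) - sum_n (fun k => ln (a + INR k)) n.

Lemma not_pole_RtoC (a : R) : 0 < a -> not_pole (RtoC a).
Proof. intros Ha k. rewrite <- RtoC_plus. apply RtoC_neq_0. pose proof (pos_INR k). lra. Qed.

Lemma gauss_RtoC (a : R) (n : nat) : 0 < a -> gauss (RtoC a) n = RtoC (exp (ln_gauss a n)).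
Proof.
  intros Ha. unfold gauss.
  assert (E : Cpochhammer_prod (RtoC a) n = RtoC (exp (sum_n (fun k => ln (a + INR k)) n))).
  { induction n.
    - rewrite sum_O. simpl. rewrite Rplus_0_r, exp_ln; auto.
    - rewrite sum_n_S, exp_plus, RtoC_mult, <- IHn. rewrite exp_ln; [|pose proof (pos_INR (S n)); lra].
      rewrite RtoC_plus. reflexivity. }
  rewrite E, <- RtoC_mult, Cexp_RtoC, <- RtoC_mult, <- RtoC_div by (apply Rgt_not_eq, exp_pos).
  f_equal. unfold ln_gauss, Rminus. rewrite !exp_plus, exp_Ropp, exp_ln; [reflexivity|apply INR_fact_lt_0].
Qed.

(** The Gauss quotients are exponentials of real numbers, so the limit is real and nonnegative;
    [gauss_cv] excludes 0, and the logarithm may be passed to the limit. *)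
Lemma CGamma_real (a : R) : 0 < a ->
  0 < Re (CGamma (RtoC a)) /\ CGamma (RtoC a) = RtoC (Re (CGamma (RtoC a))) /\ is_lim_seq (ln_gauss a) (ln_Gamma a).
Proof.
  intros Ha. destruct (gauss_cv (RtoC a) (not_pole_RtoC a Ha)) as [[H1 H2] HN].
  assert (H1' : is_lim_seq (fun n => exp (ln_gauss a n)) (Re (CGamma (RtoC a)))).
  { apply is_lim_seq_ext with (2 := H1). intros n. now rewrite gauss_RtoC. }
  assert (H2' : Im (CGamma (RtoC a)) = 0).
  { apply is_lim_seq_unique in H2. rewrite (Lim_seq_ext _ (fun _ => 0)), Lim_seq_const in H2.
    - now injection H2.
    - intros n. now rewrite gauss_RtoC. }
  assert (H3 : CGamma (RtoC a) = RtoC (Re (CGamma (RtoC a)))) by (apply C_eq; auto).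
  assert (H4 : 0 <= Re (CGamma (RtoC a))).
  { apply (is_lim_seq_le (fun _ => 0) (fun n => exp (ln_gauss a n)) 0 (Re (CGamma (RtoC a)))); auto.
    - intros n. left; apply exp_pos.
    - apply is_lim_seq_const. }
  assert (H5 : 0 < Re (CGamma (RtoC a))).
  { destruct H4 as [H4|H4]; auto. exfalso. apply HN. rewrite H3, <- H4. reflexivity. }
  split; [|split]; auto. unfold ln_Gamma.
  apply is_lim_seq_ext with (fun n => ln (exp (ln_gauss a n))); [intros n; apply ln_exp|].
  apply (is_lim_seq_continuous ln); auto.
  apply continuity_pt_filterlim, (ex_derive_continuous ln). exists (/ Re (CGamma (RtoC a))). now apply is_derive_ln.
Qed.

Lemma Clog_RtoC (r : R) : 0 < r -> Clog (RtoC r) = RtoC (ln r).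
Proof.
  intros Hr. unfold Clog. rewrite Cmod_R, Rabs_pos_eq by lra. unfold RtoC. f_equal.
  unfold Carg; simpl. destruct (Rlt_dec 0 r); [|lra]. replace (0 / r) with 0 by (unfold Rdiv; ring). apply atan_0.
Qed.

Lemma Clog_CGamma (a : R) : 0 < a -> Clog (CGamma (RtoC a)) = RtoC (ln_Gamma a).
Proof. intros Ha. destruct (CGamma_real a Ha) as [H1 [H2 _]]. rewrite H2. now apply Clog_RtoC. Qed.

Lemma is_lim_seq_sum_n (f : nat -> nat -> R) (g : nat -> R) (M : nat) :
  (forall n, is_lim_seq (fun p => f p n) (g n)) -> is_lim_seq (fun p => sum_n (f p) M) (sum_n g M).
Proof.
  intros H. induction M.
  - rewrite sum_O. apply is_lim_seq_ext with (fun p => f p 0%nat); auto. intros; now rewrite sum_O.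
  - rewrite sum_n_S. apply is_lim_seq_ext with (fun p => sum_n (f p) M + f p (S M)).
    + intros; now rewrite sum_n_S.
    + now apply is_lim_seq_plus'.
Qed.

Lemma sum_ln_fact (n : nat) : sum_n (fun k => ln (1 + INR k)) n = ln (INR (fact (S n))).
Proof.
  induction n.
  - rewrite sum_O. simpl. f_equal. ring.
  - rewrite sum_n_S, IHn. change (fact (S (S n))) with ((S (S n)) * fact (S n))%nat.
    rewrite mult_INR, ln_mult; [|apply INR_S_pos|apply INR_fact_lt_0].
    rewrite (S_INR (S n)). rewrite (Rplus_comm 1). apply Rplus_comm.
Qed.

(** Two limits in a fixed order: [n] is chosen first, so that [ln_gauss] is near its limit and the
    width of the sandwich, at most 1/(n+1) in the limit, is small; then x tends to 0 in finitely
    many terms. *)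
Lemma qgam_lim (a : R) : 0 < a < 1 -> is_lim_seq (fun p => qgam a (/ INR (S p))) (ln_Gamma a).
Proof.
  intros Ha. apply is_lim_seq_spec. intros eps.
  assert (He : 0 < eps / 6) by (pose proof (cond_pos eps); lra).
  set (e := mkposreal _ He).
  destruct (CGamma_real a (proj1 Ha)) as [_ [_ HG]].
  apply (is_lim_seq_incr_1 (ln_gauss a)) in HG. apply is_lim_seq_spec in HG. destruct (HG e) as [n1 Hn1].
  pose proof is_lim_seq_inv_S as HI. apply is_lim_seq_spec in HI. destruct (HI e) as [n2 Hn2].
  set (n := Nat.max n1 n2).
  specialize (Hn1 n (Nat.le_max_l _ _)). specialize (Hn2 n (Nat.le_max_r _ _)). change (pos e) with (eps / 6) in Hn1, Hn2.
  set (m := INR (S (S n))). pose proof (INR_S_pos n) as Hn. assert (Em : m = INR (S n) + 1) by apply S_INR.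
  set (r := fun x => qgam m x + a * qlog m x - sum_n (fun k => qlog (a + INR k) x) (S n)).
  assert (Lr : is_lim_seq (fun p => r (/ INR (S p))) (ln (INR (fact (S n))) + a * ln m - sum_n (fun k => ln (a + INR k)) (S n))).
  { apply is_lim_seq_minus'; [apply is_lim_seq_plus'|].
    - apply is_lim_seq_ext with (fun p => sum_n (fun k => qlog (1 + INR k) (/ INR (S p))) n).
      + intros p. pose proof (qgam_shift_n 1 (/ INR (S p)) n ltac:(lra) ltac:(apply Rinv_0_lt_compat, INR_S_pos)) as E.
        rewrite qgam_1, Rplus_0_l in E. rewrite <- E. f_equal. unfold m. rewrite (S_INR (S n)). ring.
      + rewrite <- sum_ln_fact. apply (is_lim_seq_sum_n (fun p k => qlog (1 + INR k) (/ INR (S p))) (fun k => ln (1 + INR k)) n).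
        intros k. apply qlog_lim. pose proof (pos_INR k). lra.
    - apply is_lim_seq_mult'; [apply is_lim_seq_const|]. apply qlog_lim. lra.
    - apply (is_lim_seq_sum_n (fun p k => qlog (a + INR k) (/ INR (S p))) (fun k => ln (a + INR k))).
      intros k. apply qlog_lim. pose proof (pos_INR k). lra. }
  assert (Ld : is_lim_seq (fun p => a * (qlog m (/ INR (S p)) - qlog (INR (S n)) (/ INR (S p)))) (a * (ln m - ln (INR (S n))))).
  { apply is_lim_seq_mult'; [apply is_lim_seq_const|]. apply is_lim_seq_minus'; apply qlog_lim; lra. }
  apply is_lim_seq_spec in Lr. apply is_lim_seq_spec in Ld.
  destruct (Lr e) as [p1 Hp1]. destruct (Ld e) as [p2 Hp2]. exists (Nat.max p1 p2). intros p Hp.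
  specialize (Hp1 p ltac:(lia)). specialize (Hp2 p ltac:(lia)). change (pos e) with (eps / 6) in Hp1, Hp2.
  pose proof (qgam_sandwich a (/ INR (S p)) n Ha ltac:(apply Rinv_0_lt_compat, INR_S_pos)) as HS.
  cbv zeta in HS. fold m in HS. change (qgam m (/ INR (S p)) + a * qlog m (/ INR (S p)) - sum_n (fun k => qlog (a + INR k) (/ INR (S p))) (S n)) with (r (/ INR (S p))) in HS.
  pose proof (ln_step_bounds (INR (S n)) Hn) as [B1 B2]. rewrite <- Em in B1, B2.
  change (ln_gauss a (S n)) with (ln (INR (fact (S n))) + a * ln (INR (S n)) - sum_n (fun k => ln (a + INR k)) (S n)) in Hn1.
  assert (0 < / m) by (apply Rinv_0_lt_compat; lra).
  assert (Hd : 0 <= a * (ln m - ln (INR (S n))) <= / INR (S n)).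
  { split; [apply Rmult_le_pos; lra|]. apply Rle_trans with (1 * (ln m - ln (INR (S n)))); [apply Rmult_le_compat_r; lra|lra]. }
  rewrite Rminus_0_r in Hn2.
  apply Rabs_def2 in Hp1. apply Rabs_def2 in Hp2. apply Rabs_def2 in Hn1. apply Rabs_def2 in Hn2.
  apply Rabs_def1; lra.
Qed.

(** For N = 1 the only root is real and 1/rho = x/(2 pi (m+1)), so both parts are O(x/(m+1)) and the
    weighted series are O(x). *)
Lemma transform_sum_lim (a : R) : is_lim_seq (fun p => Re (transform_sum a 0 (/ INR (S p)))) 0.
Proof.
  pose proof PI_RGT_0 as HPI. pose proof PI2_1 as HPI1.
  set (Z := Series (fun m => / INR (S m) ^ 2)).
  pose proof Series_inv_S_sq_nonneg as HZ. fold Z in HZ.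
  apply is_lim_seq_squeeze_0 with (fun p => (5 * PI * Z) * / INR (S p)).
  2: apply is_lim_seq_scal_0, is_lim_seq_inv_S.
  intros p. rewrite Rminus_0_r. set (x := / INR (S p)).
  assert (Hx : 0 < x) by apply Rinv_0_lt_compat, INR_S_pos.
  assert (Hx1 : x <= 1).
  { unfold x. rewrite <- Rinv_1. apply Rinv_le_contravar; [lra|]. change 1 with (INR 1). apply le_INR; lia. }
  assert (Harg : root_arg 0 0 = 0) by (unfold root_arg; simpl; unfold Rdiv; ring).
  assert (Hrho : forall m, / rho 0 x m <= x * / INR (S m) /\ 0 < / rho 0 x m <= 1).
  { intros m. pose proof (rho_pow 0 m x Hx) as E. simpl (2 * 0 + 1)%nat in E. rewrite pow_1 in E.
    pose proof (rho_pos 0 m x) as Hr. rewrite E in Hr. rewrite E. pose proof (INR_S_pos m) as Hm.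
    pose proof (INR_S_ge_1 m).
    assert (Hm1 : / INR (S m) <= 1) by (rewrite <- Rinv_1; apply Rinv_le_contravar; lra).
    assert (L : / (2 * PI * INR (S m) / x) <= x * / INR (S m)).
    { replace (/ (2 * PI * INR (S m) / x)) with (/ (2 * PI) * (x * / INR (S m))) by (field; lra).
      assert (0 < x * / INR (S m)) by (apply Rmult_lt_0_compat; auto; now apply Rinv_0_lt_compat).
      assert (/ (2 * PI) <= 1) by (rewrite <- Rinv_1; apply Rinv_le_contravar; lra). nra. }
    split; auto. split; [now apply Rinv_0_lt_compat|]. pose proof (Rinv_0_lt_compat _ Hm). nra. }
  assert (HV : forall K : R, ex_series (fun m => K * x * / INR (S m) ^ 2)).
  { intros K. apply (ex_series_scal (K * x) (fun m => / INR (S m) ^ 2)), ex_series_inv_S_sq. }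
  assert (Hco : forall c m, Rabs c <= 1 -> Rabs (c / INR (S m)) <= / INR (S m)).
  { intros c m Hc. pose proof (Rinv_0_lt_compat _ (INR_S_pos m)). unfold Rdiv. rewrite Rabs_mult, (Rabs_pos_eq (/ _)) by lra. nra. }
  assert (Bs : forall K c (f : nat -> C), (forall m, Rabs (c m) <= 1) -> (forall m, Cmod (f m) <= K * / rho 0 x m) -> 0 <= K ->
    Cser (fun m => RtoC (c m / INR (S m)) * f m)%C (CSeries (fun m => RtoC (c m / INR (S m)) * f m)%C) ->
    Cmod (CSeries (fun m => RtoC (c m / INR (S m)) * f m)%C) <= K * Z * x).
  { intros K c f Hc Hf HK Hs. eapply Rle_trans; [apply (Cmod_Cser_le (fun m => RtoC (c m / INR (S m)) * f m)%C (fun m => K * x * / INR (S m) ^ 2)); [|apply HV|exact Hs]|].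
    - intros m. rewrite Cmod_mult, Cmod_R. destruct (Hrho m) as [R1 R2].
      replace (K * x * / INR (S m) ^ 2) with (/ INR (S m) * (K * (x * / INR (S m)))) by (pose proof (INR_S_pos m); field; lra).
      apply Rmult_le_compat; auto using Rabs_pos, Cmod_ge_0. apply Rle_trans with (1 := Hf m). apply Rmult_le_compat_l; auto.
    - rewrite Series_scal_l. fold Z. right; ring. }
  assert (B1 : Cmod (exp_sum a 0 x 0) <= 1 * Z * x).
  { apply Bs; try lra.
    - intros m; apply Rabs_cos_le_1.
    - intros m. eapply Rle_trans; [apply exp_part_bound; lia|]. rewrite Harg, cos_0.
      apply Rmult_le_compat_r; [left; apply Hrho|]. rewrite <- Rinv_1. apply Rinv_le_contravar; lra.
    - apply (part_series_correct 0 0 x (fun m => cos (2 * PI * INR (S m) * a))); auto. intros m; apply Rabs_cos_le_1. }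
  assert (B2 : Cmod (psi_sum a 0 x 0) <= (4 * PI) * Z * x).
  { apply Bs; try lra.
    - intros m; apply Rabs_sin_le_1.
    - intros m. eapply Rle_trans; [apply psi_part_bound; lia|]. rewrite Harg, cos_0. destruct (Hrho m) as [R1 R2].
      pose proof (rho_pos 0 m x) as Hr.
      replace (2 / 1 ^ 2 * (/ rho 0 x m ^ 2 + PI / (2 * rho 0 x m))) with ((2 * / rho 0 x m + PI) * / rho 0 x m) by (field; lra).
      apply Rmult_le_compat_r; lra.
    - apply (part_series_correct 0 0 x (fun m => sin (2 * PI * INR (S m) * a))); auto. intros m; apply Rabs_sin_le_1. }
  eapply Rle_trans; [apply re_le_Cmod|]. unfold transform_sum. change (2 * 0)%nat with 0%nat. rewrite !sum_O.
  unfold root_sgn. simpl (0 + 0)%nat. rewrite !pow_O. change (INR (0 + 1)) with 1.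
  replace (RtoC (1 / 1) * (RtoC 1 * exp_sum a 0 x 0) - RtoC (/ (PI * 1)) * psi_sum a 0 x 0)%C
    with (exp_sum a 0 x 0 + - (RtoC (/ PI) * psi_sum a 0 x 0))%C.
  2: { rewrite Rmult_1_r. replace (1 / 1) with 1 by field. ring. }
  eapply Rle_trans; [apply Cmod_triangle|]. rewrite Cmod_opp, Cmod_mult, Cmod_R.
  assert (HiP : 0 < / PI) by (apply Rinv_0_lt_compat; lra). rewrite Rabs_pos_eq by lra.
  assert (/ PI * Cmod (psi_sum a 0 x 0) <= 4 * Z * x).
  { replace (4 * Z * x) with (/ PI * (4 * PI * Z * x)) by (field; lra). apply Rmult_le_compat_l; lra. }
  assert (0 <= Z * x) by (apply Rmult_le_pos; lra).
  replace (5 * PI * Z * x) with (5 * PI * (Z * x)) by ring. nra.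
Qed.

(** [transform_open] at N = 1, where gamma has the coefficient N - 1 = 0: beyond the terms moved to
    the left only [kummer a] does not vanish with x. *)
Lemma lam_0_lim (a : R) : 0 < a < 1 ->
  is_lim_seq (fun p => Series (lam a 0 (/ INR (S p))) - zeta (INR 1 + 1) / (/ INR (S p)) + (1 / 2 - a) * ln (/ INR (S p))) (kummer a).
Proof.
  intros Ha.
  apply is_lim_seq_ext with (fun p => kummer a - (cos_series2 a / (4 * PI ^ 2)) * / INR (S p) + Re (transform_sum a 0 (/ INR (S p)))).
  - intros p. assert (Hx : 0 < / INR (S p)) by apply Rinv_0_lt_compat, INR_S_pos.
    pose proof (transform_open a _ 0 Ha Hx) as E. apply (f_equal Re) in E.
    change (Re (RtoC (Series (lam a 0 (/ INR (S p)))))) with (Series (lam a 0 (/ INR (S p)))) in E. rewrite E.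
    change (2 * 0 + 1)%nat with 1%nat. destruct (Nat.eq_dec 0 0); [|lia].
    set (x := / INR (S p)) in *. set (t := transform_sum a 0 x).
    change (INR 1) with 1. 
    match goal with |- _ = Re (RtoC ?z + t)%C - _ + _ => change (Re (RtoC z + t)%C) with (z + Re t) end.
    rewrite Rinv_1. unfold Rdiv. ring.
  - replace (Finite (kummer a)) with (Finite (kummer a - 0 + 0)) by (f_equal; ring).
    apply is_lim_seq_plus'; [apply is_lim_seq_minus'|apply transform_sum_lim].
    + apply is_lim_seq_const.
    + apply is_lim_seq_scal_0, is_lim_seq_inv_S.
Qed.

(** The reference point 1/2 is arbitrary; the difference does not depend on it. *)
Definition kummer_const : R := kummer (1 / 2) - ln_Gamma (1 / 2).

(** Subtracting the limits of [lam_0_lim] and [qgam_lim] removes everything that depends on the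
    argument except the two functions themselves: their difference is the limit of an expression at
    a = 1. *)
Lemma kummer_eq (a : R) : 0 < a < 1 -> kummer a = ln_Gamma a + kummer_const.
Proof.
  assert (H : forall b, 0 < b < 1 -> is_lim_seq (fun p => Series (lam 1 0 (/ INR (S p))) - zeta (INR 1 + 1) / (/ INR (S p)) - 1 / 2 * ln (/ INR (S p))) (kummer b - ln_Gamma b)).
  { intros b Hb. apply is_lim_seq_ext with (2 := is_lim_seq_minus' _ _ _ _ (lam_0_lim b Hb) (qgam_lim b Hb)).
    intros p. unfold qgam. field. apply Rgt_not_eq, INR_S_pos. }
  intros Ha. pose proof (H a Ha) as H1. pose proof (H (1 / 2) ltac:(lra)) as H2.
  apply is_lim_seq_unique in H1, H2. rewrite H1 in H2. injection H2 as H2. unfold kummer_const. lra.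
Qed.

(** Convexity passed to the limit: 1 lies between [a] and 2, and [a] lies between 1/2 and 1, with
    [qgam] vanishing at 1 and tending to 0 at 2. It gives continuity of log Gamma from the left at
    1. *)
Lemma ln_Gamma_near_1 (a : R) : 1 / 2 <= a < 1 -> 0 <= ln_Gamma a <= 2 * (1 - a) * ln_Gamma (1 / 2).
Proof.
  intros Ha. assert (Hx : forall p, 0 < / INR (S p)) by (intros p; apply Rinv_0_lt_compat, INR_S_pos).
  pose proof (qgam_lim a ltac:(lra)) as La. pose proof (qgam_lim (1 / 2) ltac:(lra)) as Lh.
  split.
  - set (l := / (2 - a)). assert (Hl0 : 0 < l) by (apply Rinv_0_lt_compat; lra).
    assert (Hl : 0 <= l <= 1) by (split; [lra|]; unfold l; rewrite <- Rinv_1; apply Rinv_le_contravar; lra).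
    assert (H : 0 <= l * ln_Gamma a + (1 - l) * ln 1).
    { apply (is_lim_seq_le (fun _ => 0) (fun p => l * qgam a (/ INR (S p)) + (1 - l) * qlog 1 (/ INR (S p))) 0 (l * ln_Gamma a + (1 - l) * ln 1)).
      - intros p. pose proof (qgam_convex l a 2 (/ INR (S p)) ltac:(lra) ltac:(lra) (Hx p) Hl) as C.
        replace (l * a + (1 - l) * 2) with 1 in C by (unfold l; field; lra). rewrite qgam_1 in C.
        replace 2 with (1 + 1) in C by ring. rewrite qgam_shift, qgam_1, Rplus_0_l in C by (auto; lra). exact C.
      - apply is_lim_seq_const.
      - apply is_lim_seq_plus'; apply is_lim_seq_mult'; auto; try apply is_lim_seq_const. apply qlog_lim; lra. }
    rewrite ln_1 in H. nra.
  - apply (is_lim_seq_le (fun p => qgam a (/ INR (S p))) (fun p => 2 * (1 - a) * qgam (1 / 2) (/ INR (S p))) (ln_Gamma a) (2 * (1 - a) * ln_Gamma (1 / 2))); auto.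
    + intros p. pose proof (qgam_convex (2 * (1 - a)) (1 / 2) 1 (/ INR (S p)) ltac:(lra) ltac:(lra) (Hx p) ltac:(lra)) as C.
      replace (2 * (1 - a) * (1 / 2) + (1 - 2 * (1 - a)) * 1) with a in C by field. rewrite qgam_1 in C. lra.
    + apply is_lim_seq_mult'; auto. apply is_lim_seq_const.
Qed.

(** * The endpoint a = 1 and the constant *)

Lemma ln_Gamma_1 : ln_Gamma 1 = 0.
Proof.
  destruct (CGamma_real 1 ltac:(lra)) as [_ [_ H]].
  assert (H2 : is_lim_seq (ln_gauss 1) 0).
  { apply is_lim_seq_incr_1. apply is_lim_seq_squeeze_0 with (2 := is_lim_seq_inv_S). intros n.
    unfold ln_gauss. rewrite sum_ln_fact. change (fact (S (S n))) with ((S (S n)) * fact (S n))%nat.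
    rewrite mult_INR, ln_mult; [|apply INR_S_pos|apply INR_fact_lt_0].
    pose proof (INR_S_pos n) as Hn. pose proof (ln_step_bounds _ Hn) as B. rewrite <- S_INR in B.
    pose proof (Rinv_0_lt_compat _ (INR_S_pos (S n))).
    apply Rabs_le. lra. }
  apply is_lim_seq_unique in H, H2. rewrite H in H2. now injection H2.
Qed.

Section EndpointLimit.
Variables (b : nat -> R) (a : R).
Hypothesis Hb : is_lim_seq b a.

Lemma cos_lim (k : R) : is_lim_seq (fun p => cos (k * b p)) (cos (k * a)).
Proof.
  apply (is_lim_seq_continuous cos); [apply continuity_cos|]. apply is_lim_seq_mult'; auto. apply is_lim_seq_const.
Qed.

Lemma sin_lim (k : R) : is_lim_seq (fun p => sin (k * b p)) (sin (k * a)).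
Proof.
  apply (is_lim_seq_continuous sin); [apply continuity_sin|]. apply is_lim_seq_mult'; auto. apply is_lim_seq_const.
Qed.

Lemma cos_series2_lim : is_lim_seq (fun p => cos_series2 (b p)) (cos_series2 a).
Proof.
  unfold cos_series2. apply (tannery (fun p m => cos (2 * PI * INR (S m) * b p) * / INR (S m) ^ 2)
    (fun m => cos (2 * PI * INR (S m) * a) * / INR (S m) ^ 2) (fun m => / INR (S m) ^ 2)).
  - intros p m. assert (H : 0 < / INR (S m) ^ 2) by apply inv_S_pow_pos.
    rewrite Rabs_mult, (Rabs_pos_eq (/ _)) by lra. pose proof (Rabs_cos_le_1 (2 * PI * INR (S m) * b p)). nra.
  - apply ex_series_inv_S_sq.
  - intros m. apply is_lim_seq_mult'; [apply cos_lim|apply is_lim_seq_const].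
Qed.

Lemma trig_part_lim (h k : nat) (x : R) (c : nat -> nat -> R) (c' : nat -> R) (f : nat -> C) (K : R) :
  (forall p m, Rabs (c p m) <= 1) -> (forall m, is_lim_seq (fun p => c p m) (c' m)) ->
  (forall m, Cmod (f m) <= K * Rpower (INR (S m)) (- / INR (2 * h + 1))) ->
  Ccv (fun p => CSeries (fun m => RtoC (c p m / INR (S m)) * f m)%C) (CSeries (fun m => RtoC (c' m / INR (S m)) * f m)%C).
Proof.
  intros Hc Hl Hf.
  apply (Ctannery (fun p m => RtoC (c p m / INR (S m)) * f m)%C (fun m => RtoC (c' m / INR (S m)) * f m)%C
    (fun m => K * (/ INR (S m) * Rpower (INR (S m)) (- / INR (2 * h + 1))))).
  - intros p m. rewrite Cmod_mult, Cmod_R. pose proof (Rinv_0_lt_compat _ (INR_S_pos m)).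
    replace (K * (/ INR (S m) * Rpower (INR (S m)) (- / INR (2 * h + 1)))) with (/ INR (S m) * (K * Rpower (INR (S m)) (- / INR (2 * h + 1)))) by ring.
    apply Rmult_le_compat; auto using Rabs_pos, Cmod_ge_0.
    unfold Rdiv. rewrite Rabs_mult, (Rabs_pos_eq (/ _)) by lra. specialize (Hc p m). nra.
  - apply (ex_series_scal K (fun m => / INR (S m) * Rpower (INR (S m)) (- / INR (2 * h + 1)))).
    apply ex_series_inv_Rpower. apply Rinv_0_lt_compat, INR_odd_pos.
  - intros m. apply Ccv_mult; [|apply Ccv_const]. apply Ccv_RtoC. apply is_lim_seq_mult'; auto. apply is_lim_seq_const.
Qed.

Lemma transform_sum_cont (h : nat) (x : R) : 0 < x -> Ccv (fun p => transform_sum (b p) h x) (transform_sum a h x).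
Proof.
  intros Hx. unfold transform_sum. apply Ccv_minus; (apply Ccv_mult; [apply Ccv_const|]).
  - apply (Ccv_sum_n (fun k p => root_sgn h k * exp_sum (b p) h x k)%C). intros k Hk.
    apply Ccv_mult; [apply Ccv_const|]. destruct (part_majorant h k x Hx Hk) as [K HK].
    apply (trig_part_lim h k x (fun p m => cos (2 * PI * INR (S m) * b p)) (fun m => cos (2 * PI * INR (S m) * a)) (exp_part h x k) K).
    + intros; apply Rabs_cos_le_1.
    + intros; apply cos_lim.
    + intros; apply HK.
  - apply (Ccv_sum_n (fun k p => psi_sum (b p) h x k)). intros k Hk.
    destruct (part_majorant h k x Hx Hk) as [K HK].
    apply (trig_part_lim h k x (fun p m => sin (2 * PI * INR (S m) * b p)) (fun m => sin (2 * PI * INR (S m) * a)) (psi_part h x k) K).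
    + intros; apply Rabs_sin_le_1.
    + intros; apply sin_lim.
    + intros; apply HK.
Qed.

(** The summands decrease in [a], so those at a = 1/2 dominate; their summability is part of
    [lam_swap]. *)
Lemma lam_lim (h : nat) (x : R) : 0 < x -> (forall p, 1 / 2 <= b p) ->
  is_lim_seq (fun p => Series (lam (b p) h x)) (Series (lam a h x)).
Proof.
  intros Hx Hb2. apply (tannery (fun p => lam (b p) h x) (lam a h x) (lam (1 / 2) h x)).
  - intros p n. unfold lam. pose proof (INR_S_pos n) as Hn.
    assert (Ht : 0 < INR (S n) ^ (2 * h + 1) * x) by (apply Rmult_lt_0_compat; auto; apply pow_lt; auto).
    assert (Hd : 0 < INR (S n) * (1 - exp (- INR (S n) ^ (2 * h + 1) * x))).
    { apply Rmult_lt_0_compat; auto. pose proof (exp_neg_bounds _ Ht) as E.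
      replace (- INR (S n) ^ (2 * h + 1) * x) with (- (INR (S n) ^ (2 * h + 1) * x)) by ring. lra. }
    unfold Rdiv. rewrite Rabs_pos_eq by (apply Rmult_le_pos; [left; apply exp_pos|left; now apply Rinv_0_lt_compat]).
    apply Rmult_le_compat_r; [left; now apply Rinv_0_lt_compat|]. apply exp_le_mono.
    specialize (Hb2 p). rewrite !Rmult_assoc. apply Rmult_le_compat_r; lra.
  - destruct (lam_swap (1 / 2) x h) as [_ E]; auto; [lra|]. intros m.
    eexists. apply (Cser_RtoC_inv _ _ (column_series (1 / 2) x h m Hx)).
  - intros n. unfold lam. apply is_lim_seq_mult'; [|apply is_lim_seq_const].
    apply (is_lim_seq_continuous exp); [apply derivable_continuous, derivable_exp|].
    apply is_lim_seq_mult'; [|apply is_lim_seq_const]. apply is_lim_seq_mult'; [|apply is_lim_seq_const].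
    apply is_lim_seq_opp in Hb. exact Hb.
Qed.
End EndpointLimit.

(** The elementary part of the right-hand side. The constant of Kummer's formula is a parameter
    because its value is read off from an instance of the transformation itself. *)
Definition transform_main (c a : R) (h : nat) (x : R) : R :=
  zeta (INR (2 * h + 1) + 1) / x
     + / INR (2 * h + 1) * ((ln_Gamma a + c) + (1 / 2 - a) * ((INR (2 * h + 1) - 1) * euler_gamma - ln x))
     - (if Nat.eq_dec h 0 then x / (4 * PI ^ 2) else 0) * cos_series2 a.

(** [kummer] contains a cosine series that diverges at a = 1. Once it is replaced by log Gamma plus
    a constant, every term is continuous from the left there. *)
Lemma transform_closed (a x : R) (h : nat) : 0 < a <= 1 -> 0 < x ->
  RtoC (Series (lam a h x)) = (RtoC (transform_main kummer_const a h x) + transform_sum a h x)%C.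
Proof.
  intros Ha Hx.
  assert (Hopen : forall b, 0 < b < 1 -> RtoC (Series (lam b h x)) = (RtoC (transform_main kummer_const b h x) + transform_sum b h x)%C).
  { intros b Hb. rewrite transform_open, kummer_eq by auto. unfold transform_main.
    destruct (Nat.eq_dec h 0); [reflexivity|]. now rewrite Rmult_0_l. }
  destruct (Req_dec a 1) as [->|Hn]; [|apply Hopen; lra].
  set (b := fun p => 1 - / INR (S (S p))).
  assert (Hb1 : forall p, 1 / 2 <= b p < 1).
  { intros p. unfold b. pose proof (Rinv_0_lt_compat _ (INR_S_pos (S p))). split; [|lra].
    assert (/ INR (S (S p)) <= / 2); [|lra]. apply Rinv_le_contravar; [lra|]. change 2 with (INR 2). apply le_INR; lia. }
  assert (L0 : is_lim_seq (fun n => / INR (S (S n))) 0).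
  { apply (is_lim_seq_incr_1 (fun n => / INR (S n))). apply is_lim_seq_inv_S. }
  assert (Hb : is_lim_seq b 1).
  { replace (Finite 1) with (Finite (1 - 0)) by (f_equal; ring). apply is_lim_seq_minus'; auto. apply is_lim_seq_const. }
  apply Ccv_unique with (fun p => RtoC (Series (lam (b p) h x))).
  - apply Ccv_RtoC. apply lam_lim; auto. apply Hb1.
  - apply Ccv_ext with (fun p => (RtoC (transform_main kummer_const (b p) h x) + transform_sum (b p) h x)%C).
    + intros p. symmetry. apply Hopen. specialize (Hb1 p). lra.
    + apply Ccv_plus; [apply Ccv_RtoC|now apply transform_sum_cont].
      assert (LG : is_lim_seq (fun p => ln_Gamma (b p)) (ln_Gamma 1)).
      { rewrite ln_Gamma_1. apply is_lim_seq_squeeze_0 with (fun p => (2 * ln_Gamma (1 / 2)) * / INR (S (S p))); [|now apply is_lim_seq_scal_0].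
        intros p. pose proof (ln_Gamma_near_1 (b p) (Hb1 p)) as B. rewrite Rminus_0_r, Rabs_pos_eq by lra.
        replace (2 * (1 - b p) * ln_Gamma (1 / 2)) with (2 * ln_Gamma (1 / 2) * / INR (S (S p))) in B by (unfold b; ring). lra. }
      unfold transform_main. apply is_lim_seq_minus'; [apply is_lim_seq_plus'|].
      * apply is_lim_seq_const.
      * apply is_lim_seq_mult'; [apply is_lim_seq_const|]. apply is_lim_seq_plus'.
        -- apply is_lim_seq_plus'; auto. apply is_lim_seq_const.
        -- apply is_lim_seq_mult'; [|apply is_lim_seq_const]. apply is_lim_seq_minus'; auto. apply is_lim_seq_const.
      * apply is_lim_seq_mult'; [apply is_lim_seq_const|]. now apply cos_series2_lim.
Qed.

Lemma sin_2PI_nat (n : nat) : sin (2 * PI * INR n * 1) = 0.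
Proof. apply sin_eq_0_1. exists (2 * Z.of_nat n)%Z. rewrite mult_IZR, <- INR_IZR_INZ. ring. Qed.

Lemma cos_2PI_nat (n : nat) : cos (2 * PI * INR n * 1) = 1.
Proof. replace (2 * PI * INR n * 1) with (0 + 2 * INR n * PI) by ring. rewrite cos_period. apply cos_0. Qed.

Lemma zeta_2 : cos_series2 1 = zeta (INR 1 + 1).
Proof.
  unfold cos_series2. rewrite <- (is_series_unique _ _ (zeta_pow 0)). apply Series_ext. intros n.
  rewrite cos_2PI_nat. ring.
Qed.

(* The case [a = 1], [N = 1] is self-dual under [x -> 4 pi^2 / x]; its fixed point gives the constant. *)
Lemma kummer_const_value : kummer_const = - (1 / 2 * ln (2 * PI)).
Proof.
  pose proof PI_RGT_0 as HPI. assert (Hx : 0 < 2 * PI) by lra.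
  pose proof (transform_closed 1 (2 * PI) 0 ltac:(lra) Hx) as E.
  assert (ET : transform_sum 1 0 (2 * PI) = RtoC (Series (lam 1 0 (2 * PI)))).
  { unfold transform_sum. change (2 * 0)%nat with 0%nat. rewrite !sum_O.
    assert (E1 : psi_sum 1 0 (2 * PI) 0 = 0).
    { apply Cser_CSeries. apply Cser_ext with (fun _ => RtoC 0).
      - intros m. rewrite sin_2PI_nat. unfold Rdiv. rewrite Rmult_0_l. ring.
      - apply Cser_RtoC. now apply is_series_0. }
    assert (E2 : exp_sum 1 0 (2 * PI) 0 = RtoC (Series (lam 1 0 (2 * PI)))).
    { apply Cser_CSeries. apply Cser_ext with (fun m => RtoC (lam 1 0 (2 * PI) m)).
      2: { apply Cser_RtoC, Series_correct. apply ex_series_lam_0; lra. }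
      intros m. rewrite cos_2PI_nat. unfold exp_part, root_w.
      assert (Er : rho 0 (2 * PI) m = INR (S m)).
      { pose proof (rho_pow 0 m (2 * PI) Hx) as Er. simpl (2 * 0 + 1)%nat in Er. rewrite pow_1 in Er. rewrite Er. field. lra. }
      rewrite Er, cpolar_cis.
      replace (root_arg 0 0) with 0 by (unfold root_arg; simpl; unfold Rdiv; ring).
      rewrite cis_0, Cmult_1_r, <- !RtoC_mult, Cexp_RtoC, <- RtoC_minus.
      pose proof (INR_S_pos m) as Hm. assert (Hp : 0 < 2 * PI * INR (S m)) by now apply Rmult_lt_0_compat.
      assert (He : 1 < exp (2 * PI * INR (S m))) by (rewrite <- exp_0; apply exp_increasing; auto).
      rewrite <- RtoC_inv, <- RtoC_mult by lra. f_equal. unfold lam. change (2 * 0 + 1)%nat with 1%nat. rewrite pow_1.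
      replace (- (1) * INR (S m) * (2 * PI)) with (- (2 * PI * INR (S m))) by ring.
      replace (- INR (S m) * (2 * PI)) with (- (2 * PI * INR (S m))) by ring.
      rewrite exp_Ropp. field. lra. }
    rewrite E1, E2. unfold root_sgn. simpl (0 + 0)%nat. rewrite pow_O. change (INR 1) with 1.
    change (INR (0 + 1)) with 1. replace (1 / 1) with 1 by field. ring. }
  rewrite ET in E. apply (f_equal Re) in E.
  change (Series (lam 1 0 (2 * PI)) = transform_main kummer_const 1 0 (2 * PI) + Series (lam 1 0 (2 * PI))) in E.
  assert (E0 : transform_main kummer_const 1 0 (2 * PI) = 0) by lra.
  (* At x = 2 pi the terms zeta(2)/x and x zeta(2)/(4 pi^2) cancel, which leaves only the constant
     and ln(2 pi)/2. *)
  unfold transform_main in E0. rewrite ln_Gamma_1, zeta_2 in E0. destruct (Nat.eq_dec 0 0); [|lia].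
  change (INR (2 * 0 + 1)) with 1 in E0. change (INR 1) with 1 in E0.
  replace (zeta (1 + 1) / (2 * PI) + / 1 * (0 + kummer_const + (1 / 2 - 1) * ((1 - 1) * euler_gamma - ln (2 * PI))) -
    2 * PI / (4 * PI ^ 2) * zeta (1 + 1)) with (kummer_const + 1 / 2 * ln (2 * PI)) in E0 by (field; lra).
  lra.
Qed.

(** * Bernoulli polynomials *)

(** The Fourier term of B_j(a)/j! for j = i + 2; from j = 2 on the series converges absolutely. *)
Definition bern_term (a : R) (m i : nat) : R :=
  - 2 * cos (2 * PI * INR (S m) * a - INR (i + 2) * (PI / 2)) / (2 * PI * INR (S m)) ^ (i + 2).

(* Hurwitz' Fourier expansion of [B_j(a) / j!]. *)
Definition bern_coef (a : R) (j : nat) : R :=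
  match j with
  | O => 1
  | S O => a - 1 / 2
  | S (S i) => Series (fun m => bern_term a m i)
  end.

Lemma two_PI_S_ge_1 (m : nat) : 1 <= INR (S m) /\ 2 * INR (S m) <= 2 * PI * INR (S m).
Proof.
  pose proof (INR_S_ge_1 m). pose proof PI2_1. split; auto. nra.
Qed.

Lemma bern_term_bound (a : R) (m i : nat) : Rabs (bern_term a m i) <= / INR (S m) ^ 2.
Proof.
  destruct (two_PI_S_ge_1 m) as [H1 H2]. set (u := 2 * PI * INR (S m)) in *.
  assert (Hp : 0 < u ^ (i + 2)) by (apply pow_lt; lra).
  unfold bern_term. fold u. unfold Rdiv. rewrite !Rabs_mult, (Rabs_left (-2)), (Rabs_pos_eq (/ _)) by (try lra; left; now apply Rinv_0_lt_compat).
  pose proof (Rabs_cos_le_1 (u * a - INR (i + 2) * (PI * / 2))) as Hc.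
  assert (Hi : / u ^ (i + 2) <= / 2 * / INR (S m) ^ 2).
  { rewrite <- Rinv_mult. apply Rinv_le_contravar; [nra|].
    apply Rle_trans with (u ^ 2); [nra|]. apply Rle_pow; [lra|lia]. }
  assert (0 < / u ^ (i + 2)) by now apply Rinv_0_lt_compat. pose proof (Rabs_pos (cos (u * a - INR (i + 2) * (PI * / 2)))). nra.
Qed.

Lemma bern_term_step (a : R) (m i : nat) : bern_term a m (S (S i)) = - bern_term a m i / (2 * PI * INR (S m)) ^ 2.
Proof.
  destruct (two_PI_S_ge_1 m) as [H1 H2]. unfold bern_term. set (u := 2 * PI * INR (S m)) in *.
  replace (u * a - INR (S (S i) + 2) * (PI / 2)) with ((u * a - INR (i + 2) * (PI / 2)) - PI).
  - rewrite cos_minus, cos_PI, sin_PI. replace (S (S i) + 2)%nat with ((i + 2) + 2)%nat by lia. rewrite (pow_add u (i + 2) 2).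
    assert (u ^ (i + 2) <> 0) by (apply pow_nonzero; lra). field. split; auto. lra.
  - replace (S (S i) + 2)%nat with (S (S (i + 2))) by lia. rewrite !(S_INR). field.
Qed.

(** Raising the index by 2 shifts the phase by pi, so the even and the odd terms form two geometric
    series of ratio -z^2/u^2. Their sums are the cosine and sine parts of the partial fraction
    expansion. *)
Lemma bern_term_series (a z : R) (m : nat) : Rabs z < 1 ->
  let u := 2 * PI * INR (S m) in
  is_series (fun i => bern_term a m i * z ^ (i + 2))
    (2 * z ^ 2 * cos (u * a) / (z ^ 2 + u ^ 2) + 2 * z ^ 3 * sin (u * a) / (u * (z ^ 2 + u ^ 2))).
Proof.
  intros Hz u. destruct (two_PI_S_ge_1 m) as [H1 H2]. fold u in H2.
  set (T := fun i => bern_term a m i * z ^ (i + 2)).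
  assert (HT : forall i, T (S (S i)) = - (z ^ 2 / u ^ 2) * T i).
  { intros i. unfold T. rewrite bern_term_step. fold u. replace (S (S i) + 2)%nat with ((i + 2) + 2)%nat by lia.
    rewrite (pow_add z (i + 2) 2). field. lra. }
  assert (HS : forall p, (1 + z ^ 2 / u ^ 2) * sum_n T p = T 0%nat + T 1%nat - T (S p) - T (S (S p))).
  { induction p.
    - rewrite sum_O, HT. as_R. ring.
    - rewrite sum_n_S, Rmult_plus_distr_l, IHp, (HT (S p)). ring. }
  assert (HT0 : is_lim_seq T 0).
  { apply is_lim_seq_squeeze_0 with (fun i => Rabs z ^ i).
    2: { apply is_lim_seq_geom. now rewrite Rabs_Rabsolu. }
    intros i. rewrite Rminus_0_r. unfold T. rewrite Rabs_mult, <- RPow_abs.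
    pose proof (bern_term_bound a m i) as B. pose proof (Rabs_pos z).
    assert (/ INR (S m) ^ 2 <= 1) by (rewrite <- Rinv_1; apply Rinv_le_contravar; nra).
    assert (Rabs z ^ (i + 2) <= Rabs z ^ i).
    { rewrite pow_add. pose proof (pow_le (Rabs z) i H). assert (Rabs z ^ 2 <= 1) by nra. nra. }
    pose proof (pow_le (Rabs z) (i + 2) H). pose proof (Rabs_pos (bern_term a m i)). nra. }
  assert (Hu : 0 < u ^ 2) by nra. pose proof (pow2_ge_0 z) as Hz2.
  assert (Hzu : 0 < 1 + z ^ 2 / u ^ 2).
  { assert (0 <= z ^ 2 / u ^ 2) by (apply Rmult_le_pos; auto; left; now apply Rinv_0_lt_compat). lra. }
  apply is_series_is_lim_seq.
  apply is_lim_seq_ext with (fun p => / (1 + z ^ 2 / u ^ 2) * (T 0%nat + T 1%nat - T (S p) - T (S (S p)))).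
  - intros p. rewrite <- HS, <- Rmult_assoc, Rinv_l by lra. apply Rmult_1_l.
  - match goal with |- is_lim_seq _ (Finite ?X) => replace X with (/ (1 + z ^ 2 / u ^ 2) * (T 0%nat + T 1%nat - 0 - 0)) end.
    + apply is_lim_seq_mult'; [apply is_lim_seq_const|]. apply is_lim_seq_minus'; [apply is_lim_seq_minus'|].
      * apply is_lim_seq_const.
      * now apply (is_lim_seq_incr_1 T).
      * apply (is_lim_seq_incr_1 (fun n => T (S n))). now apply (is_lim_seq_incr_1 T).
    + unfold T, bern_term. fold u.
      replace (INR (0 + 2) * (PI / 2)) with PI by (simpl; field).
      replace (u * a - INR (1 + 2) * (PI / 2)) with ((u * a - PI) - PI / 2) by (simpl; field).
      rewrite (cos_minus (u * a - PI)), cos_PI2, sin_PI2, !cos_minus, sin_minus, cos_PI, sin_PI.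
      simpl (0 + 2)%nat. simpl (1 + 2)%nat. field. repeat split; try lra.
Qed.

(** Expanding each partial fraction in powers of z and exchanging the sums turns the expansion into
    the generating function; the first two coefficients come from its terms 1/t and 1/2 - a. *)
Lemma bern_coef_series_tail (a z : R) : 0 < a <= 1 -> Rabs z < 1 -> z <> 0 ->
  is_series (fun i => bern_coef a (S (S i)) * z ^ (i + 2)) (z * exp (a * z) / (exp z - 1) - 1 - (a - 1 / 2) * z).
Proof.
  intros Ha Hz Hz0. pose proof PI_RGT_0 as HPI.
  set (f := fun m i => bern_term a m i * z ^ (i + 2)).
  (* t = -z turns exp(-at)/(1 - exp(-t)), multiplied by -z, into z exp(az)/(exp z - 1). *)
  set (g := fun m => - z * pf_rterm (- z) a m).
  assert (Hg : is_series g (- z * (exp (- a * - z) / (1 - exp (- - z)) - / - z - (1 / 2 - a)))).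
  { apply is_series_Rmult_l. apply partial_fraction_R; auto. lra. }
  destruct (series_swap_dominated f g (fun m => / (1 - Rabs z) * / INR (S m) ^ 2)) as [_ HS].
  - intros i. apply ex_series_Rabs_le with (2 := ex_series_inv_S_sq). intros m. unfold f. rewrite Rabs_mult.
    pose proof (bern_term_bound a m i). assert (Rabs (z ^ (i + 2)) <= 1).
    { rewrite <- RPow_abs. rewrite <- (pow1 (i + 2)). apply pow_incr. pose proof (Rabs_pos z). lra. }
    pose proof (Rabs_pos (bern_term a m i)). pose proof (Rabs_pos (z ^ (i + 2))). nra.
  - intros m p. apply Rle_trans with (sum_n (fun i => / INR (S m) ^ 2 * Rabs z ^ i) p).
    + apply sum_n_Rabs_le. intros i. unfold f. rewrite Rabs_mult. apply Rmult_le_compat; auto using Rabs_pos.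
      * apply bern_term_bound.
      * rewrite <- RPow_abs, pow_add. pose proof (pow_le (Rabs z) i (Rabs_pos z)). pose proof (Rabs_pos z). assert (Rabs z ^ 2 <= 1) by nra. nra.
    + rewrite sum_n_Rmult_l, Rmult_comm. apply Rmult_le_compat_r; [left; apply inv_S_pow_pos|].
      apply sum_n_le_is_series.
      * intros i. apply pow_le, Rabs_pos.
      * apply is_series_geom. now rewrite Rabs_Rabsolu.
  - apply (ex_series_scal (/ (1 - Rabs z)) (fun m => / INR (S m) ^ 2)), ex_series_inv_S_sq.
  - intros m. replace (g m) with (2 * z ^ 2 * cos (2 * PI * INR (S m) * a) / (z ^ 2 + (2 * PI * INR (S m)) ^ 2)
       + 2 * z ^ 3 * sin (2 * PI * INR (S m) * a) / (2 * PI * INR (S m) * (z ^ 2 + (2 * PI * INR (S m)) ^ 2))).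
    + now apply bern_term_series.
    + unfold g, pf_rterm. pose proof (pf_den_pos z m). pose proof (INR_S_pos m).
      replace ((2 * PI * INR (S m)) ^ 2) with (4 * PI ^ 2 * INR (S m) ^ 2) by ring.
      replace ((- z) ^ 2) with (z ^ 2) by ring. field. repeat split; lra.
  - rewrite (is_series_unique _ _ Hg) in HS.
    replace (z * exp (a * z) / (exp z - 1) - 1 - (a - 1 / 2) * z) with (- z * (exp (- a * - z) / (1 - exp (- - z)) - / - z - (1 / 2 - a))).
    + apply is_series_ext with (2 := HS). intros i. unfold f. rewrite Series_scal_r. reflexivity.
    + replace (- a * - z) with (a * z) by ring. rewrite Ropp_involutive.
      assert (exp z - 1 <> 0).
      { intros E. apply Hz0. apply exp_inv. rewrite exp_0. lra. }
      field. repeat split; lra.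
Qed.

Lemma bern_coef_pseries (a z : R) : 0 < a <= 1 -> Rabs z < 1 -> z <> 0 ->
  is_pseries (bern_coef a) z (z * exp (a * z) / (exp z - 1)).
Proof.
  intros Ha Hz Hz0. apply is_pseries_R.
  pose proof (bern_coef_series_tail a z Ha Hz Hz0) as H.
  replace (z * exp (a * z) / (exp z - 1)) with (bern_coef a 0 * z ^ 0 + (bern_coef a 1 * z ^ 1 + (z * exp (a * z) / (exp z - 1) - 1 - (a - 1 / 2) * z))) by (simpl; ring).
  apply (is_series_cons (fun n => bern_coef a n * z ^ n)).
  apply (is_series_cons (fun n => bern_coef a (S n) * z ^ (S n))).
  apply is_series_ext with (2 := H). intros i. now replace (i + 2)%nat with (S (S i)) by lia.
Qed.

Lemma CV_radius_ge (a : nat -> R) (x : R) : ex_pseries a x -> Rbar_le (Rabs x) (CV_radius a).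
Proof.
  intros [l H]. apply is_pseries_R in H. apply Rbar_not_lt_le. intros F. apply (CV_disk_outside a x F).
  apply ex_series_lim_0. now exists l.
Qed.

(** The coefficient of z^(m+1) in (sum_j c_j z^j)(exp z - 1) = z exp(az), with c_j for
    [bern_coef a j]. The identity holds for |z| < 1/2, including z = 0 where both sides vanish. *)
Lemma bern_coef_recursion (a : R) (m : nat) : 0 < a <= 1 ->
  sum_n (fun k => bern_coef a k * / INR (fact (S m - k))) m = a ^ m * / INR (fact m).
Proof.
  intros Ha.
  set (b := PS_incr_1 (fun n => / INR (fact (S n)))).
  set (e := PS_incr_1 (fun n => a ^ n * / INR (fact n))).
  assert (Hb : forall z, is_pseries b z (exp z - 1)).
  { intros z. pose proof (is_exp_Reals z) as H. apply is_pseries_R in H. apply is_pseries_R.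
    apply is_series_ext with (fun n => / INR (fact n) * z ^ n + (if Nat.eq_dec n 0 then -1 else 0)).
    - intros n. unfold b. destruct n as [|n].
      + change (PS_incr_1 (fun n => / INR (fact (S n))) 0) with 0. destruct (Nat.eq_dec 0 0); [|lia].
        simpl. field.
      + change (PS_incr_1 (fun n => / INR (fact (S n))) (S n)) with (/ INR (fact (S n))). destruct (Nat.eq_dec (S n) 0); [lia|]. as_R. ring.
    - unfold Rminus. apply (is_series_plus (V := R_NormedModule)); auto.
      replace (Ropp 1) with (-1 + 0) by ring.
      apply (is_series_cons (fun n => if Nat.eq_dec n 0 then -1 else 0)). apply is_series_0. intros n. destruct (Nat.eq_dec (S n) 0); [lia|auto]. }
  assert (He : forall z, is_pseries e z (z * exp (a * z))).
  { intros z. pose proof (is_exp_Reals (a * z)) as H. apply is_pseries_R in H.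
    replace (z * exp (a * z)) with (@scal R_AbsRing R_NormedModule z (exp (a * z))) by reflexivity. apply is_pseries_incr_1. apply is_pseries_R.
    apply is_series_ext with (2 := H). intros n. rewrite Rpow_mult_distr. as_R. ring. }
  assert (Hrad : forall (s : nat -> R) x, ex_pseries s (1 / 2) -> Rabs x < 1 / 2 -> Rbar_lt (Rabs x) (CV_radius s)).
  { intros s x Hs Hx. apply Rbar_lt_le_trans with (1 / 2); [exact Hx|].
    replace (1 / 2) with (Rabs (1 / 2)) by (apply Rabs_pos_eq; lra). now apply CV_radius_ge. }
  assert (Exb : ex_pseries b (1 / 2)) by (eexists; apply Hb).
  assert (Exe : ex_pseries e (1 / 2)) by (eexists; apply He).
  assert (Exc : ex_pseries (bern_coef a) (1 / 2)).
  { eexists. apply bern_coef_pseries; auto; [rewrite Rabs_pos_eq; lra|lra]. }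
  assert (Hprod : forall z, Rabs z < 1 / 2 -> PSeries (PS_mult (bern_coef a) b) z = PSeries e z).
  { intros z Hz. rewrite PSeries_mult by (apply Hrad; auto).
    rewrite (is_pseries_unique _ _ _ (Hb z)), (is_pseries_unique _ _ _ (He z)).
    destruct (Req_dec z 0) as [->|Hz0].
    - rewrite exp_0. ring.
    - rewrite (is_pseries_unique _ _ _ (bern_coef_pseries a z Ha ltac:(lra) Hz0)).
      field. intros E. apply Hz0. apply exp_inv. rewrite exp_0. lra. }
  assert (H0 : Rabs 0 < 1 / 4) by (rewrite Rabs_R0; lra).
  assert (Hq : PS_mult (bern_coef a) b (S m) = e (S m)).
  { apply PSeries_ext_recip.
    - apply Rbar_lt_le_trans with (Rabs (1 / 4)); [simpl; rewrite Rabs_pos_eq; lra|]. apply CV_radius_ge.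
      apply ex_pseries_mult; apply Hrad; auto; rewrite Rabs_pos_eq; lra.
    - replace (Finite 0) with (Finite (Rabs 0)) by (now rewrite Rabs_R0). apply Hrad; auto. lra.
    - exists (mkposreal (1 / 2) ltac:(lra)). intros y Hy. apply Hprod.
      change (Rabs (y - 0) < 1 / 2) in Hy. now rewrite Rminus_0_r in Hy. }
  unfold PS_mult in Hq. rewrite <- sum_n_Reals, sum_n_S in Hq.
  replace (S m - S m)%nat with 0%nat in Hq by lia. change (b 0%nat) with 0 in Hq. rewrite Rmult_0_r, Rplus_0_r in Hq.
  change (e (S m)) with (a ^ m * / INR (fact m)) in Hq. rewrite <- Hq. apply sum_n_ext_loc. intros k Hk.
  replace (S m - k)%nat with (S (m - k)) by lia. unfold b. simpl PS_incr_1. reflexivity.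
Qed.

(** * Identification with the recursively defined Bernoulli polynomials *)

Lemma length_bern_list (a : R) (m : nat) : length (bern_list a m) = S m.
Proof. induction m; [reflexivity|]. cbn [bern_list]. rewrite length_app, IHm. simpl. lia. Qed.

Lemma nth_bern_list (a : R) (k m : nat) : (k <= m)%nat -> nth k (bern_list a m) 0 = bernoulli_poly k a.
Proof.
  intros H. induction m.
  - replace k with 0%nat by lia. reflexivity.
  - destruct (Nat.eq_dec k (S m)) as [->|]; [reflexivity|].
    cbn [bern_list]. rewrite app_nth1 by (rewrite length_bern_list; lia). apply IHm. lia.
Qed.

Lemma bernoulli_poly_S (a : R) (m : nat) :
  bernoulli_poly (S m) a = a ^ (S m) - / INR (S (S m)) * sum_n (fun k => binomR (S (S m)) k * bernoulli_poly k a) m.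
Proof.
  unfold bernoulli_poly at 1. cbn [bern_list]. rewrite app_nth2 by (rewrite length_bern_list; lia).
  rewrite length_bern_list, Nat.sub_diag. cbn [nth]. do 2 f_equal.
  apply sum_n_ext_loc. intros k Hk. now rewrite nth_bern_list.
Qed.

(** After multiplication by (m+2)!, [bern_coef_recursion] at m + 1 is the recursion behind
    [bern_list], up to the factor m + 2, so strong induction identifies the two. *)
Lemma bernoulli_poly_coef (a : R) (j : nat) : 0 < a <= 1 -> bernoulli_poly j a = INR (fact j) * bern_coef a j.
Proof.
  intros Ha. induction j as [j IH] using (well_founded_induction lt_wf). destruct j as [|m].
  - unfold bernoulli_poly. simpl. ring.
  - rewrite bernoulli_poly_S. pose proof (bern_coef_recursion a (S m) Ha) as R. rewrite sum_n_S in R.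
    replace (S (S m) - S m)%nat with 1%nat in R by lia. change (INR (fact 1)) with 1 in R. rewrite Rinv_1, Rmult_1_r in R.
    rewrite (sum_n_ext_loc _ (fun k => INR (fact (S (S m))) * (bern_coef a k * / INR (fact (S (S m) - k))))).
    + rewrite sum_n_Rmult_l. set (T := sum_n (fun k => bern_coef a k * / INR (fact (S (S m) - k))) m) in *.
      replace (bern_coef a (S m)) with (a ^ S m * / INR (fact (S m)) - T) by lra.
      replace (INR (fact (S (S m)))) with (INR (S (S m)) * INR (fact (S m))) by (rewrite <- mult_INR; reflexivity).
      pose proof (INR_fact_lt_0 (S m)). pose proof (INR_S_pos (S m)). field. lra.
    + intros k Hk. as_R. rewrite IH by lia. unfold binomR.
      pose proof (INR_fact_lt_0 k). pose proof (INR_fact_lt_0 (S (S m) - k)). field. lra.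
Qed.

Lemma cos_series2_bernoulli (a : R) : 0 < a <= 1 -> cos_series2 a = PI ^ 2 * bernoulli_poly 2 a.
Proof.
  intros Ha. rewrite bernoulli_poly_coef by auto. cbn [bern_coef]. change (INR (fact 2)) with (1 + 1).
  unfold cos_series2. rewrite <- !Series_scal_l. apply Series_ext. intros m. unfold bern_term.
  change (0 + 2)%nat with 2%nat. change (INR 2) with (1 + 1).
  replace ((1 + 1) * (PI / 2)) with PI by field. rewrite cos_minus, cos_PI, sin_PI.
  pose proof (INR_S_pos m). pose proof PI_RGT_0. field. split; lra.
Qed.

(** Euler's evaluation of zeta at even integers, as Hurwitz' expansion at a = 1. It lets zeta(N+1)/x
    become the term j = 0 of the second form. *)
Lemma zeta_bernoulli (h : nat) :
  zeta (INR (2 * h + 1) + 1) = (-1) ^ h * (2 * PI) ^ (2 * h + 2) * bernoulli (2 * h + 2) / (2 * INR (fact (2 * h + 2))).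
Proof.
  unfold bernoulli. rewrite bernoulli_poly_coef by lra.
  pose proof (INR_fact_lt_0 (2 * h + 2)) as HF. pose proof PI_RGT_0 as HPI.
  replace ((-1) ^ h * (2 * PI) ^ (2 * h + 2) * (INR (fact (2 * h + 2)) * bern_coef 1 (2 * h + 2)) / (2 * INR (fact (2 * h + 2))))
    with ((-1) ^ h * (2 * PI) ^ (2 * h + 2) / 2 * bern_coef 1 (2 * h + 2)) by (field; lra).
  replace (bern_coef 1 (2 * h + 2)) with (Series (fun m => bern_term 1 m (2 * h))).
  2: { replace (2 * h + 2)%nat with (S (S (2 * h))) by lia. reflexivity. }
  replace (2 * h + 1)%nat with (S (2 * h)) by lia. rewrite <- (is_series_unique _ _ (zeta_pow (2 * h))).
  rewrite <- Series_scal_l. apply Series_ext. intros m. unfold bern_term.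
  replace (2 * PI * INR (S m) * 1 - INR (2 * h + 2) * (PI / 2)) with (2 * PI * INR (S m) * 1 - INR (S h) * PI).
  2: { replace (INR (2 * h + 2)) with (2 * INR (S h)) by (rewrite plus_INR, mult_INR, S_INR; simpl; ring). field. }
  rewrite cos_minus, cos_2PI_nat, sin_2PI_nat.
  assert (Ec : cos (INR (S h) * PI) = (-1) ^ (S h)).
  { pose proof (cis_PI_nat (S h)) as E. apply (f_equal Re) in E. rewrite (Rmult_comm PI) in E. exact E. }
  rewrite Ec, (Rpow_mult_distr (2 * PI) (INR (S m))). change ((-1) ^ S h) with (-1 * (-1) ^ h). replace (S (S (2 * h))) with (2 * h + 2)%nat by lia.
  pose proof (m1_pow_sq h) as Hsq.
  pose proof (pow_lt (INR (S m)) (2 * h + 2) (INR_S_pos m)). assert (0 < (2 * PI) ^ (2 * h + 2)) by (apply pow_lt; lra).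
  match goal with |- _ = ?X => replace X with (((-1) ^ h * (-1) ^ h) * / INR (S m) ^ (2 * h + 2)) end.
  - rewrite Hsq. ring.
  - field. split; lra.
Qed.

(** * The transformation formula *)

(** In the right half-plane the principal argument is the plain arctangent of the slope. *)
Lemma Clog_cpolar (r th : R) : 0 < r -> - (PI / 2) < th < PI / 2 -> Clog (cpolar r th) = (ln r, th).
Proof.
  intros Hr Hth. unfold Clog. rewrite Cmod_cpolar by lra. f_equal.
  pose proof (cos_gt_0 th (proj1 Hth) (proj2 Hth)) as Hc.
  unfold Carg, cpolar; simpl. destruct (Rlt_dec 0 (r * cos th)) as [H|H].
  - replace (r * sin th / (r * cos th)) with (tan th) by (unfold tan; field; lra). now apply atan_tan.
  - exfalso. apply H. now apply Rmult_lt_0_compat.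
Qed.

Lemma IZR_sym_index (h k : nat) : IZR (- Z.of_nat h + Z.of_nat k) = INR k - INR h.
Proof. rewrite plus_IZR, opp_IZR, <- !INR_IZR_INZ. ring. Qed.

Lemma powerRZ_sym_index (h k : nat) : powerRZ (-1) (- Z.of_nat h + Z.of_nat k) = (-1) ^ (h + k).
Proof.
  rewrite powerRZ_add by lra. rewrite <- pow_powerRZ, pow_add. f_equal.
  rewrite powerRZ_neg', <- pow_powerRZ, <- pow_inv. f_equal. field.
Qed.

Lemma Csum_Z_sym (h : nat) (f : Z -> C) :
  Csum_Z (- Z.of_nat h) (Z.of_nat h) f = sum_n (fun k => f (- Z.of_nat h + Z.of_nat k)%Z) (2 * h).
Proof.
  unfold Csum_Z. replace (Z.ltb (Z.of_nat h) (- Z.of_nat h)) with false by (symmetry; apply Z.ltb_ge; lia).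
  f_equal. lia.
Qed.

(** The last quotient is the upper limit of the Bernoulli sum: j = 1 occurs for N = 1 only. *)
Lemma half_indices (h : nat) :
  ((2 * h + 1 + 3) / 2 = h + 2 /\ (2 * h + 1 + 1) / 2 = h + 1 /\ (2 * h + 1 - 1) / 2 = h /\
  (2 * h + 1 + 1) / (2 * (2 * h + 1)) = if Nat.eq_dec h 0 then 1 else 0)%nat.
Proof.
  repeat split.
  - replace (2 * h + 1 + 3)%nat with ((h + 2) * 2)%nat by lia. now apply Nat.div_mul.
  - replace (2 * h + 1 + 1)%nat with ((h + 1) * 2)%nat by lia. now apply Nat.div_mul.
  - replace (2 * h + 1 - 1)%nat with (h * 2)%nat by lia. now apply Nat.div_mul.
  - destruct (Nat.eq_dec h 0) as [->|H]; [reflexivity|]. apply Nat.div_small. lia.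
Qed.

(** The summands are abstracted into [t1] and [t2] so that both forms of the theorem, which write
    them in terms of different parameters, share the treatment of signs and indices. *)
Lemma transform_sum_Z (a x : R) (h : nat) (t1 t2 : Z -> nat -> C) :
  (forall k n, (k <= 2 * h)%nat -> t1 (- Z.of_nat h + Z.of_nat k)%Z n =
     (RtoC (cos (2 * PI * INR (S n) * a) / INR (S n)) * exp_part h x k n)%C) ->
  (forall k n, (k <= 2 * h)%nat -> t2 (- Z.of_nat h + Z.of_nat k)%Z n =
     (RtoC (sin (2 * PI * INR (S n) * a) / INR (S n)) * psi_part h x k n)%C) ->
  Cmult (RtoC ((-1) ^ ((2 * h + 1 + 3) / 2) / INR (2 * h + 1)))
    (Csum_Z (- Z.of_nat ((2 * h + 1 - 1) / 2)) (Z.of_nat ((2 * h + 1 - 1) / 2)) (fun j : Z =>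
       Cmult (RtoC (powerRZ (-1) j))
         (Cplus (CSeries (t1 j))
           (Cmult (RtoC (powerRZ (-1) j * (-1) ^ ((2 * h + 1 + 1) / 2) / PI)) (CSeries (t2 j))))))
  = transform_sum a h x.
Proof.
  intros H1 H2. destruct (half_indices h) as [E1 [E2 [E3 _]]]. rewrite E1, E2, E3, Csum_Z_sym.
  pose proof (INR_odd_pos h) as HN. pose proof PI_RGT_0 as HPI.
  rewrite (sum_n_ext_loc _ (fun k => root_sgn h k * exp_sum a h x k + RtoC ((-1) ^ (h + 1) / PI) * psi_sum a h x k)%C).
  - rewrite sum_n_Cplus, sum_n_Cmult_l. unfold transform_sum.
    set (SE := sum_n (fun k => (root_sgn h k * exp_sum a h x k)%C) (2 * h)). set (SD := sum_n (psi_sum a h x) (2 * h)).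
    transitivity (RtoC ((-1) ^ (h + 2) / INR (2 * h + 1)) * SE + RtoC ((-1) ^ (h + 2) / INR (2 * h + 1) * ((-1) ^ (h + 1) / PI)) * SD)%C.
    + rewrite (RtoC_mult (_ / _) (_ / _)). as_C. ring.
    + rewrite !pow_add, pow_1. replace ((-1) ^ h * (-1) ^ 2 / INR (2 * h + 1)) with ((-1) ^ h / INR (2 * h + 1)) by (unfold Rdiv; ring).
      replace ((-1) ^ h / INR (2 * h + 1) * ((-1) ^ h * -1 / PI)) with (- / (PI * INR (2 * h + 1))).
      * rewrite RtoC_opp. as_C. ring.
      * replace ((-1) ^ h / INR (2 * h + 1) * ((-1) ^ h * -1 / PI)) with (((-1) ^ h * (-1) ^ h) * - / (PI * INR (2 * h + 1))) by (field; lra).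
        rewrite m1_pow_sq. ring.
  - intros k Hk. as_C. rewrite powerRZ_sym_index.
    replace (CSeries (t1 (- Z.of_nat h + Z.of_nat k)%Z)) with (exp_sum a h x k).
    2: { unfold exp_sum, CSeries. f_equal; apply Series_ext; intros n; now rewrite H1. }
    replace (CSeries (t2 (- Z.of_nat h + Z.of_nat k)%Z)) with (psi_sum a h x k).
    2: { unfold psi_sum, CSeries. f_equal; apply Series_ext; intros n; now rewrite H2. }
    unfold root_sgn. rewrite Cmult_plus_distr_l, Cmult_assoc, <- RtoC_mult.
    replace ((-1) ^ (h + k) * ((-1) ^ (h + k) * (-1) ^ (h + 1) / PI)) with (((-1) ^ (h + k) * (-1) ^ (h + k)) * ((-1) ^ (h + 1) / PI)) by (unfold Rdiv; ring).
    rewrite m1_pow_sq, Rmult_1_l. reflexivity.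
Qed.

Lemma root_w_Cexp (h k : nat) (r : R) :
  Cmult (RtoC r) (Cexp (0, PI * IZR (- Z.of_nat h + Z.of_nat k) / INR (2 * h + 1))) = root_w h r k.
Proof. rewrite Cexp_cis, IZR_sym_index. unfold root_w. now rewrite cpolar_cis. Qed.

Lemma A_Nj_root_w (h k n : nat) (x : R) : 0 < x ->
  A_Nj (2 * h + 1) (- Z.of_nat h + Z.of_nat k) (INR (S n) / x) = (RtoC PI * root_w h (rho h x n) k)%C.
Proof.
  intros Hx. unfold A_Nj. rewrite RtoC_mult, <- Cmult_assoc, root_w_Cexp. unfold rho.
  now replace (2 * PI * INR (S n) / x) with (2 * PI * (INR (S n) / x)) by (unfold Rdiv; ring).
Qed.

Lemma exp_part_term (h k n : nat) (x c : R) : 0 < x -> (k <= 2 * h)%nat ->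
  (RtoC c / (RtoC (INR (S n)) * (Cexp (2 * PI * root_w h (rho h x n) k) - 1)))%C = (RtoC (c / INR (S n)) * exp_part h x k n)%C.
Proof.
  intros Hx Hk. pose proof (INR_S_pos n) as Hn. unfold exp_part. rewrite RtoC_div by lra.
  pose proof (cpolar_exp_neq_1 (rho h x n) (root_arg h k) (rho_pos h n x) (root_arg_bound h k Hk)) as H.
  fold (root_w h (rho h x n) k) in H.
  assert (RtoC (INR (S n)) <> 0) by (apply RtoC_neq_0; lra). field. split; auto.
Qed.

Lemma psi_part_log (h k n : nat) (x : R) : (k <= 2 * h)%nat ->
  (Clog (root_w h (rho h x n) k) - RtoC (1 / 2) *
     (digamma (Ci * root_w h (rho h x n) k) + digamma (- Ci * root_w h (rho h x n) k)))%C = psi_part h x k n.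
Proof.
  intros Hk. unfold psi_part. f_equal. apply Clog_cpolar; [apply rho_pos|now apply root_arg_bound].
Qed.

Lemma bernoulli_0 : bernoulli 0 = 1.
Proof. reflexivity. Qed.

Lemma transform_main_first (a x : R) (h : nat) : 0 < a <= 1 -> 0 < x ->
  transform_main kummer_const a h x =
  zeta (INR (2 * h + 1) + 1) / x
  + / INR (2 * h + 1) * ((1 / 2 - a) * ((INR (2 * h + 1) - 1) * euler_gamma - ln x) + ln_Gamma a + - (1 / 2 * ln (2 * PI)))
  + (-1) ^ ((2 * h + 1 + 3) / 2) * 2 ^ (2 * h + 1) * PI ^ (2 * h + 1 + 1) *
    sum_n_m (fun j : nat => (-1 / (4 * PI ^ 2)) ^ (j * (2 * h + 1)) *
       (bernoulli_poly (2 * j) a * bernoulli (2 * h + 1 + 1 - 2 * j * (2 * h + 1))) /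
       (INR (fact (2 * j)) * INR (fact (2 * h + 1 + 1 - 2 * j * (2 * h + 1)))) * x ^ (2 * j - 1))
     1 ((2 * h + 1 + 1) / (2 * (2 * h + 1))).
Proof.
  intros Ha Hx. pose proof PI_RGT_0 as HPI. pose proof (INR_odd_pos h) as HN.
  destruct (half_indices h) as [E1 [_ [_ E4]]]. rewrite E1, E4. unfold transform_main.
  rewrite kummer_const_value, cos_series2_bernoulli by auto.
  destruct (Nat.eq_dec h 0) as [->|H].
  (* For N = j = 1 the natural-number subtraction N + 1 - 2jN gives exactly 0, so the second
     Bernoulli factor is B_0 = 1. *)
  - rewrite sum_n_n. change (2 * 0 + 1 + 1 - 2 * 1 * (2 * 0 + 1))%nat with 0%nat. rewrite bernoulli_0.
    change (2 * 0 + 1)%nat with 1%nat in *. change (2 * 1)%nat with 2%nat. change (1 * 1)%nat with 1%nat.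
    change (2 - 1)%nat with 1%nat. change (1 + 1)%nat with 2%nat. change (0 + 2)%nat with 2%nat.
    change (INR (fact 2)) with (1 + 1). change (INR (fact 0)) with 1. change (INR 1) with 1. rewrite !pow_1. field. lra.
  - rewrite sum_n_m_zero by lia. change (@zero R_AbelianMonoid) with 0. ring.
Qed.

Lemma transform_main_second (a al be : R) (h : nat) : 0 < a <= 1 -> 0 < al -> 0 < be ->
  al * be ^ (2 * h + 1) = PI ^ (2 * h + 1 + 1) ->
  transform_main kummer_const a h (2 ^ (2 * h + 1) * al) =
  / INR (2 * h + 1) * ((a - 1) * ln (2 * PI) + ln_Gamma a)
  + (a - 1 / 2) * ((INR (2 * h + 1) - 1) * (ln 2 - euler_gamma) / INR (2 * h + 1) + ln (al / be) / (INR (2 * h + 1) + 1))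
  + (-1) ^ ((2 * h + 1 + 3) / 2) * sum_n_m (fun j : nat =>
      (-1) ^ j * bernoulli_poly (2 * j) a * bernoulli (2 * h + 1 + 1 - 2 * (2 * h + 1) * j) /
      (INR (fact (2 * j)) * INR (fact (2 * h + 1 + 1 - 2 * (2 * h + 1) * j))) *
      Rpower al (2 * INR j / (INR (2 * h + 1) + 1)) *
      Rpower be (INR (2 * h + 1) - 2 * INR (2 * h + 1) ^ 2 * INR j / (INR (2 * h + 1) + 1)))
    0 ((2 * h + 1 + 1) / (2 * (2 * h + 1))).
Proof.
  intros Ha Hal Hbe Hab. pose proof PI_RGT_0 as HPI. pose proof (INR_odd_pos h) as HN.
  destruct (half_indices h) as [E1 [_ [_ E4]]]. rewrite E1, E4. unfold transform_main.
  rewrite kummer_const_value, cos_series2_bernoulli by auto.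
  set (N := INR (2 * h + 1)) in *.
  assert (H2N : 0 < 2 ^ (2 * h + 1)) by (apply pow_lt; lra).
  (* In logarithmic form the constraint is linear; eliminating ln [be] then reduces the logarithmic
     terms to field arithmetic. *)
  assert (Hlog : ln al + N * ln be = (N + 1) * ln PI).
  { pose proof (f_equal ln Hab) as E. rewrite ln_mult in E by (auto; apply pow_lt; auto). rewrite !ln_pow in E by auto.
    rewrite (plus_INR (2 * h + 1) 1) in E. fold N in E. exact E. }
  rewrite (ln_mult (2 ^ (2 * h + 1))), ln_pow, (ln_div al), (ln_mult 2 PI) by lra. fold N.
  set (G := fun j : nat => (-1) ^ j * bernoulli_poly (2 * j) a * bernoulli (2 * h + 1 + 1 - 2 * (2 * h + 1) * j) /
      (INR (fact (2 * j)) * INR (fact (2 * h + 1 + 1 - 2 * (2 * h + 1) * j))) *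
      Rpower al (2 * INR j / (N + 1)) * Rpower be (N - 2 * N ^ 2 * INR j / (N + 1))).
  (* The term j = 0 is the zeta term: Euler's formula, with be^N replaced by pi^(N+1)/al. *)
  assert (G0 : (-1) ^ (h + 2) * G 0%nat = zeta (N + 1) / (2 ^ (2 * h + 1) * al)).
  { unfold N. rewrite zeta_bernoulli. unfold G. change (2 * 0)%nat with 0%nat. rewrite Nat.mul_0_r, Nat.sub_0_r.
    replace (2 * h + 1 + 1)%nat with (2 * h + 2)%nat in * by lia.
    change (INR 0) with 0. replace (2 * 0 / (N + 1)) with 0 by (unfold Rdiv; ring).
    replace (N - 2 * N ^ 2 * 0 / (N + 1)) with N by (unfold Rdiv; ring).
    rewrite Rpower_O by auto. unfold N. rewrite Rpower_pow by auto.
    replace (be ^ (2 * h + 1)) with (PI ^ (2 * h + 2) / al) by (rewrite <- Hab; field; lra).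
    change (bernoulli_poly 0 a) with 1. change (INR (fact 0)) with 1.
    rewrite (Rpow_mult_distr 2 PI), (pow_add (-1) h 2).
    replace (2 ^ (2 * h + 2)) with (2 * 2 ^ (2 * h + 1)) by (replace (2 * h + 2)%nat with (S (2 * h + 1)) by lia; reflexivity).
    pose proof (INR_fact_lt_0 (2 * h + 2)). rewrite pow_O. field. repeat split; lra. }
  replace (ln be) with (((N + 1) * ln PI - ln al) / N) by (apply Rmult_eq_reg_l with N; [field_simplify; lra|lra]).
  destruct (Nat.eq_dec h 0) as [Hh|Hh].
  - rewrite sum_Sn_m by lia. rewrite sum_n_n. change (@plus R_AbelianMonoid) with Rplus.
    rewrite (Rmult_plus_distr_l ((-1) ^ (h + 2)) (G 0%nat)).
    rewrite <- G0.
    (* For N = j = 1 the exponents of [al] and [be] are 1 and 0. *)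
    assert (G1 : (-1) ^ (h + 2) * G 1%nat = - (2 ^ (2 * h + 1) * al / (4 * PI ^ 2)) * (PI ^ 2 * bernoulli_poly 2 a)).
    { unfold G, N. rewrite Hh. change (2 * 0 + 1 + 1 - 2 * (2 * 0 + 1) * 1)%nat with 0%nat. rewrite bernoulli_0.
      change (2 * 0 + 1)%nat with 1%nat. change (2 * 1)%nat with 2%nat. change (INR 1) with 1. change (0 + 2)%nat with 2%nat.
      change (INR (fact 2)) with (1 + 1). change (INR (fact 0)) with 1.
      replace (2 * 1 / (1 + 1)) with 1 by field. replace (1 - 2 * 1 ^ 2 * 1 / (1 + 1)) with 0 by field.
      rewrite Rpower_1, Rpower_O, !pow_1 by auto. field. lra. }
    rewrite G1. field. split; lra.
  - rewrite sum_n_n, G0. field. split; [|split]; lra.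
Qed.

(** The N-th power of either side is 2 pi (n+1)/(2^N al), by the constraint; the comparison is made
    on logarithms. *)
Lemma rho_second (h n : nat) (al be : R) : 0 < al -> 0 < be ->
  al * be ^ (2 * h + 1) = PI ^ (2 * h + 1 + 1) ->
  be / (2 * PI) * Rpower (2 * INR (S n)) (/ INR (2 * h + 1)) = rho h (2 ^ (2 * h + 1) * al) n.
Proof.
  intros Hal Hbe Hab. pose proof PI_RGT_0 as HPI. pose proof (INR_odd_pos h) as HN. pose proof (INR_S_pos n) as Hn.
  set (N := INR (2 * h + 1)) in *. assert (H2N : 0 < 2 ^ (2 * h + 1)) by (apply pow_lt; lra).
  assert (Hlog : ln al + N * ln be = (N + 1) * ln PI).
  { pose proof (f_equal ln Hab) as E. rewrite ln_mult in E by (auto; apply pow_lt; auto). rewrite !ln_pow in E by auto.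
    rewrite (plus_INR (2 * h + 1) 1) in E. fold N in E. exact E. }
  assert (Hb0 : 0 < be / (2 * PI)) by (apply Rdiv_lt_0_compat; lra).
  apply ln_inv; [apply Rmult_lt_0_compat; [auto|apply exp_pos]|apply rho_pos|].
  assert (Hxa : 0 < 2 ^ (2 * h + 1) * al) by now apply Rmult_lt_0_compat.
  rewrite ln_rho. fold N. rewrite ln_mult; [|auto|apply exp_pos].
  unfold Rpower. rewrite ln_exp.
  rewrite (ln_div be), (ln_div (2 * PI * INR (S n))), (ln_mult 2 PI), (ln_mult (2 * PI)), (ln_mult 2 PI), (ln_mult 2 (INR (S n))), (ln_mult _ al), ln_pow; try lra.
  - fold N. replace (ln be) with (((N + 1) * ln PI - ln al) / N) by (apply Rmult_eq_reg_l with N; [field_simplify; lra|lra]).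
    field. lra.
  - apply Rmult_lt_0_compat; lra.
Qed.

Theorem theorem1p10 (a : R) (N : nat) :
  0 < a -> a <= 1 -> Nat.Odd N ->
  (forall x : R, 0 < x ->
     RtoC (Series (fun n => exp (- a * INR (S n) ^ N * x)
                            / (INR (S n) * (1 - exp (- INR (S n) ^ N * x)))))
     = Cplus (Cplus (Cplus
         (RtoC (zeta (INR N + 1) / x))
         (Cmult (RtoC (/ INR N))
            (Cplus (Cplus
               (RtoC ((1 / 2 - a) * ((INR N - 1) * euler_gamma - ln x)))
               (Clog (CGamma (RtoC a))))
               (RtoC (- (1 / 2 * ln (2 * PI)))))))
         (RtoC ((-1) ^ ((N + 3) / 2) * 2 ^ N * PI ^ (N + 1) *
                sum_n_m (fun j : nat =>
                   (-1 / (4 * PI ^ 2)) ^ (j * N) *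
                   (bernoulli_poly (2 * j) a * bernoulli (N + 1 - 2 * j * N)) /
                   (INR (fact (2 * j)) * INR (fact (N + 1 - 2 * j * N))) *
                   x ^ (2 * j - 1))
                  1 ((N + 1) / (2 * N)))))
         (Cmult (RtoC ((-1) ^ ((N + 3) / 2) / INR N))
            (Csum_Z (- Z.of_nat ((N - 1) / 2)) (Z.of_nat ((N - 1) / 2)) (fun j : Z =>
               Cmult (RtoC (powerRZ (-1) j))
                 (Cplus
                    (CSeries (fun n =>
                       Cdiv (RtoC (cos (2 * PI * INR (S n) * a)))
                            (Cmult (RtoC (INR (S n)))
                               (Cminus (Cexp (Cmult (RtoC 2) (A_Nj N j (INR (S n) / x))))
                                       (RtoC 1)))))
                    (Cmult (RtoC (powerRZ (-1) j * (-1) ^ ((N + 1) / 2) / PI))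
                       (CSeries (fun n =>
                          let A := A_Nj N j (INR (S n) / x) in
                          Cmult (RtoC (sin (2 * PI * INR (S n) * a) / INR (S n)))
                            (Cminus (Clog (Cdiv A (RtoC PI)))
                               (Cmult (RtoC (1 / 2))
                                  (Cplus (digamma (Cdiv (Cmult Ci A) (RtoC PI)))
                                         (digamma (Cdiv (Cmult (Copp Ci) A) (RtoC PI))))))))))))))
  /\
  (forall alpha beta : R, 0 < alpha -> 0 < beta -> alpha * beta ^ N = PI ^ (N + 1) ->
     Cminus
       (RtoC (Series (fun n => exp (- a * (2 * INR (S n)) ^ N * alpha)
                               / (INR (S n) * (1 - exp (- (2 * INR (S n)) ^ N * alpha))))))
       (Cmult (RtoC ((-1) ^ ((N + 3) / 2) / INR N))
          (Csum_Z (- Z.of_nat ((N - 1) / 2)) (Z.of_nat ((N - 1) / 2)) (fun j : Z =>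
             Cmult (RtoC (powerRZ (-1) j))
               (Cplus
                  (CSeries (fun n =>
                     Cdiv (RtoC (cos (2 * PI * INR (S n) * a)))
                          (Cmult (RtoC (INR (S n)))
                             (Cminus (Cexp (Cmult (RtoC (Rpower (2 * INR (S n)) (/ INR N) * beta))
                                                  (Cexp (0, PI * IZR j / INR N))))
                                     (RtoC 1)))))
                  (Cmult (RtoC (powerRZ (-1) j * (-1) ^ ((N + 1) / 2) / PI))
                     (CSeries (fun n =>
                        let B := Cmult (RtoC (beta / (2 * PI) * Rpower (2 * INR (S n)) (/ INR N)))
                                       (Cexp (0, PI * IZR j / INR N)) in
                        Cmult (RtoC (sin (2 * PI * INR (S n) * a) / INR (S n)))
                          (Cminus (Clog B)
                             (Cmult (RtoC (1 / 2))
                                (Cplus (digamma (Cmult Ci B))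
                                       (digamma (Cmult (Copp Ci) B))))))))))))
     = Cplus (Cplus
         (Cmult (RtoC (/ INR N))
            (Cplus (RtoC ((a - 1) * ln (2 * PI))) (Clog (CGamma (RtoC a)))))
         (RtoC ((a - 1 / 2) *
                ((INR N - 1) * (ln 2 - euler_gamma) / INR N
                 + ln (alpha / beta) / (INR N + 1)))))
         (RtoC ((-1) ^ ((N + 3) / 2) *
                sum_n_m (fun j : nat =>
                   (-1) ^ j * bernoulli_poly (2 * j) a * bernoulli (N + 1 - 2 * N * j) /
                   (INR (fact (2 * j)) * INR (fact (N + 1 - 2 * N * j))) *
                   Rpower alpha (2 * INR j / (INR N + 1)) *
                   Rpower beta (INR N - 2 * INR N ^ 2 * INR j / (INR N + 1)))
                  0 ((N + 1) / (2 * N))))).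
Proof.
  intros Ha0 Ha1 [h ->]. assert (Ha : 0 < a <= 1) by lra. pose proof PI_RGT_0 as HPI.
  assert (HP : RtoC PI <> 0) by (apply RtoC_neq_0; lra).
  split.
  - intros x Hx.
    transitivity (RtoC (transform_main kummer_const a h x) + transform_sum a h x)%C.
    { now apply transform_closed. }
    rewrite Clog_CGamma, <- !RtoC_plus, <- RtoC_mult, <- !RtoC_plus by auto.
    apply f_equal2.
    + f_equal. now apply transform_main_first.
    + symmetry. apply transform_sum_Z.
      * intros k n Hk. rewrite A_Nj_root_w, Cmult_assoc by auto. now apply exp_part_term.
      * intros k n Hk. cbv zeta. rewrite A_Nj_root_w by auto. rewrite <- (psi_part_log h k n x Hk).
        replace (RtoC PI * root_w h (rho h x n) k / RtoC PI)%C with (root_w h (rho h x n) k) by (field; auto).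
        replace (Ci * (RtoC PI * root_w h (rho h x n) k) / RtoC PI)%C with (Ci * root_w h (rho h x n) k)%C by (field; auto).
        replace (- Ci * (RtoC PI * root_w h (rho h x n) k) / RtoC PI)%C with (- Ci * root_w h (rho h x n) k)%C by (field; auto).
        reflexivity.
  - intros alpha beta Hal Hbe Hab.
    set (x := 2 ^ (2 * h + 1) * alpha).
    assert (Hx : 0 < x) by (apply Rmult_lt_0_compat; auto; apply pow_lt; lra).
    (* The second form carries the transformed sum on the left, so [transform_closed] leaves only
       [transform_main] to be rewritten. *)
    transitivity (RtoC (Series (lam a h x)) - transform_sum a h x)%C.
    + apply f_equal2.
      * f_equal. apply Series_ext. intros n. unfold lam, x. rewrite !Rpow_mult_distr.
        replace (- a * INR (S n) ^ (2 * h + 1) * (2 ^ (2 * h + 1) * alpha)) with (- a * (2 ^ (2 * h + 1) * INR (S n) ^ (2 * h + 1)) * alpha) by ring.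
        replace (- INR (S n) ^ (2 * h + 1) * (2 ^ (2 * h + 1) * alpha)) with (- (2 ^ (2 * h + 1) * INR (S n) ^ (2 * h + 1)) * alpha) by ring.
        reflexivity.
      * apply transform_sum_Z.
        -- intros k n Hk. rewrite root_w_Cexp, <- exp_part_term by auto. unfold x. rewrite <- (rho_second h n alpha beta) by auto.
           do 4 f_equal. unfold root_w. rewrite !cpolar_cis, !Cmult_assoc, <- !RtoC_mult. do 2 f_equal. field. lra.
        -- intros k n Hk. cbv zeta. rewrite root_w_Cexp, (rho_second h n alpha beta) by auto. fold x. now rewrite psi_part_log.
    + rewrite transform_closed by auto. rewrite Clog_CGamma, <- !RtoC_plus, <- RtoC_mult, <- !RtoC_plus by auto.
      unfold x. rewrite (transform_main_second a alpha beta h) by auto. ring.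
Qed.
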